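(* Let $P$ be a finite set of points in a metric space $(X,\delta)$ of doubling dimension $d$ (where $d$ is a constant), and let $\varepsilon \in (0,1)$. Then there exists a $(1+\varepsilon)$-tree cover $\mathcal{T}$ for $P$ with sparsity $|\mathcal{T}| = \varepsilon^{-\tilde{O}(d)}$ and individual lightness $\varepsilon^{-O(d)}$. Furthermore, every tree in $\mathcal{T}$ has maximum degree bounded by $\varepsilon^{-O(d)}$.
   Context: A metric space has doubling dimension $d$ if every ball of radius $r>0$ can be covered by at most $2^{d}$ balls of radius $r/2$. A tree cover of $P$ is a collection $\mathcal{T}$ of edge-weighted trees, each containing all points of $P$ as vertices, such that $d_T(u,v) \ge \delta(u,v)$ for every $T \in \mathcal{T}$ and $u,v\in P$. It is a $t$-tree cover if for every pair $u,v \in P$ there is a tree $T \in \mathcal{T}$ with $d_T(u,v) \le t\cdot \delta(u,v)$. The sparsity of $\mathcal{T}$ is the number of trees $|\mathcal{T}|$. The individual lightness of $\mathcal{T}$ is $\max_{T \in \mathcal{T}} w(T)/w(\mathrm{MST})$, where $w(T)$ is the total edge weight of $T$ and $w(\mathrm{MST})$ is the weight of a minimum spanning tree of $P$ (with respect to $\delta$). The notation $\tilde{O}(g)$ hides factors polylogarithmic in $g$.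
   Formalization: The bounds ε^{-O(d)} and ε^{-Õ(d)} are read as (2/ε)^{O(d)} and (2/ε)^{Õ(d)}: taken literally they tend to 1 as ε→1, which fails already for the degree bound on three points; for ε ≤ 1/2 the two forms agree up to constants in the exponent. *)

(* Defs.v *)
From mathcomp Require Import all_boot all_order all_algebra finmap.
From mathcomp Require Import all_classical all_reals all_analysis.

Set Implicit Arguments.
Unset Strict Implicit.
Unset Printing Implicit Defensive.

Import Order.TTheory GRing.Theory Num.Theory.

Local Open Scope classical_set_scope.
Local Open Scope ring_scope.

(* Balls are the open balls of the metric (ballEmdist), centred anywhere in X;
   d is a real number. *)
Definition doubling_dimension (R : realType) (X : metricType R) (d : R) : Prop :=
  forall (x : X) (r : R), 0 < r ->
    exists s : seq X, (size s)%:R <= 2 `^ d /\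
      ball x r `<=` \bigcup_(y in [set` s]) ball y (r / 2).

Definition simple_graph (V : finType) (e : rel V) : Prop :=
  symmetric e /\ irreflexive e.

(* [ucycle] also holds of the one-edge sequence [:: x; y], hence the size
   condition. *)
Definition acyclic (V : finType) (e : rel V) : Prop :=
  forall c : seq V, (2 < size c)%N -> ~ ucycle e c.

Definition is_tree (V : finType) (e : rel V) : Prop :=
  [/\ simple_graph e, (0 < #|V|)%N, forall x y : V, connect e x y & acyclic e].

Definition degree (V : finType) (e : rel V) (x : V) : nat := #|[set y | e x y]%SET|.

(* Every edge occurs in the double sum with both orientations; [w] is meant to
   be symmetric on edges. *)
Definition total_weight (R : realType) (V : finType) (e : rel V)
    (w : V -> V -> R) : R :=
  (\sum_x \sum_(y | e x y) w x y) / 2.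

(* The walk is x :: p. *)
Definition walk_weight (R : realType) (V : finType) (w : V -> V -> R)
    (x : V) (p : seq V) : R :=
  \sum_(a <- pairmap w x p) a.

Definition graph_dist (R : realType) (V : finType) (e : rel V)
    (w : V -> V -> R) (x y : V) : R :=
  inf [set walk_weight w x p | p in [set p | path e x p /\ last x p = y]].

(* An edge-weighted tree containing the points of P among its vertices: it may
   have further (Steiner) vertices, and its weights need not come from the
   metric. *)
Record weighted_tree (R : realType) (X : metricType R) (P : {fset X}) :=
  WeightedTree {
    vertex : finType;
    edge : rel vertex;
    weight : vertex -> vertex -> R;
    point : P -> vertex;
    edge_is_tree : is_tree edge;
    weight_sym : forall x y, edge x y -> weight x y = weight y x;
    weight_gt0 : forall x y, edge x y -> 0 < weight x y;
    point_inj : injective point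
  }.

Section TreeCover.
Context (R : realType) (X : metricType R) (P : {fset X}).
Implicit Types (T : weighted_tree P) (u v : P).

Definition tree_dist T u v : R :=
  graph_dist (@edge _ _ _ T) (@weight _ _ _ T) (point T u) (point T v).

Definition tree_weight T : R :=
  total_weight (@edge _ _ _ T) (@weight _ _ _ T).

Definition point_dist u v : R := mdist (val u) (val v).

(* A collection of k trees is a family indexed by 'I_k. *)
Definition tree_cover (k : nat) (T : 'I_k -> weighted_tree P) : Prop :=
  forall i u v, point_dist u v <= tree_dist (T i) u v.

Definition stretch_tree_cover (t : R) (k : nat) (T : 'I_k -> weighted_tree P) : Prop :=
  tree_cover T /\
  forall u v, exists i, tree_dist (T i) u v <= t * point_dist u v.

Definition minimum_spanning_tree (e : rel P) : Prop :=
  is_tree e /\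
  forall e' : rel P, is_tree e' ->
    total_weight e point_dist <= total_weight e' point_dist.

(* max_i w(T i) / w(MST) <= L, with the division cleared so that a one-point P,
   where w(MST) = 0, forces w(T i) = 0 instead of leaving w(T i) free. *)
Definition individual_lightness_le (k : nat) (T : 'I_k -> weighted_tree P) (L : R) : Prop :=
  forall e : rel P, minimum_spanning_tree e ->
    forall i, tree_weight (T i) <= L * total_weight e point_dist.

Definition max_degree_le T (D : R) : Prop :=
  forall x : vertex T, (degree (@edge _ _ _ T) x)%:R <= D.

End TreeCover.

(* eps^{-O(g)}, where c bounds the exponent and is the quantity that is O(g).
   The base is 2 / eps because 1 / eps tends to 1 as eps tends to 1: for
   eps <= 1/2 this lies between eps^{-c} and eps^{-2c}, and for eps near 1 it
   is a constant 2^{O(g)}. *)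
Definition eps_power (R : realType) (eps c : R) : R := (2 / eps) `^ c.

(* Main.v *)
(** Fix [eta] proportional to [eps] and a sequence of scales growing by a factor at least
    [10^4 / eta], with a set of centres pairwise 100 times farther apart than their scale. A tree
    that is almost exact around all these centres is built bottom-up. The state is a partition of
    the points into blocks, each carrying a tree, and a set of edges connecting the blocks: initially
    singletons and a finely subdivided spanning tree, embedded by Kuratowski's map. At a centre [x]
    of scale [r], the blocks near [x] are merged into one, whose tree has distances from [x] exact up
    to [8 eta r]. Their mass (weight of the edges among them plus lengths of passages through them)
    pays for it. If it exceeds the length of the passages the merged block must still provide by
    [eta r], the blocks are cut into pieces of radius about [eta r], each linked to [x]; the cost is
    [O(eta ^- 2)] times the mass consumed. Otherwise the blocks form an almost shortest path, along
    which they are simply joined. Hence the weight plus [O(eta ^- 2)] times the potential never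
    increases, which bounds the lightness.

    At each dyadic scale a net is coloured so that centres of one colour are far apart; by packing,
    [eps^{-O(d)}] colours suffice. There is one tree for each colour and each residue of the scales
    modulo [log (1 / eps)]. Factors that depend on [eps] only are [eps^{-O(d)}] too, because
    [d >= 1 / 2] as soon as there are two points. Degrees are bounded by expanding every vertex into
    a chain of negligible length. *)

Require Import Defs.
From mathcomp Require Import all_boot all_order all_algebra finmap.
From mathcomp Require Import all_classical all_reals all_analysis.
From mathcomp Require Import ring lra zify.
From mathcomp Require Import fintype finset.

Set Implicit Arguments.
Unset Strict Implicit.
Unset Printing Implicit Defensive.

Import Order.TTheory GRing.Theory Num.Theory.

Local Open Scope ring_scope.

(** * Weighted edge lists and trees *)

(** The factor [eta ^- 2] has two sources. In a star, a link of length [O(r)] is charged to about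
    [eta * r] of mass, so links cost [O(1 / eta)] times the mass of the blocks. Not all of this mass
    is freed: the merged block, or an edge in its place, must go on providing a passage, and only
    the surplus over that passage is released, which may be as small as [eta * r] out of [75 * r].
    This loses the second factor [1 / eta].

    The obstacle is that a merged block might have to provide passages between many distant parts of
    the graph. Parts that stay in the neighbourhood are absorbed. Every other part crosses an
    annulus of width about [27 * r], so a region of mass at most [75 * r] meets at most two of them
    and a single passage remains. In a heavier region the whole diameter [74 * r] of the merged
    block is granted as passage, since the mass exceeds it by a constant fraction.

    Lengths of walks are only bounded: from above by [reach], from below because all edges are at
    least as long as the pseudometric [D] ([long_edges]). *)

Section WeightedEdges.
Context (R : realFieldType) (V : finType).
Implicit Types (a b c x u v : V) (e : V * V * R) (s t : seq (V * V * R)) (l m : R).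

Definition between e a b := (e.1 == (a, b)) || (e.1 == (b, a)).

Lemma between_sym e a b : between e a b = between e b a.
Proof. by rewrite /between orbC. Qed.

Lemma betweenP e a b : reflect (e.1 = (a, b) \/ e.1 = (b, a)) (between e a b).
Proof. by apply: (iffP orP) => -[/eqP->|/eqP->]; [left|right|left|right]. Qed.

(** The length is an upper bound, so that composing, reversing and enlarging walks never requires an
    equality of lengths. *)
Inductive reach s : V -> V -> R -> Prop :=
| reach_nil a l : 0 <= l -> reach s a a l
| reach_step e a b c l m :
    e \in s -> between e a b -> reach s b c l -> e.2 + l <= m -> reach s a c m.

Lemma reach_le s a b l m : reach s a b l -> l <= m -> reach s a b m.
Proof.
case=> [c k k0 km|e {}a c {}b k {}l es eac r kl lm].
  by apply: reach_nil; apply: le_trans km.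
by apply: (reach_step es eac r); apply: le_trans lm.
Qed.

Lemma reach_sub s t a b l : {subset s <= t} -> reach s a b l -> reach t a b l.
Proof.
move=> st; elim=> [c k|e {}a c {}b k {}l es eac r rt kl]; first exact: reach_nil.
exact: (reach_step (st _ es) eac rt).
Qed.

Lemma reach_trans s b a c l m :
  reach s a b l -> reach s b c m -> reach s a c (l + m).
Proof.
move=> r; elim: r m => [d k k0|e {}a d {}b k {}l es ead r IH kl] m rm.
  by apply: reach_le rm _; lra.
by apply: (reach_step es ead (IH _ rm)); lra.
Qed.

Lemma reach_edge s e a b l : e \in s -> between e a b -> e.2 <= l -> reach s a b l.
Proof.
move=> es eab el; apply: (reach_step es eab (reach_nil _ _ (lexx 0))); lra.
Qed.

Lemma reach_sym s a b l : reach s a b l -> reach s b a l.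
Proof.
elim=> [c k|e {}a c {}b k {}l es eac r IH kl]; first exact: reach_nil.
have r' : reach s c a e.2 by apply: (@reach_edge _ e); rewrite // between_sym.
by apply: reach_le (reach_trans IH r') _; lra.
Qed.

Definition wt s : R := \sum_(e <- s) e.2.

Lemma wt_cat s t : wt (s ++ t) = wt s + wt t.
Proof. by rewrite /wt big_cat. Qed.

Lemma wt_cons e s : wt (e :: s) = e.2 + wt s.
Proof. by rewrite /wt big_cons. Qed.

Lemma wt_nil : wt [::] = 0. Proof. by rewrite /wt big_nil. Qed.

Definition positive_edges s := forall e, e \in s -> 0 < e.2.

Lemma wt_ge0 s : positive_edges s -> 0 <= wt s.
Proof. by move=> sp; rewrite /wt big_seq sumr_ge0 // => e /sp/ltW. Qed.

(** Joining disjoint trees by one edge is how every merge below builds its tree. Connectedness and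
    acyclicity in the sense of graphs are derived in [tree_connect] and [tree_acyclic]. *)
Inductive tree_on : {set V} -> seq (V * V * R) -> Prop :=
| tree_single a : tree_on [set a] [::]
| tree_join A B s t a b w :
    tree_on A s -> tree_on B t -> [disjoint A & B] -> a \in A -> b \in B ->
    0 < w -> tree_on (A :|: B) ((a, b, w) :: s ++ t).

Lemma tree_positive A s : tree_on A s -> positive_edges s.
Proof.
elim=> [a e //|{}A B {}s t a b w _ IHs _ IHt _ _ _ w0 e].
by rewrite inE mem_cat => /or3P [/eqP->|/IHs|/IHt].
Qed.

Lemma tree_neq0 A s : tree_on A s -> exists a, a \in A.
Proof.
elim=> [a|{}A B {}s t a b w _ [c cA] _ _ _ _ _ _]; first by exists a; rewrite inE.
by exists c; rewrite inE cA.
Qed.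

End WeightedEdges.
Arguments wt {R V} s.
Arguments reach_nil {R V s} a l.

Section MetricEdges.
Context (R : realFieldType) (V : finType) (D : V -> V -> R).
Hypotheses (D0 : forall x, D x x = 0) (Dsym : forall x y, D x y = D y x)
  (Dtri : forall y x z, D x z <= D x y + D y z).
Implicit Types (s t : seq (V * V * R)).

Lemma D_ge0 x y : 0 <= D x y.
Proof. by have := Dtri y x x; rewrite D0 (Dsym y x); lra. Qed.

Definition long_edges s := forall e, e \in s -> D e.1.1 e.1.2 <= e.2.

Lemma reach_dist s a b l : long_edges s -> reach s a b l -> D a b <= l.
Proof.
move=> sl; elim=> [c k|e {}a c {}b k {}l es eac _ IH kl]; first by rewrite D0.
have Dac : D a c <= e.2.
  have := sl _ es; case/betweenP: eac => -> //=; by rewrite Dsym.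
by have := Dtri c a b; lra.
Qed.

End MetricEdges.

(** * Graphs of blocks *)

Section Quotient.
Context (R : realFieldType) (V : finType) (E : seq (V * V * R)).
Implicit Types (A B C : {set V}) (S T U : {set {set V}}) (e : V * V * R).

Definition adj A B := has (fun e => (e.1.1 \in A) && (e.1.2 \in B)
  || (e.1.2 \in A) && (e.1.1 \in B)) E.

Lemma adjP A B : reflect (exists e a b, [/\ e \in E, between e a b, a \in A & b \in B])
  (adj A B).
Proof.
apply: (iffP hasP) => [[e eE /orP [] /andP [h1 h2]]|[e [a [b [eE /betweenP eab aA bB]]]]].
- by exists e, e.1.1, e.1.2; split=> //; apply/betweenP; left; case: (e.1).
- by exists e, e.1.2, e.1.1; split=> //; apply/betweenP; right; case: (e.1).
- by exists e => //; case: eab => -> /=; rewrite aA bB ?orbT.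
Qed.

Lemma adj_sym A B : adj A B = adj B A.
Proof.
by apply/adjP/adjP => -[e [a [b [eE eab aA bB]]]]; exists e, b, a; rewrite between_sym.
Qed.

Definition port a := has (fun e => (e.1.1 == a) || (e.1.2 == a)) E.

Lemma port_between e a b : e \in E -> between e a b -> port a.
Proof.
by move=> eE /betweenP eab; apply/hasP; exists e => //; case: eab => -> /=;
  rewrite eqxx ?orbT.
Qed.

(** Connectedness by cuts rather than by paths, because merges grow by one block at a time across a
    cut; [conn_connect] and [conn_comp] translate from and to paths. *)
Definition conn U := forall S, S \subset U -> S != set0 -> S != U ->
  exists C C', [/\ C \in S, C' \in U, C' \notin S & adj C C'].

Lemma conn_grow U S0 (P : {set {set V}} -> Prop) :
  conn U -> S0 \subset U -> S0 != set0 -> P S0 ->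
  (forall S C C', S0 \subset S -> S \subset U -> C \in S -> C' \in U -> C' \notin S ->
    adj C C' -> P S -> P (C' |: S)) -> P U.
Proof.
move=> cU S0U S0n PS0 step.
have [n] := ubnP #|U :\: S0|.
suff main : forall S, S0 \subset S -> S \subset U -> P S -> (#|U :\: S| < n)%N -> P U.
  by apply: main.
elim: n => // n IH S S0S SU PS; rewrite ltnS => le_n.
have [<-//|SnU] := eqVneq S U.
have Sn : S != set0.
  by apply: contra_neq S0n => S_0; apply/eqP; rewrite -finset.subset0 -S_0.
have [C [C' [CS C'U C'S CC']]] := cU S SU Sn SnU.
apply: (IH (C' |: S)); first by apply: subset_trans S0S (subsetUr _ _).
- by rewrite subUset sub1set C'U.
- exact: step CC' PS.
apply: leq_trans le_n; apply: proper_card; apply/properP; split.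
  by apply: setDS; apply: subsetUr.
by exists C'; rewrite !inE ?C'U ?C'S ?eqxx.
Qed.

Definition relU U := [rel A B | [&& A \in U, B \in U & adj A B]].

Lemma relU_sym U : symmetric (relU U).
Proof. by move=> A B /=; rewrite adj_sym andbCA. Qed.

Lemma closed_out U S : S \subset U ->
  (forall C C', C \in S -> C' \in U -> adj C C' -> C' \in S) ->
  forall A B, connect (relU U) A B -> A \in S -> B \in S.
Proof.
move=> SU cl A B /connectP [p + ->]; elim: p A => //= C p IH A /andP [/and3P [_ CU AC] pp] AS.
by apply: IH => //; apply: cl AC.
Qed.

Lemma conn_connect U : (forall A B, A \in U -> B \in U -> connect (relU U) A B) -> conn U.
Proof.
move=> cc S SU /set0Pn [A AS] SnU.
have /subsetPn [B BU BS] : ~~ (U \subset S).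
  by apply: contraNN SnU => US; rewrite finset.eqEsubset SU.
case: (boolP [exists C in S, [exists C' in U, (C' \notin S) && adj C C']]).
  by move=> /exists_inP [C CS /exists_inP [C' C'U /andP [C'S a]]]; exists C, C'.
move=> nex; case/negP: (BS); apply: (closed_out SU _ (cc _ _ (subsetP SU _ AS) BU)) => //.
move=> C C' CS C'U CC'; apply: contraNT nex => C'S.
by apply/exists_inP; exists C => //; apply/exists_inP; exists C'; rewrite ?C'S.
Qed.

Definition comp U A := [set B in U | connect (relU U) A B].

Lemma comp_sub U A : comp U A \subset U.
Proof. by apply/subsetP => B; rewrite inE => /andP []. Qed.

Lemma comp_refl U A : A \in U -> A \in comp U A.
Proof. by move=> AU; rewrite inE AU connect0. Qed.

Lemma comp_closed U A B C : B \in comp U A -> C \in U -> adj B C -> C \in comp U A.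
Proof.
rewrite !inE => /andP [BU AB] CU BC; rewrite CU; apply: connect_trans AB (connect1 _).
by rewrite /= BU CU.
Qed.

Lemma relU_connect_sym U : connect_sym (relU U).
Proof. by apply: sym_connect_sym; apply: relU_sym. Qed.

Lemma comp_conn U A : A \in U -> conn (comp U A).
Proof.
move=> AU; have key : forall B, connect (relU U) A B -> B \in U ->
    connect (relU (comp U A)) A B.
  move=> B /connectP [p + ->]; elim/last_ind: p => [|p C IH]; first by rewrite connect0.
  rewrite rcons_path last_rcons => /andP [pp /and3P [lU CU aC]] _.
  apply: connect_trans (IH pp lU) (connect1 _) => /=; rewrite !inE lU CU aC.
  have cl : connect (relU U) A (last A p) by apply/connectP; exists p.
  by rewrite cl /=; rewrite (connect_trans cl) // connect1 //= lU CU.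
apply: conn_connect => B C; rewrite !inE => /andP [BU AB] /andP [CU AC].
apply: connect_trans (key _ AC CU).
by rewrite relU_connect_sym key.
Qed.

Lemma comp_eq U A B : B \in comp U A -> comp U A = comp U B.
Proof.
rewrite inE => /andP [BU AB]; apply/setP => C; rewrite !inE.
by case: (C \in U) => //=; rewrite (same_connect (@relU_connect_sym U) AB).
Qed.

Lemma conn_comp U A B : conn U -> A \in U -> B \in U -> connect (relU U) A B.
Proof.
move=> cU AU BU; have [UE|nU] := eqVneq (comp U A) U.
  by move: BU; rewrite -{1}UE inE => /andP [].
have An : comp U A != set0 by apply/set0Pn; exists A; apply: comp_refl.
have [C [C' [CS C'U /negP C'S CC']]] := cU _ (comp_sub U A) An nU.
by case: C'S; apply: comp_closed CC'.
Qed.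

Lemma conn_sub_comp U T A : conn T -> T \subset U -> A \in T -> T \subset comp U A.
Proof.
move=> cT TU AT; apply/subsetP => B BT; rewrite inE (subsetP TU _ BT).
apply: connect_sub (conn_comp cT AT BT) => C C' /and3P [h1 h2 h3].
by apply: connect1; rewrite /= !(subsetP TU).
Qed.

Context (lam : {set V} -> R).
Definition inside A e := (e.1.1 \in A) && (e.1.2 \in A).
Definition esum (P : pred (V * V * R)) : R := \sum_(e <- E | P e) e.2.
Definition mass U : R := \sum_(C in U) lam C + esum (inside (cover U)).

Hypothesis (E0 : positive_edges E).

Implicit Types (P : pred (V * V * R)).

Lemma esum_ge0 P : 0 <= esum P.
Proof. by rewrite /esum big_seq_cond sumr_ge0 // => e /andP [/E0/ltW]. Qed.

Lemma esum2 P P1 P2 :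
  {in E, subpred P1 P} -> {in E, subpred P2 P} ->
  (forall e, e \in E -> P1 e -> ~~ P2 e) -> esum P1 + esum P2 <= esum P.
Proof.
move=> s1 s2 d; rewrite /esum big_mkcond [X in _ + X]big_mkcond [leRHS]big_mkcond -big_split /=.
rewrite big_seq [leRHS]big_seq; apply: ler_sum => e eE.
move: (E0 eE) (s1 e eE) (s2 e eE) (d e eE).
by case: (P1 e); case: (P2 e); case: (P e) => /= ? h1 h2 h3;
  try (by have := h1 isT); try (by have := h2 isT); try (by have := h3 isT); lra.
Qed.

Lemma esum1 P P1 : {in E, subpred P1 P} -> esum P1 <= esum P.
Proof.
move=> s1; have := @esum2 P P1 pred0 s1 (fun _ _ H => match notF H with end).
by rewrite {2}/esum big_pred0 // addr0; apply.
Qed.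

Lemma esum_mem P e : e \in E -> P e -> e.2 <= esum P.
Proof.
move=> eE Pe; rewrite /esum (big_rem e) //= Pe lerDl.
by rewrite big_seq_cond sumr_ge0 // => e' /andP [/mem_rem/E0/ltW].
Qed.

Lemma esum_add P P1 e :
  {in E, subpred P1 P} -> e \in E -> P e -> ~~ P1 e -> esum P1 + e.2 <= esum P.
Proof.
move=> s1 eE Pe P1e.
have eP : e.2 <= esum (pred1 e) by apply: esum_mem => /=.
suff : esum P1 + esum (pred1 e) <= esum P by lra.
apply: esum2 => // [x _ /= /eqP -> //|x _ P1x /=].
by apply: contraNN P1e => /eqP <-.
Qed.

Hypothesis (lam0 : forall C, 0 <= lam C).

Lemma coverU1 C S : cover (C |: S) = C :|: cover S.
Proof. by rewrite /cover bigcup_setU big_set1. Qed.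

Lemma cover_sub S U : S \subset U -> cover S \subset cover U.
Proof.
move=> SU; apply/bigcupsP => C CS; apply: (bigcup_max C) => //; exact: (subsetP SU).
Qed.

Lemma mem_coverP S C a : C \in S -> a \in C -> a \in cover S.
Proof. by move=> CS aC; apply/bigcupP; exists C. Qed.

Lemma W_ge0 U : 0 <= mass U.
Proof. by rewrite addr_ge0 ?esum_ge0 ?sumr_ge0. Qed.

Lemma W_sub S U : S \subset U -> mass S <= mass U.
Proof.
move=> SU; rewrite lerD //.
  by rewrite [leRHS](big_setID S) /= (setIidPr SU) lerDl sumr_ge0.
by apply: esum1 => e _ /andP [h1 h2]; apply/andP; split; apply: (subsetP (cover_sub SU)).
Qed.

Lemma triv_disjoint U S1 S2 : trivIset U -> S1 \subset U -> S2 \subset U -> [disjoint S1 & S2] ->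
  [disjoint cover S1 & cover S2].
Proof.
move=> tU s1 s2 d; rewrite -setI_eq0; apply/eqP/setP => a; rewrite !inE.
apply/negP => /andP [/bigcupP [A A1 aA] /bigcupP [B B2 aB]].
have AB : A = B.
  apply/eqP; apply: contraT => AB.
  have := trivIsetP tU A B (subsetP s1 _ A1) (subsetP s2 _ B2) AB.
  by move=> /pred0P /(_ a) /=; rewrite aA aB.
by have := disjointFr d A1; rewrite AB B2.
Qed.

Lemma W_disj S1 S2 U : S1 \subset U -> S2 \subset U -> [disjoint S1 & S2] ->
  trivIset U -> mass S1 + mass S2 <= mass U.
Proof.
move=> s1 s2 d tU; rewrite addrACA lerD //.
  rewrite [leRHS](big_setID S1) /= (setIidPr s1) lerD2l.
  have s2' : S2 \subset U :\: S1.
    by apply/subsetP => A A2; rewrite inE (subsetP s2 _ A2) andbT (disjointFl d A2).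
  by rewrite [leRHS](big_setID S2) /= (setIidPr s2') lerDl sumr_ge0.
have dc := triv_disjoint tU s1 s2 d.
apply: esum2 => e _.
- by case/andP => h1 h2; rewrite /inside !(subsetP (cover_sub s1)).
- by case/andP => h1 h2; rewrite /inside !(subsetP (cover_sub s2)).
- by case/andP => h1 _; rewrite /inside (disjointFr dc h1).
Qed.

(** The end [b] of [e] lies in a block disjoint from [cover S], so [e] was not counted before: the
    increase of the mass pays for the edge and for the passage through the new block. *)
Lemma W_grow U S C e a b : trivIset U -> S \subset U -> C \in U -> C \notin S ->
  e \in E -> between e a b -> a \in cover S -> b \in C ->
  mass S + lam C + e.2 <= mass (C |: S).
Proof.
move=> tU SU CU CS eE eab aS bC.
have bS : b \notin cover S.
  have : [disjoint cover [set C] & cover S].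
    by apply: triv_disjoint tU _ SU _; rewrite ?sub1set // disjoints1.
  by rewrite {1}/cover big_set1 => /disjointFr ->.
suff h : esum (inside (cover S)) + e.2 <= esum (inside (cover (C |: S))).
  by rewrite /mass big_setU1 //=; lra.
rewrite coverU1; apply: esum_add => //.
- by move=> x _ /andP [h1 h2]; rewrite /inside !inE h1 h2 !orbT.
- by case/betweenP: eab => h; rewrite /inside h /= !inE aS bC !orbT.
by case/betweenP: eab => h; rewrite /inside h /= (negbTE bS) ?andbF.
Qed.

End Quotient.

(** * Merging blocks *)

Section Merge.
Context (R : realFieldType) (V : finType) (D : V -> V -> R).
Hypotheses (D0 : forall x, D x x = 0) (Dsym : forall x y, D x y = D y x)
  (Dtri : forall y x z, D x z <= D x y + D y z).
Context (E : seq (V * V * R)) (lam : {set V} -> R) (tr : {set V} -> seq (V * V * R)) (h : R).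
Hypotheses (E0 : positive_edges E) (Elong : long_edges D E) (lam0 : forall C, 0 <= lam C)
  (h0 : 0 <= h).
Implicit Types (A B C : {set V}) (S : {set {set V}}).
Local Notation W := (mass E lam).

(* Only the ports of a block are within [lam C] of each other; any other vertex first pays the
   diameter bound [h]. *)
Definition slack a : R := if port E a then 0 else h.

Lemma slack_ge0 a : 0 <= slack a. Proof. by rewrite /slack; case: ifP. Qed.
Lemma slack_le a : slack a <= h. Proof. by rewrite /slack; case: ifP. Qed.

Lemma slack_port e a b : e \in E -> between e a b -> slack a = 0 /\ slack b = 0.
Proof.
move=> eE eab; rewrite /slack (port_between eE eab).
by rewrite (port_between (b := a) eE) // between_sym.
Qed.

Context (U : {set {set V}}).
Hypotheses (tU : trivIset U) (treeU : forall C, C \in U -> tree_on C (tr C))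
  (longU : forall C, C \in U -> long_edges D (tr C))
  (lamU : forall C a b, C \in U -> a \in C -> b \in C ->
    reach (tr C) a b (lam C + slack a + slack b))
  (diamU : forall C a b, C \in U -> a \in C -> b \in C -> reach (tr C) a b h).

Definition trees_weight S : R := \sum_(C in S) wt (tr C).

(** The last clause makes the mass a bound on the tree distance between any two ports; the weight
    clause charges the joining edges to the edges of [E] inside the cover. *)
Definition spans S s := [/\ tree_on (cover S) s /\ long_edges D s,
  forall C, C \in S -> {subset tr C <= s},
  wt s <= trees_weight S + esum E (inside (cover S)) &
  forall a b, a \in cover S -> b \in cover S -> reach s a b (W S + slack a + slack b)].

Lemma cover1 C : cover [set C] = C. Proof. by rewrite /cover big_set1. Qed.

Lemma spans1 C : C \in U -> spans [set C] (tr C).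
Proof.
move=> CU; split; rewrite ?cover1 /trees_weight ?big_set1.
- by split; [apply: treeU|apply: longU].
- by move=> C' /set1P ->.
- by rewrite lerDl esum_ge0.
- move=> a b aC bC; apply: reach_le (lamU CU aC bC) _.
  have := esum_ge0 E0 (inside C).
  by rewrite /mass big_set1 cover1; lra.
Qed.

Lemma disj_block S C : S \subset U -> C \in U -> C \notin S -> [disjoint cover S & C].
Proof.
move=> SU CU CS.
have CU1 : [set C] \subset U by rewrite sub1set.
by have := triv_disjoint tU SU CU1; rewrite cover1; apply; rewrite disjoint_sym disjoints1.
Qed.

(** A walk from [S] into [C] goes through the ports [a] and [b], whose slack is zero, so the
    increase [lam C + e.2] of the mass covers its new part. *)
Lemma spans_grow S s C e a b : S \subset U -> C \in U -> C \notin S -> e \in E ->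
  between e a b -> a \in cover S -> b \in C -> spans S s ->
  spans (C |: S) ((a, b, e.2) :: s ++ tr C).
Proof.
move=> SU CU CS eE eab aS bC [[ts sl] sub ws rs].
have d := disj_block SU CU CS.
have [pa pb] := slack_port eE eab.
have Wg := W_grow lam E0 tU SU CU CS eE eab aS bC.
have Dab : D a b <= e.2.
  have := Elong eE; by case/betweenP: eab => -> //=; rewrite Dsym.
set s' := _ :: _.
have ss : {subset s <= s'} by move=> x xs; rewrite inE mem_cat xs orbT.
have st : {subset tr C <= s'} by move=> x xs; rewrite inE mem_cat xs !orbT.
have rab : reach s' a b e.2.
  by apply: (@reach_edge _ _ _ (a, b, e.2)) => //; rewrite ?mem_head // /between /= eqxx.
split.
- rewrite coverU1 setUC; split.
    by apply: tree_join => //; [apply: treeU|apply: E0].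
  move=> x; rewrite inE mem_cat => /or3P [/eqP -> //|/sl //|]; exact: (longU CU).
- move=> C'; rewrite !inE => /orP [/eqP -> //|/sub h' x /h']; exact: ss.
- rewrite wt_cons wt_cat /trees_weight big_setU1 //=.
  suff : esum E (inside (cover S)) + e.2 <= esum E (inside (cover (C |: S))).
    by move: ws; rewrite /trees_weight; lra.
  rewrite coverU1; apply: esum_add => //.
  + by move=> x _ /andP [h1 h2]; rewrite /inside !inE h1 h2 !orbT.
  + by case/betweenP: eab => k; rewrite /inside k /= !inE aS bC !orbT.
  + by case/betweenP: eab => k; rewrite /inside k /= (disjointFl d bC) ?andbF.
have key x y : x \in cover S -> y \in C -> reach s' x y (W (C |: S) + slack x + slack y).
  move=> xS yC; apply: (@reach_le _ _ _ _ _ ((W S + slack x + slack a) +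
    (e.2 + (lam C + slack b + slack y)))).
    apply: reach_trans (reach_sub ss (rs _ _ xS aS)) _.
    exact: reach_trans rab (reach_sub st (lamU CU bC yC)).
  by rewrite pa pb; lra.
have e2 := E0 eE; have WS := W_ge0 E0 lam0 S; have lC := lam0 C.
move=> x y; rewrite coverU1 !inE => /orP [xC|xS] /orP [yC|yS].
- by apply: reach_le (reach_sub st (lamU CU xC yC)) _; lra.
- by apply: reach_sym; apply: reach_le (key _ _ yS xC) _; lra.
- exact: key.
- by apply: reach_le (reach_sub ss (rs _ _ xS yS)) _; lra.
Qed.

(** Blocks outside [S0] hang from the tree of [S0], and a walk from [S0] to them uses only mass
    beyond that of [S0]. If [S0] has almost all of the mass, these detours are short. *)
Lemma spans_conn S0 s0 : conn E U -> S0 \subset U -> S0 != set0 -> spans S0 s0 ->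
  exists s, [/\ spans U s, {subset s0 <= s} &
    forall v, v \in cover U -> exists2 a, a \in cover S0 & reach s a v (W U - W S0 + h)].
Proof.
move=> cU S0U S0n sp0.
suff [s [sp ss rr]] : exists s, [/\ spans U s, {subset s0 <= s} &
    forall v, v \in cover U -> exists2 a, a \in cover S0 & reach s a v (W U - W S0 + slack v)].
  exists s; split=> // v /rr [a aS r]; exists a => //; apply: reach_le r _.
  by have := slack_le v; lra.
apply: (conn_grow (P := fun S => exists s, [/\ spans S s, {subset s0 <= s} &
    forall v, v \in cover S -> exists2 a, a \in cover S0 & reach s a v (W S - W S0 + slack v)])
    cU S0U S0n).
  exists s0; split=> // v vS; exists v => //; apply: reach_nil.
  by have := slack_ge0 v; lra.
move=> S B C S0S SU BS CU CS /adjP [e [a [b [eE eab aB bC]]]] [s [sp ss rr]].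
have aS : a \in cover S by apply: mem_coverP aB.
exists ((a, b, e.2) :: s ++ tr C); split; first exact: spans_grow.
  by move=> x xs; rewrite inE mem_cat ss ?orbT.
have [pa pb] := slack_port eE eab.
have Wg := W_grow lam E0 tU SU CU CS eE eab aS bC.
have e2 := E0 eE; have lC := lam0 C.
set s' := _ :: _.
have ss' : {subset s <= s'} by move=> x xs; rewrite inE mem_cat xs orbT.
have st : {subset tr C <= s'} by move=> x xs; rewrite inE mem_cat xs !orbT.
move=> v; rewrite coverU1 !inE => /orP [vC|/rr [x xS r]]; last first.
  by exists x => //; apply: reach_le (reach_sub ss' r) _; lra.
have [x xS r] := rr _ aS; exists x => //.
apply: (@reach_le _ _ _ _ _ ((W S - W S0 + slack a) + (e.2 + (lam C + slack b + slack v)))).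
  apply: reach_trans (reach_sub ss' r) _.
  apply: reach_trans (reach_sub st (lamU CU bC vC)).
  by apply: (@reach_edge _ _ _ (a, b, e.2)) => //; rewrite ?mem_head // /between /= eqxx.
by rewrite pa pb; lra.
Qed.

(** Along a simple path of blocks, the stretches from [p] to [x], from [x] to [u] and from [u] to
    [q] use disjoint parts of the mass, in this order or with [x] and [u] exchanged. At the far end
    the bound has [slack q] rather than [h]: it vanishes when the path goes on through the port [q],
    so the error in [h] does not accumulate along the path. *)
Lemma path_tight p B0 (P : seq {set V}) : path (relU E U) B0 P -> B0 \in U -> uniq (B0 :: P) ->
  p \in B0 -> exists s, let S := [set C in B0 :: P] in [/\ spans S s, S \subset U,
    (forall x q, x \in cover S -> q \in last B0 P ->
      exists2 l, reach s x q l & D p x + l <= W S + 4 * h + slack q) &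
    (forall x u q, x \in cover S -> u \in cover S -> q \in last B0 P ->
      exists2 l, reach s x u l & D p x + l + D u q <= W S + 8 * h + slack q \/
        D p u + l + D x q <= W S + 8 * h + slack q)].
Proof.
have RD := reach_dist D0 Dsym Dtri; have h0' := h0.
elim/last_ind: P => [_ BU _ pB|P C IH].
  exists (tr B0) => S; have -> : S = [set B0] by apply/setP => x; rewrite !inE.
  have WB := W_ge0 E0 lam0 [set B0].
  have diam x y : x \in B0 -> y \in B0 -> D x y <= h.
    by move=> xB yB; apply: RD (longU BU) (diamU BU xB yB).
  rewrite cover1; split; [exact: spans1|by rewrite sub1set| |] => /=.
    move=> x q xB qB; exists h; first exact: diamU.
    by have := diam _ _ pB xB; have := slack_ge0 q; lra.
  move=> x u q xB uB qB; exists h; first exact: diamU.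
  left; have := diam _ _ pB xB; have := diam _ _ uB qB; have := slack_ge0 q; lra.
rewrite rcons_path -rcons_cons rcons_uniq => /andP [pP /and3P [BU CU]].
move=> /adjP [e [a [b [eE eab aL bC]]]] B0U /andP [CP uP] pB.
have [s [sp SU al ga]] := IH pP B0U uP pB.
set S := [set C0 in B0 :: P] in sp SU al ga.
have CS : C \notin S by rewrite inE.
have -> : [set C0 in rcons (B0 :: P) C] = C |: S.
  by apply/setP => x; rewrite !inE mem_rcons !inE orbCA.
have aS : a \in cover S by apply: mem_coverP aL; rewrite inE mem_last.
have pS : p \in cover S by apply: mem_coverP pB; rewrite inE mem_head.
have := spans_grow SU CU CS eE eab aS bC sp.
set s' := (a, b, e.2) :: s ++ tr C => sp'.
have ss' : {subset s <= s'} by move=> x xs; rewrite inE mem_cat xs orbT.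
have st : {subset tr C <= s'} by move=> x xs; rewrite inE mem_cat xs !orbT.
have [pa pb] := slack_port eE eab.
have Wg := W_grow lam E0 tU SU CU CS eE eab aS bC.
have e2 := E0 eE; have lC := lam0 C; have WS := W_ge0 E0 lam0 S.
have rab : reach s' a b e.2.
  by apply: (@reach_edge _ _ _ (a, b, e.2)) => //; rewrite ?mem_head // /between /= eqxx.
case: (sp') => -[_ sl'] _ _ _; case: (sp) => -[_ sl] _ _ rs.
have Dab : D a b <= e.2 by apply: RD sl' rab.
have diam x y : x \in C -> y \in C -> D x y <= h.
  by move=> xB yB; apply: RD (longU CU) (diamU CU xB yB).
have diamb y : y \in C -> D b y <= lam C + slack y.
  move=> yC; apply: RD (longU CU) (reach_le (lamU CU bC yC) _); rewrite pb; lra.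
have DpS y : y \in cover S -> D p y <= W S + h + slack y.
  move=> yS; apply: RD sl (reach_le (rs _ _ pS yS) _).
  by have := slack_le p; lra.
have Dpa := DpS _ aS.
have DpC y : y \in C -> D p y <= W S + e.2 + 2 * h.
  move=> yC; have := Dtri a p y; have := Dtri b a y; have := diam _ _ bC yC; lra.
exists s'; rewrite last_rcons; split=> //.
- by rewrite subUset sub1set CU.
- move=> x q; rewrite coverU1 !inE => /orP [xC|xS] qC.
    exists h; first exact: reach_sub st (diamU CU xC qC).
    by have := DpC _ xC; have := slack_ge0 q; lra.
  have [l rl Hl] := al _ _ xS aL.
  exists (l + (e.2 + (lam C + slack b + slack q))).
    apply: reach_trans (reach_sub ss' rl) _.
    exact: reach_trans rab (reach_sub st (lamU CU bC qC)).
  by move: Hl; rewrite pa pb; lra.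
have mixed x u q : x \in cover S -> u \in C -> q \in C ->
  exists2 l, reach s' x u l & D p x + l + D u q <= W (C |: S) + 8 * h + slack q.
  move=> xS uC qC; have [l rl Hl] := al _ _ xS aL.
  exists (l + (e.2 + h)).
    apply: reach_trans (reach_sub ss' rl) _.
    exact: reach_trans rab (reach_sub st (diamU CU bC uC)).
  by move: Hl; rewrite pa; have := diam _ _ uC qC; have := slack_ge0 q; lra.
move=> x u q; rewrite coverU1 !inE => /orP [xC|xS] /orP [uC|uS] qC.
- exists h; first exact: reach_sub st (diamU CU xC uC).
  left; have := DpC _ xC; have := diam _ _ uC qC; have := slack_ge0 q; lra.
- have [l rl Hl] := mixed _ _ _ uS xC qC.
  by exists l; [exact: reach_sym|right; lra].
- by have [l rl Hl] := mixed _ _ _ xS uC qC; exists l => //; left; lra.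
have [l rl Hl] := ga _ _ _ xS uS aL.
exists l; first exact: reach_sub rl.
have dq := diamb _ qC.
by move: Hl; rewrite pa => -[Hl|Hl]; [left|right];
  [have := Dtri a u q|have := Dtri a x q]; have := Dtri b a q; lra.
Qed.

(** Let [w = W U - D p q]. Between points of the path, the triangle inequality through [p] and [q]
    bounds the excess over [D] by the excess of the path over [D p q]. The path alone has mass at
    least [D p q - 2 * h], so all other points hang at distance at most [w + 3 * h]. Each of two
    hanging ends counts twice, in the walk and in comparing [D x' u'] with [D x u]; four plus one
    for the path gives the factor 5. *)
Lemma tight_merge p q : conn E U -> p \in cover U -> q \in cover U ->
  exists2 s, spans U s & forall x u, x \in cover U -> u \in cover U ->
    reach s x u (D x u + 5 * (W U - D p q) + 21 * h).
Proof.
move=> cU /bigcupP [Bp BpU pB] /bigcupP [Bq BqU qB].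
have RD := reach_dist D0 Dsym Dtri; have h0' := h0.
have [P pP lP] := connectP (conn_comp cU BpU BqU).
move: lP; case: (shortenP pP) => P' pP' uP' _ lP.
have [s0 [sp0 SU al ga]] := path_tight pP' BpU uP' pB.
set S := [set C in Bp :: P'] in sp0 SU al ga.
have pS : p \in cover S by apply: mem_coverP pB; rewrite inE mem_head.
have qS : q \in cover S by apply: mem_coverP qB; rewrite lP inE mem_last.
have Sn : S != set0 by apply/set0Pn; exists Bp; rewrite inE mem_head.
have [s [sp ss rr]] := spans_conn cU SU Sn sp0.
have WSU := W_sub E0 lam0 SU.
case: (sp) => -[_ sl] _ _ _; case: (sp0) => -[_ sl0] _ _ rs0.
have Dpq : D p q <= W S + 2 * h.
  apply: RD sl0 (reach_le (rs0 _ _ pS qS) _).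
  have := slack_le p; have := slack_le q; lra.
exists s => // x u xU uU.
have [x' x'S rx] := rr _ xU; have [u' u'S ru] := rr _ uU.
have qL : q \in last Bp P' by rewrite -lP.
have [l rl Hl] := ga _ _ _ x'S u'S qL.
have Hx := RD _ _ _ _ sl rx; have Hu := RD _ _ _ _ sl ru.
apply: reach_le (reach_trans (reach_sym rx) (reach_trans (reach_sub ss rl) ru)) _.
have := Dtri x' p q; have := Dtri u' x' q; have := Dtri u' p q; have := Dtri x' u' q.
have := Dtri x x' u'; have := Dtri u x u'; rewrite (Dsym u u') (Dsym u' x').
by have := slack_le q; case: Hl; lra.
Qed.
End Merge.

(** * Merging by links to a centre *)

Section StarMerge.
Context (R : realFieldType) (V : finType) (D : V -> V -> R).
Hypotheses (D0 : forall x, D x x = 0) (Dsym : forall x y, D x y = D y x)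
  (Dtri : forall y x z, D x z <= D x y + D y z).
Context (E : seq (V * V * R)) (lam : {set V} -> R) (tr : {set V} -> seq (V * V * R)) (h : R).
Hypotheses (E0 : positive_edges E) (Elong : long_edges D E) (lam0 : forall C, 0 <= lam C)
  (h0 : 0 <= h).
Implicit Types (A B C : {set V}) (S K T U : {set {set V}}).
Local Notation W := (mass E lam).

Local Notation slack := (slack E h).
Context (U : {set {set V}}).
Hypotheses (tU : trivIset U) (treeU : forall C, C \in U -> tree_on C (tr C))
  (longU : forall C, C \in U -> long_edges D (tr C))
  (lamU : forall C a b, C \in U -> a \in C -> b \in C ->
    reach (tr C) a b (lam C + slack a + slack b))
  (diamU : forall C a b, C \in U -> a \in C -> b \in C -> reach (tr C) a b h).
Local Notation tw := (trees_weight tr).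

(** Induction along a rooted spanning tree without constructing one: [U2] is the component of a
    neighbour [B] of the root in [K] without the root, so it touches the rest of [K] only at the
    root. *)
Lemma rooted_ind (P : {set {set V}} -> {set V} -> Prop) :
  (forall A, A \in U -> P [set A] A) ->
  (forall U1 U2 A B, U1 \subset U -> U2 \subset U -> [disjoint U1 & U2] ->
    A \in U1 -> B \in U2 -> adj E A B -> P U1 A -> P U2 B -> P (U1 :|: U2) A) ->
  forall K A, K \subset U -> conn E K -> A \in K -> P K A.
Proof.
move=> P1 PU K A; have [n] := ubnP #|K|.
elim: n => // n IH in K A *; rewrite ltnS => Kn KU cK AK.
have [->|K1] := eqVneq K [set A]; first by apply: P1; apply: (subsetP KU).
have AsK : [set A] \subset K by rewrite sub1set.
have A1 : [set A] != set0 by apply/set0Pn; exists A; rewrite inE.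
have [A' [B [/set1P -> BK BA AB]]] := cK _ AsK A1 (contra_neq esym K1).
set K' := K :\ A; set U2 := comp E K' B; set U1 := K :\: U2.
have BK' : B \in K' by rewrite !inE BK -in_set1 BA.
have BU2 : B \in U2 by apply: comp_refl.
have U2K' : U2 \subset K' := comp_sub E K' B.
have U2K : U2 \subset K by apply: subset_trans U2K' (subsetDl _ _).
have AU2 : A \notin U2 by apply: contraTN (isT) => /(subsetP U2K'); rewrite !inE eqxx.
have AU1 : A \in U1 by rewrite inE AU2.
have U1K : U1 \subset K by apply: subsetDl.
(* Blocks of [U1] not connected to [A] would still have an edge to the rest of [K]. It cannot end in
   the component of [A], and if it ended in [U2] they would belong to [U2]. *)
have cU1 : conn E U1.
  have [<-|nU1] := eqVneq (comp E U1 A) U1; first exact: comp_conn.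
  set S := comp E U1 A in nU1; set T := U1 :\: S.
  have SU1 : S \subset U1 := comp_sub E U1 A.
  have AS : A \in S by apply: comp_refl.
  have Tn : T != set0.
    apply: contraNneq nU1 => /eqP; rewrite setD_eq0 => U1S.
    by rewrite finset.eqEsubset SU1.
  have TK : T \subset K by apply: subset_trans U1K; apply: subsetDl.
  have TnK : T != K by apply: contraTneq AK => <-; rewrite inE AS.
  have [C [C' [CT C'K C'T CC']]] := cK _ TK Tn TnK.
  move: CT; rewrite inE => /andP [CS CU1].
  case: (boolP (C' \in S)) => C'S.
    by case/negP: CS; apply: comp_closed C'S CU1 _; rewrite adj_sym.
  have C'U2 : C' \in U2.
    by apply: contraNT C'T => C'U2; rewrite inE C'S inE C'U2.
  have : C \in U2; last by move: CU1; rewrite inE => /andP [/negP].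
  apply: comp_closed C'U2 _ _; last by rewrite adj_sym.
  rewrite !inE (subsetP U1K _ CU1) andbT.
  by apply: contraNneq CS => ->.
have disj : [disjoint U1 & U2] by rewrite -setI_eq0 setIDAC setDIl setDv setI0.
rewrite -(setID K U2) setUC (setIidPr U2K).
apply: (PU _ _ _ B) => //.
- exact: subset_trans U1K KU.
- exact: subset_trans U2K KU.
- apply: IH => //; last exact: subset_trans U1K KU.
  apply: leq_trans Kn; apply: proper_card; apply/properP; split => //.
  by exists B => //; rewrite inE BU2.
- apply: IH => //; [|exact: subset_trans U2K KU|exact: comp_conn].
  by apply: leq_trans Kn; apply: proper_card; apply/properP; split => //; exists A.
Qed.

Context (x : V) (kappa zeta H : R).
Hypotheses (zeta0 : 0 < zeta) (hH : 8 * h <= H)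
  (xU : forall v, v \in cover U -> D x v <= kappa)
  (lam_h : forall C, C \in U -> lam C <= h)
  (edge_h : forall e a b, e \in E -> between e a b -> a \in cover U -> b \in cover U -> e.2 <= h).

(** Twice the radius [H + 2 * h] of a piece with centre [c], once for the walk inside the piece and
    once for comparing [D x c] with [D x v], plus the [zeta] of the link. *)
Definition err := 2 * H + 4 * h + zeta.

(** Quantified over the tree to be extended, so that pieces can be attached one after the other
    ([hangU]). The positive [zeta] is there because [D x c] may vanish for distinct vertices, while
    edges must have positive weight. *)
Definition hangable K n := forall A s, x \in A -> [disjoint A & cover K] ->
  tree_on A s -> long_edges D s ->
  exists s', [/\ tree_on (A :|: cover K) s' /\ long_edges D s',
    {subset s <= s'} /\ (forall C, C \in K -> {subset tr C <= s'}),
    wt s' <= wt s + tw K + esum E (inside (cover K)) + (kappa + zeta) *+ n &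
    forall v, v \in cover K -> reach s' x v (D x v + err)].

Lemma cover0 : cover (set0 : {set {set V}}) = set0.
Proof. by rewrite /cover big_set0. Qed.

Lemma hang0 : hangable set0 0.
Proof.
move=> A s xA _ ts sl; exists s; split=> //.
- by rewrite cover0 setU0.
- by split=> // C; rewrite inE.
- by rewrite mulr0n /trees_weight big_set0 !addr0 lerDl esum_ge0.
- by move=> v; rewrite cover0 inE.
Qed.

Lemma disjoint_setU (T : finType) (A B C : {set T}) :
  [disjoint A :|: B & C] = [disjoint A & C] && [disjoint B & C].
Proof. by rewrite -!setI_eq0 setIUl setU_eq0. Qed.

Lemma coverU K1 K2 : cover (K1 :|: K2) = cover K1 :|: cover K2.
Proof. by rewrite /cover bigcup_setU. Qed.

Lemma trees_weightU K1 K2 : [disjoint K1 & K2] ->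
  tw (K1 :|: K2) = tw K1 + tw K2.
Proof. by move=> d; rewrite /trees_weight -bigU //; apply: eq_bigl => C; rewrite !inE. Qed.

Lemma esum_insideU K1 K2 : K1 \subset U -> K2 \subset U -> [disjoint K1 & K2] ->
  esum E (inside (cover K1)) + esum E (inside (cover K2)) <=
  esum E (inside (cover (K1 :|: K2))).
Proof.
move=> s1 s2 d; have dc := triv_disjoint tU s1 s2 d; rewrite coverU.
apply: esum2 => // e _ /andP [h1 h2]; rewrite /inside ?inE ?h1 ?h2 ?orbT //.
by rewrite (disjointFr dc h1).
Qed.

Lemma esum_link K1 K2 e a b : K1 \subset U -> K2 \subset U -> [disjoint K1 & K2] ->
  e \in E -> between e a b -> a \in cover K1 -> b \in cover K2 ->
  esum E (inside (cover K1)) + (esum E (inside (cover K2)) + e.2) <=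
  esum E (inside (cover (K1 :|: K2))).
Proof.
move=> s1 s2 d eE eab aK1 bK2.
have dK := triv_disjoint tU s1 s2 d; rewrite coverU.
pose P2 f := inside (cover K2) f || (f == e).
have : esum E (inside (cover K2)) + e.2 <= esum E P2.
  apply: esum_add => //; rewrite /P2 ?eqxx ?orbT //; first by move=> f _ /= ->.
  by case/betweenP: eab => k; rewrite /inside k /= (disjointFr dK aK1) ?andbF.
suff : esum E (inside (cover K1)) + esum E P2 <= esum E (inside (cover K1 :|: cover K2)) by lra.
apply: esum2 => // f _.
+ by move=> /andP [k1 k2]; rewrite /inside !inE k1 k2.
+ case/orP => [/andP [k1 k2]|/eqP ->]; first by rewrite /inside !inE k1 k2 !orbT.
  by case/betweenP: eab => k; rewrite /inside k /= !inE aK1 bK2 !orbT.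
case/andP => k1 k2; apply/negP => /orP [/andP [k3 _]|/eqP fe].
  by move: k3; rewrite (disjointFr dK k1).
move: k1 k2; rewrite fe; case/betweenP: eab => k; rewrite k /=.
  by rewrite (disjointFl dK bK2).
by rewrite (disjointFl dK bK2).
Qed.

Lemma hangU K1 K2 n1 n2 : K1 \subset U -> K2 \subset U -> [disjoint K1 & K2] ->
  hangable K1 n1 -> hangable K2 n2 -> hangable (K1 :|: K2) (n1 + n2).
Proof.
move=> s1 s2 d h1 h2 A s xA dA ts sl.
have dc := triv_disjoint tU s1 s2 d.
have [dA1 dA2] : [disjoint A & cover K1] /\ [disjoint A & cover K2].
  by move: dA; rewrite coverU disjoint_sym disjoint_setU !(disjoint_sym _ A) => /andP.
have [t1 [[tt1 lt1] [st1 str1] w1 r1]] := h1 A s xA dA1 ts sl.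
have dt1 : [disjoint A :|: cover K1 & cover K2] by rewrite disjoint_setU dA2.
have xt1 : x \in A :|: cover K1 by rewrite inE xA.
have [t2 [[tt2 lt2] [st2 str2] w2 r2]] := h2 _ t1 xt1 dt1 tt1 lt1.
exists t2; split.
- by rewrite coverU setUA.
- split; first by move=> e /st1/st2.
  by move=> C; rewrite inE => /orP [/str1 k e /k/st2|/str2].
- have := esum_insideU s1 s2 d; rewrite trees_weightU // mulrnDr.
  by move: w1 w2; lra.
by move=> v; rewrite coverU inE => /orP [/r1 r|/r2 //]; exact: reach_sub st2 r.
Qed.

Lemma hang_piece K s c : K \subset U -> c \in cover K -> tree_on (cover K) s -> long_edges D s ->
  (forall C, C \in K -> {subset tr C <= s}) ->
  wt s <= tw K + esum E (inside (cover K)) ->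
  (forall v, v \in cover K -> reach s c v (H + 2 * h)) -> hangable K 1.
Proof.
move=> KU cK ts sl st sw rs A t xA dA tt tl.
have Dc : 0 <= D x c := D_ge0 D0 Dsym Dtri x c.
have z0 := zeta0.
have xc : D x c <= kappa by apply: xU; apply: (subsetP (cover_sub KU)).
exists ((x, c, D x c + zeta) :: t ++ s); set s' := _ :: _.
have ss : {subset s <= s'} by move=> e es; rewrite inE mem_cat es !orbT.
have stt : {subset t <= s'} by move=> e es; rewrite inE mem_cat es !orbT.
split.
- split; first by apply: tree_join => //; lra.
  move=> e; rewrite inE mem_cat => /or3P [/eqP -> /=|/tl //|/sl //]; lra.
- by split=> // C /st k e /k/ss.
- by rewrite wt_cons wt_cat /= mulr1n; lra.
move=> v vK; have r := rs _ vK.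
have Dcv := reach_dist D0 Dsym Dtri sl r.
apply: (@reach_le _ _ _ _ _ ((D x c + zeta) + (H + 2 * h))).
  apply: reach_trans (reach_sub ss r).
  by apply: (@reach_edge _ _ _ (x, c, D x c + zeta)); rewrite ?mem_head // /between eqxx.
by have := Dtri v x c; rewrite (Dsym v c) /err; lra.
Qed.

(* Cutting a rooted tree of blocks bottom-up as soon as the height exceeds [H]: every piece but
   the root piece has weight at least [H / 4]. *)
Lemma root_piece K A : K \subset U -> conn E K -> A \in K ->
  exists K0 s eta n,
    [/\ [/\ K0 \subset K, A \in K0, hangable (K :\: K0) n & (H / 4) *+ n + eta <= W K],
      [/\ tree_on (cover K0) s, long_edges D s, forall C, C \in K0 -> {subset tr C <= s} &
        wt s <= tw K0 + esum E (inside (cover K0))] &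
      lam A <= eta <= H /\
      forall a v, a \in A -> v \in cover K0 -> reach s a v (eta + slack a + slack v)].
Proof.
have h0' := h0; have hH' := hH.
move=> KU cK AK; move: K A KU cK AK; apply: rooted_ind
  => [A AU|K1 K2 A B s1 s2 d A1 B2 /adjP [e [a [b [eE eab aA bB]]]]].
  exists [set A], (tr A), (lam A), 0%N; rewrite cover1; split.
  - rewrite setDv mulr0n add0r inE; split=> //; first exact: hang0.
    by rewrite /mass big_set1 lerDl esum_ge0.
  - split; [exact: treeU|exact: longU|by move=> C /set1P ->|].
    by rewrite /trees_weight big_set1 lerDl esum_ge0.
  split; first by rewrite lexx /=; have := lam_h AU; lra.
  by move=> a v; apply: lamU.
move=> [T1 [t1 [eta1 [n1 [[T1K AT1 hg1 w1] [tt1 l1 st1 tw1] [e1 r1]]]]]].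
move=> [T2 [t2 [eta2 [n2 [[T2K BT2 hg2 w2] [tt2 l2 st2 tw2] [e2 r2]]]]]].
have dT : [disjoint T1 & T2] by apply: disjointWl T1K _; apply: disjointWr T2K _.
have T1U := subset_trans T1K s1; have T2U := subset_trans T2K s2.
have dc := triv_disjoint tU T1U T2U dT.
have [sa sb] := slack_port h eE eab.
have aT1 : a \in cover T1 := mem_coverP AT1 aA.
have bT2 : b \in cover T2 := mem_coverP BT2 bB.
have eh : e.2 <= h.
  by apply: edge_h eE eab _ _; [exact: (subsetP (cover_sub T1U))|exact: (subsetP (cover_sub T2U))].
have AU := subsetP s1 _ A1; have BU := subsetP s2 _ B2.
have Dab : D a b <= e.2.
  have := Elong eE; by case/betweenP: eab => -> //=; rewrite Dsym.
have Wsum : W K1 + W K2 + e.2 <= W (K1 :|: K2).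
  rewrite /mass.
  have -> : \sum_(C in K1 :|: K2) lam C = \sum_(C in K1) lam C + \sum_(C in K2) lam C.
    by rewrite -bigU //; apply: eq_bigl => C; rewrite !inE.
  suff : esum E (inside (cover K1)) + (esum E (inside (cover K2)) + e.2) <=
    esum E (inside (cover (K1 :|: K2))) by lra.
  by apply: esum_link eE eab _ _ => //; [apply: mem_coverP A1 aA|apply: mem_coverP B2 bB].
have ee := E0 eE; have lA := lam0 A.
(* [eta2] bounds the height of the root piece of [K2]. If the height stays below [H] when prolonged
   through [e] and the block [A], the two root pieces are joined; otherwise that of [K2] becomes a
   piece with a link of its own. *)
case: (leP (lam A + e.2 + eta2) H) => hc.
  exists (T1 :|: T2), ((a, b, e.2) :: t1 ++ t2), (Num.max eta1 (lam A + e.2 + eta2)), (n1 + n2)%N.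
  set s' := _ :: _.
  have ss1 : {subset t1 <= s'} by move=> f fs; rewrite inE mem_cat fs !orbT.
  have ss2 : {subset t2 <= s'} by move=> f fs; rewrite inE mem_cat fs !orbT.
  split.
  - split; first exact: setUSS.
    + by rewrite inE AT1.
    + have -> : (K1 :|: K2) :\: (T1 :|: T2) = (K1 :\: T1) :|: (K2 :\: T2).
        apply/setP => C; rewrite !inE.
        have := disjointFr d (x := C); have := subsetP T1K C; have := subsetP T2K C.
        case: (C \in K1); case: (C \in K2); case: (C \in T1); case: (C \in T2) => //= h1 h2 h3;
          by [have := h1 isT|have := h2 isT|have := h3 isT].
      apply: hangU => //; [exact: subset_trans (subsetDl _ _) s1|
        exact: subset_trans (subsetDl _ _) s2|].
      by apply: disjointWl (subsetDl _ _) _; apply: disjointWr (subsetDl _ _) _.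
    rewrite mulrnDr; case/andP: e1 => e1 _; case/andP: e2 => e2 _; have lB := lam0 B.
    by case: (leP eta1) => _; move: w1 w2 Wsum; lra.
  - split.
    + by rewrite coverU; apply: tree_join.
    + by move=> f; rewrite inE mem_cat => /or3P [/eqP ->|/l1|/l2].
    + by move=> C; rewrite inE => /orP [/st1 k f /k/ss1|/st2 k f /k/ss2].
    rewrite wt_cons wt_cat trees_weightU //=.
    suff : esum E (inside (cover T1)) + (esum E (inside (cover T2)) + e.2) <=
      esum E (inside (cover (T1 :|: T2))) by lra.
    exact: esum_link eE eab aT1 bT2.
  split; first by rewrite le_max ge_max hc; case/andP: e1 => -> ->.
  move=> a' v a'A; rewrite coverU inE => /orP [vT1|vT2].
    apply: reach_le (reach_sub ss1 (r1 _ _ a'A vT1)) _.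
    by rewrite -!addrA lerD2r le_max lexx.
  apply: (@reach_le _ _ _ _ _ ((lam A + slack a' + slack a) + (e.2 + (eta2 + slack b + slack v)))).
    apply: reach_trans (reach_sub ss1 (reach_sub (st1 _ AT1) (lamU AU a'A aA))) _.
    apply: reach_trans (reach_sub ss2 (r2 _ _ bB vT2)).
    by apply: (@reach_edge _ _ _ (a, b, e.2)); rewrite ?mem_head // /between eqxx.
  rewrite sa sb; have : lam A + e.2 + eta2 <= Num.max eta1 (lam A + e.2 + eta2).
    by rewrite le_max lexx orbT.
  lra.
exists T1, t1, eta1, (n1 + n2.+1)%N; split=> //; split=> //.
- exact: subset_trans T1K (subsetUl _ _).
- have -> : (K1 :|: K2) :\: T1 = (K1 :\: T1) :|: K2.
    apply/setP => C; rewrite !inE.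
    have := disjointFr d (x := C); have := subsetP T1K C.
    case: (C \in K1); case: (C \in K2); case: (C \in T1) => //= h2 h3;
      by [have := h2 isT|have := h3 isT].
  apply: hangU => //; first exact: subset_trans (subsetDl _ _) s1.
    by apply: disjointWl (subsetDl _ _) _.
  rewrite -addn1 -(setID K2 T2) setUC (setIidPr T2K).
  apply: hangU => //; first exact: subset_trans (subsetDl _ _) s2.
    by rewrite -setI_eq0 setIDAC setDIl setDv setI0.
  apply: (hang_piece (c := b) T2U bT2 tt2 l2 st2 tw2) => v vT2.
  by apply: reach_le (r2 _ _ bB vT2) _; case/andP: e2 => _; rewrite sb; have := slack_le E h0 v; lra.
(* The piece cut off has height [eta2 > H - 2 * h >= H / 4], and this part of the mass of [K2] pays
   for the additional link. *)
have := lam_h AU; rewrite mulrnDr mulrSr; move: w1 w2 Wsum hc.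
case/andP: e2 => _; lra.
Qed.

(** Here the root piece needs a link too, and its mass has no lower bound: one link more than the
    mass pays for. *)
Lemma hang_conn K A : K \subset U -> conn E K -> A \in K ->
  exists2 n, hangable K n.+1 & (H / 4) *+ n <= W K.
Proof.
move=> KU cK AK; have h0' := h0; have hH' := hH.
have [K0 [s [eta [n [[K0K AK0 hg w] [ts sl st sw] [e r]]]]]] := root_piece KU cK AK.
have lA := lam0 A; case/andP: e => e1 e2.
exists n; last by lra.
rewrite -(setID K K0) setUC (setIidPr K0K) -addn1.
have K0U := subset_trans K0K KU.
have [c cA] := tree_neq0 (treeU (subsetP KU _ AK)).
apply: hangU => //; first exact: subset_trans (subsetDl _ _) KU.
  by rewrite -setI_eq0 setIDAC setDIl setDv setI0.
apply: (hang_piece (c := c) K0U (mem_coverP AK0 cA) ts sl st sw) => v vK.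
by apply: reach_le (r _ _ cA vK) _; have := slack_le E h0 v; have := slack_le E h0 c; lra.
Qed.

(** The one unpaid link of each component is charged to its mass of at least [H / 4], which halves
    the rate to [H / 8]. *)
Lemma hang_comps T : T \subset U -> (forall C, C \in T -> comp E U C \subset T) ->
  (forall C, C \in T -> H / 4 <= W (comp E U C)) ->
  exists2 n, hangable T n & (H / 8) *+ n <= W T.
Proof.
have [n] := ubnP #|T|; elim: n => // n IH in T *; rewrite ltnS => Tn TU cT wT.
have [->|/set0Pn [C CT]] := eqVneq T set0.
  by exists 0%N; [exact: hang0|rewrite mulr0n W_ge0].
have CU := subsetP TU _ CT; set K := comp E U C.
have KT : K \subset T by apply: cT.
have CK : C \in K by apply: comp_refl.
have KU := subset_trans KT TU.
have [m hg wm] := hang_conn KU (comp_conn CU) CK.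
have [||||m' hg' wm'] := IH (T :\: K).
- apply: leq_trans Tn; apply: proper_card; apply/properP; split; first exact: subsetDl.
  by exists C => //; rewrite inE CK.
- exact: subset_trans (subsetDl _ _) TU.
- move=> B; rewrite inE => /andP [BK BT]; apply/subsetP => B' B'B.
  rewrite inE (subsetP (cT _ BT) _ B'B) andbT; apply: contraNN BK => B'K.
  by rewrite /K (comp_eq B'K) -(comp_eq B'B); apply: comp_refl; apply: (subsetP TU).
- by move=> B; rewrite inE => /andP [_ /wT].
have dK : [disjoint T :\: K & K] by rewrite -setI_eq0 setIDAC setDIl setDv setI0.
have DU : T :\: K \subset U by apply: subset_trans (subsetDl _ _) TU.
have UE : (T :\: K) :|: K = T by rewrite setUC -{1}(setIidPr KT) setID.
exists (m' + m.+1)%N; first by rewrite -UE; apply: hangU.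
have := W_disj E0 lam0 (subsetDl T K) KT dK (trivIsetS TU tU).
have := wT _ CT; rewrite -/K mulrnDr mulrSr; move: wm wm'.
set a := H / 4 *+ m; have -> : H / 8 *+ m = a / 2.
  by rewrite /a mulrnAl; congr (_ *+ _); lra.
lra.
Qed.

(** The root piece of the component of [A] contains [x] and gets no link, so that this component may
    be arbitrarily light; every other component must pay for at least one link. *)
Lemma star_merge A : A \in U -> x \in A ->
  (forall C, C \in U -> C \notin comp E U A -> H / 4 <= W (comp E U C)) ->
  exists s N, [/\ tree_on (cover U) s /\ long_edges D s,
    forall C, C \in U -> {subset tr C <= s},
    wt s <= tw U + esum E (inside (cover U)) + (kappa + zeta) *+ N /\
      (H / 8) *+ N <= W U &
    forall v, v \in cover U -> reach s x v (D x v + err)].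
Proof.
move=> AU xA wU; have h0' := h0; have hH' := hH; have z0 := zeta0.
set K := comp E U A; set T := U :\: K.
have KU : K \subset U := comp_sub E U A.
have AK : A \in K by apply: comp_refl.
have TU : T \subset U by apply: subsetDl.
have [K0 [s [eta [n [[K0K AK0 hg w] [ts sl st sw] [/andP [e1 e2] r]]]]]] :=
  root_piece KU (comp_conn AU) AK.
have [||m hgT wT] := hang_comps TU.
- move=> C; rewrite inE => /andP [CK CU]; apply/subsetP => B BC.
  rewrite inE (subsetP (comp_sub E U C) _ BC) andbT; apply: contraNN CK => BK.
  by rewrite /K (comp_eq BK) -(comp_eq BC); apply: comp_refl.
- by move=> C; rewrite inE => /andP [CK CU]; apply: wU.
have K0U := subset_trans K0K KU.
have KKU : K :\: K0 \subset U by apply: subset_trans (subsetDl _ _) KU.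
have dKT : [disjoint K & T] by rewrite disjoint_sym -setI_eq0 setIDAC setDIl setDv setI0.
have dK : [disjoint K :\: K0 & T] by apply: disjointWl (subsetDl _ _) dKT.
have UE : U = K0 :|: ((K :\: K0) :|: T).
  have -> : K0 :|: ((K :\: K0) :|: T) = K :|: T.
    by rewrite setUA -[X in X :|: _ :|: _](setIidPr K0K) setID.
  by rewrite -[X in _ = X :|: _](setIidPr KU) setID.
have dK0 : [disjoint K0 & (K :\: K0) :|: T].
  rewrite disjoint_sym disjoint_setU; apply/andP; split.
    by rewrite -setI_eq0 setIDAC setDIl setDv setI0.
  by rewrite disjoint_sym; apply: disjointWl K0K dKT.
have KTU : (K :\: K0) :|: T \subset U by rewrite subUset KKU TU.
have dc := triv_disjoint tU K0U KTU dK0.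
have xK0 : x \in cover K0 := mem_coverP AK0 xA.
have [s' [ts' [ss' st'] ws' rs']] := hangU KKU TU dK hg hgT xK0 dc ts sl.
exists s', (n + m)%N; rewrite -{1}coverU -UE in ts'; split=> //.
- by move=> C; rewrite {1}UE inE => /orP [/st k e /k/ss'|/st'].
- split.
    have := esum_insideU K0U KTU dK0; rewrite -UE.
    have := trees_weightU dK0; rewrite -UE; move: sw ws'; lra.
  have := W_disj E0 lam0 KU TU dKT tU; have lA := lam0 A.
  have : H / 8 *+ n <= H / 4 *+ n by rewrite lerMn2r; apply/orP; right; lra.
  by rewrite mulrnDr; move: w wT; lra.
move=> v; rewrite {1}UE coverU inE => /orP [vK|/rs' //].
apply: reach_le (reach_sub ss' (r _ _ xA vK)) _; rewrite /err.
have := D_ge0 D0 Dsym Dtri x v; have := slack_le E h0 v; have := slack_le E h0 x; lra.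
Qed.

End StarMerge.

(** * Merging the blocks around one centre *)

Section States.
Context (R : realFieldType) (V : finType) (D : V -> V -> R).
Hypotheses (D0 : forall x, D x x = 0) (Dsym : forall x y, D x y = D y x)
  (Dtri : forall y x z, D x z <= D x y + D y z).
Implicit Types (A B C T : {set V}) (S U : {set {set V}}).

(* Blocks, with a tree inside each of them; edges [ed] connecting the blocks; [lam C] bounds the
   tree distances between those vertices of [C] at which some edge of [ed] ends. *)
Record state := State {
  bl : {set {set V}};
  tr : {set V} -> seq (V * V * R);
  lam : {set V} -> R;
  ed : seq (V * V * R) }.
Implicit Type st : state.

(* Connectedness of the graph obtained by contracting the sets of [S]. *)
Definition linked S (E : seq (V * V * R)) := forall T, T != set0 ->
  (forall C a b, C \in S -> a \in C -> b \in C -> a \in T -> b \in T) ->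
  (forall e a b, e \in E -> between e a b -> a \in T -> b \in T) -> T = setT.

Record ok st : Prop := Ok {
  ok_triv : trivIset (bl st);
  ok_cover : cover (bl st) = setT;
  ok_tree : forall C, C \in bl st -> tree_on C (tr st C);
  ok_long : forall C, C \in bl st -> long_edges D (tr st C);
  ok_pos : positive_edges (ed st);
  ok_edlong : long_edges D (ed st);
  ok_lam : forall C, 0 <= lam st C;
  ok_port : forall C a b, C \in bl st -> a \in C -> b \in C ->
    port (ed st) a -> port (ed st) b -> reach (tr st C) a b (lam st C);
  ok_linked : linked (bl st) (ed st) }.

Lemma ok_neq0 st C : ok st -> C \in bl st -> exists a, a \in C.
Proof. by move=> o CS; apply: tree_neq0 (ok_tree o CS). Qed.

Lemma ok_block st a : ok st -> exists2 C, C \in bl st & a \in C.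
Proof.
move=> o; have : a \in cover (bl st) by rewrite (ok_cover o) inE.
by case/bigcupP => C; exists C.
Qed.

Lemma same_block S C B a : trivIset S -> C \in S -> B \in S -> a \in C -> a \in B -> C = B.
Proof.
move=> tS CS BS aC aB; apply/eqP; apply: contraT => CB.
have /disjointFr d := trivIsetP tS C B CS BS CB. by have := d _ aC; rewrite aB.
Qed.

(** The union of a set of blocks without outgoing edge is closed under blocks and edges, hence
    everything by [linked]. *)
Lemma ok_conn st : ok st -> conn (ed st) (bl st).
Proof.
move=> o S Sb /set0Pn [A AS] SnU.
case: (boolP [exists C in S, [exists C' in bl st, (C' \notin S) && adj (ed st) C C']]).
  by move=> /exists_inP [C CS /exists_inP [C' C'U /andP [C'S a]]]; exists C, C'.
move=> nex; have [a aA] := ok_neq0 o (subsetP Sb _ AS).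
have T_cover : cover S = setT.
  apply: (ok_linked o).
  - by apply/set0Pn; exists a; apply: mem_coverP aA.
  - move=> C b c CS bC cC /bigcupP [B BS bB].
    by rewrite (same_block (ok_triv o) CS (subsetP Sb _ BS) bC bB) in cC; apply: mem_coverP cC.
  - move=> e b c eE ebc /bigcupP [B BS bB].
    have [C CS cC] := ok_block c o; apply: (mem_coverP (C := C)) => //.
    apply: contraNT nex => CnS; apply/exists_inP; exists B => //; apply/exists_inP; exists C => //.
    by rewrite CnS /=; apply/adjP; exists e, b, c.
case/negP: SnU; rewrite finset.eqEsubset Sb; apply/subsetP => C CS.
have [c cC] := ok_neq0 o CS; have : c \in cover S by rewrite T_cover inE.
by case/bigcupP => B BS cB; rewrite (same_block (ok_triv o) CS (subsetP Sb _ BS) cC cB).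
Qed.

Definition upd (X : Type) (f : {set V} -> X) T (y : X) C := if C == T then y else f C.

Definition merge st U s l E :=
  State (cover U |: (bl st :\: U)) (upd (tr st) (cover U) s) (upd (lam st) (cover U) l) E.

Lemma cover_notin st U C : ok st -> U \subset bl st -> C \in bl st :\: U -> C != cover U.
Proof.
move=> o Ub; rewrite inE => /andP [CU Cb]; apply/negP => /eqP CE.
have [c cC] := ok_neq0 o Cb; move: (cC); rewrite CE => /bigcupP [B BU cB].
by case/negP: CU; rewrite (same_block (ok_triv o) Cb (subsetP Ub _ BU) cC cB).
Qed.

(** No new port may arise outside the merged block, because the old values of [lam] only bound
    distances between old ports. *)
Lemma merge_ok st U s l E : ok st -> U \subset bl st -> tree_on (cover U) s ->
  long_edges D s -> 0 <= l -> positive_edges E -> long_edges D E ->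
  (forall a, a \notin cover U -> port E a -> port (ed st) a) ->
  (forall a b, a \in cover U -> b \in cover U -> port E a -> port E b -> reach s a b l) ->
  linked (cover U |: (bl st :\: U)) E -> ok (merge st U s l E).
Proof.
move=> o Ub ts sl l0 Ep El pout pin lk.
have dU C : C \in bl st :\: U -> [disjoint cover U & C].
  rewrite inE => /andP [CU Cb].
  have C1 : [set C] \subset bl st by rewrite sub1set.
  have := triv_disjoint (ok_triv o) Ub C1; rewrite cover1; apply.
  by rewrite disjoint_sym disjoints1.
split=> //=.
- apply/trivIsetP => A B; rewrite !in_setU1 => /orP [/eqP ->|Ab] /orP [/eqP ->|Bb].
  + by rewrite eqxx.
  + by move=> _; apply: dU.
  + by move=> _; rewrite disjoint_sym; apply: dU.
  by apply: (trivIsetP (ok_triv o)); [move: Ab|move: Bb]; rewrite inE => /andP [].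
- apply/setP => a; rewrite coverU1 !inE.
  have [C Cb aC] := ok_block a o; have [CU|CU] := boolP (C \in U).
    by rewrite (mem_coverP CU aC).
  by apply/orP; right; apply: (mem_coverP (C := C)) => //; rewrite inE CU.
- move=> C; rewrite in_setU1 /upd => /orP [/eqP ->|CbU]; first by rewrite eqxx.
  by rewrite (negbTE (cover_notin o Ub CbU)); apply: (ok_tree o); move: CbU; rewrite inE => /andP [].
- move=> C; rewrite in_setU1 /upd => /orP [/eqP ->|CbU]; first by rewrite eqxx.
  by rewrite (negbTE (cover_notin o Ub CbU)); apply: (ok_long o); move: CbU; rewrite inE => /andP [].
- by move=> C; rewrite /upd; case: ifP => // _; apply: (ok_lam o).
move=> C a b; rewrite in_setU1 /upd => /orP [/eqP ->|CbU] aC bC pa pb.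
  by rewrite eqxx; apply: pin.
rewrite (negbTE (cover_notin o Ub CbU)); apply: (ok_port o) => //.
- by move: CbU; rewrite inE => /andP [].
- by apply: pout => //; rewrite (disjointFl (dU _ CbU) aC).
- by apply: pout => //; rewrite (disjointFl (dU _ CbU) bC).
Qed.

(** Edges count both here and in [total], hence their factor [1 + gain] in the energy. *)
Definition potential st : R := \sum_(C in bl st) lam st C + wt (ed st).
Definition total st : R := \sum_(C in bl st) wt (tr st C) + wt (ed st).

Lemma merge_sum st U (f : {set V} -> R) y : ok st -> U \subset bl st ->
  \sum_(C in cover U |: (bl st :\: U)) upd f (cover U) y C =
  \sum_(C in bl st) f C - \sum_(C in U) f C + y.
Proof.
move=> o Ub; rewrite big_setU1 /=; last first.
  by apply/negP => /(cover_notin o Ub); rewrite eqxx.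
rewrite {1}/upd eqxx [in RHS](big_setID U) /= (setIidPr Ub).
rewrite (eq_bigr f); first by ring.
by move=> C /(cover_notin o Ub)/negbTE; rewrite /upd => ->.
Qed.

Lemma merge_potential st U s l E : ok st -> U \subset bl st ->
  potential (merge st U s l E) =
  potential st - \sum_(C in U) lam st C + l - wt (ed st) + wt E.
Proof. by move=> o Ub; rewrite /potential /= merge_sum //; ring. Qed.

Lemma merge_total st U s l E : ok st -> U \subset bl st ->
  total (merge st U s l E) =
  total st - \sum_(C in U) wt (tr st C) + wt s - wt (ed st) + wt E.
Proof.
move=> o Ub; rewrite /total /=.
rewrite (eq_bigr (upd (fun C => wt (tr st C)) (cover U) (wt s))) => [|C _].
  by rewrite merge_sum //; ring.
by rewrite /upd; case: ifP.
Qed.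

End States.

(** * Numerical energy balances *)

Section Arithmetic.
Context (R : realFieldType).
Implicit Types (p q r w c g l S i : R).

(** [p] is [eta * r] times the number of links and [w] the mass of the region. As [75 * r <= w], at
    least [w / 75] is released, and [300 * 100 / 75 = 400] exceeds [34 * 8]. *)
Lemma star_cost p w q r : 0 <= r -> p <= 8 * w ->
  (300 * 100) * (w - 74 * r) <= q -> 75 * r <= w -> 34 * p <= q.
Proof. lra. Qed.

Lemma ge_75_74 w r : 0 <= r -> 75 * r <= w -> 0 <= w - 74 * r.
Proof. lra. Qed.

(** The cost [c] of the links is paid by the consumed passages [S] and edges [i], less the passage
    [l] of the new block; [w] is the weight of all edges. *)
Lemma star_energy c s tw i g l S w : c <= g * (S + i - l) -> s <= tw + i + c ->
  s + g * l + (1 + g) * (w - i) <= tw + g * S + (1 + g) * w.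
Proof.
have -> : (1 + g) * (w - i) = w - i + g * w - g * i by ring.
have -> : (1 + g) * w = w + g * w by ring.
have -> : g * (S + i - l) = g * S + g * i - g * l by ring.
lra.
Qed.

(** With mass at most [75 * r] the links need at most [34 * 8 * 75 = 20400] of the [30000] units
    that the surplus is worth. That is less than [21 / 30]; the remaining [9 / 30] serve in
    [bridge_energy]. *)
Lemma bridge_cost p w q r : 0 <= r -> p <= 8 * w -> w <= 75 * r ->
  (300 * 100) * r <= q -> 34 * p <= 21 / 30 * q.
Proof. lra. Qed.

(** The edges may become heavier by [dl + h], less the consumed [i]. The dominant term [g * dl] is
    covered by [dl + e <= S + i], and the surplus [g * e] pays for [c], [dl], [h] and [g * h]. *)
Lemma bridge_energy c s tw i g S w w' dl h e r : 0 <= r -> 0 < g ->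
  s <= tw + i + c -> c <= 21 / 30 * (g * e) ->
  (300 * 100) * r <= g * e -> dl <= 66 * r -> h <= r -> 100 * h <= e -> dl + e <= S + i ->
  w' + i <= w + dl + h ->
  s + g * 0 + (1 + g) * w' <= tw + g * S + (1 + g) * w.
Proof.
move=> r0 g0 ws hc gr d1 h1 he hS hw.
have g1 : g * (100 * h) <= g * e by rewrite ler_pM2l.
have g2 : g * (dl + e) <= g * (S + i) by rewrite ler_pM2l.
have g3 : g * (w' + i) <= g * (w + dl + h) by rewrite ler_pM2l.
have -> : (1 + g) * w = w + g * w by ring.
have -> : (1 + g) * w' = w' + g * w' by ring.
have e1 : g * (100 * h) = 100 * (g * h) by ring.
have e2 : g * (dl + e) = g * dl + g * e by ring.
have e3 : g * (S + i) = g * S + g * i by ring.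
have e4 : g * (w' + i) = g * w' + g * i by ring.
have e5 : g * (w + dl + h) = g * w + g * dl + g * h by ring.
rewrite e1 in g1; rewrite e2 e3 in g2; rewrite e4 e5 in g3; rewrite mulr0.
move: (g * h) (g * e) (g * dl) (g * S) (g * i) (g * w) (g * w') g1 g2 g3 hc gr.
by move=> *; lra.
Qed.

End Arithmetic.

(** * The blocks around one centre *)

Section Step.
Context (R : realFieldType) (V : finType) (D : V -> V -> R).
Hypotheses (D0 : forall x, D x x = 0) (Dsym : forall x y, D x y = D y x)
  (Dtri : forall y x z, D x z <= D x y + D y z).
Implicit Types (A B C T : {set V}) (S U Q Y : {set {set V}}).

Context (st : state R V) (o : ok D st) (x : V) (r eta h : R).
Hypotheses (r0 : 0 < r) (eta0 : 0 < eta) (eta1 : eta <= 1) (h0 : 0 <= h)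
  (hr : 100 * h <= eta * r)
  (near_diam : forall C v, C \in bl st -> v \in C -> D x v <= 40 * r ->
    lam st C <= h /\ forall a b, a \in C -> b \in C -> reach (tr st C) a b h)
  (near_edge : forall e a b, e \in ed st -> between e a b -> D x a <= 40 * r -> e.2 <= h).
Local Notation E := (ed st).
Local Notation W := (mass E (lam st)).
Local Notation conn := (conn E).
Local Notation comp := (comp E).
Local Notation adj := (adj E).

Definition nbhd q := [set C in bl st | [exists v in C, D x v <= q]].

Lemma r_facts : [/\ 0 < eta * r, eta * r <= r & 100 * h <= r].
Proof.
have h1 := hr; have := mulr_gt0 eta0 r0; have : eta * r <= 1 * r by rewrite ler_wpM2r // ltW.
by rewrite mul1r => *; split=> //; lra.
Qed.

Lemma nbhd_sub q : nbhd q \subset bl st.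
Proof. by apply/subsetP => C; rewrite inE => /andP []. Qed.

Lemma nbhd_mono p q : p <= q -> nbhd p \subset nbhd q.
Proof.
move=> pq; apply/subsetP => C; rewrite !inE => /andP [-> /exists_inP [v vC Dv]].
by apply/exists_inP; exists v => //; apply: le_trans pq.
Qed.

Lemma nbhd_out q C v : C \in bl st -> C \notin nbhd q -> v \in C -> q < D x v.
Proof.
move=> CS; rewrite inE CS /= => /exists_inPn H /H; by rewrite -ltNge.
Qed.

Lemma nbhd_diam q C : q <= 40 * r -> C \in nbhd q ->
  lam st C <= h /\ forall a b, a \in C -> b \in C -> reach (tr st C) a b h.
Proof.
move=> q40; rewrite inE => /andP [CS /exists_inP [v vC Dv]].
by apply: near_diam CS vC _; apply: le_trans q40.
Qed.

Lemma nbhd_ball q C v : q <= 40 * r -> C \in nbhd q -> v \in C -> D x v <= q + h.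
Proof.
move=> q40 CN vC; have [_ rC] := nbhd_diam q40 CN.
move: CN; rewrite inE => /andP [CS /exists_inP [u uC Du]].
have := reach_dist D0 Dsym Dtri (ok_long o CS) (rC _ _ uC vC).
by have := Dtri u x v; lra.
Qed.

Lemma edge_dist e a b : e \in E -> between e a b -> D a b <= e.2.
Proof.
by move=> eE eab; have := ok_edlong o eE; case/betweenP: eab => -> //=; rewrite Dsym.
Qed.

Lemma nbhd_lam Q : Q \subset nbhd (32 * r) -> forall C a b, C \in Q -> a \in C -> b \in C ->
  reach (tr st C) a b (lam st C + slack E h a + slack E h b).
Proof.
move=> QN C a b CQ aC bC; have CN := subsetP QN _ CQ.
have [//|_ rC] := nbhd_diam _ CN; first by have := r0; lra.
have CS := subsetP (nbhd_sub _) _ CN.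
have l0 := ok_lam o C; have h0' := h0; rewrite /slack.
case: ifP => pa; case: ifP => pb.
- by rewrite !addr0; apply: (ok_port o CS).
- by apply: reach_le (rC _ _ aC bC) _; lra.
- by apply: reach_le (rC _ _ aC bC) _; lra.
- by apply: reach_le (rC _ _ aC bC) _; lra.
Qed.

Section Nearby.
Context (Q : {set {set V}}) (QN : Q \subset nbhd (32 * r)).

Lemma Q_bl : Q \subset bl st. Proof. exact: subset_trans QN (nbhd_sub _). Qed.
Lemma Q_triv : trivIset Q. Proof. exact: trivIsetS Q_bl (ok_triv o). Qed.
Lemma Q_tree C : C \in Q -> tree_on C (tr st C).
Proof. by move=> CQ; apply: (ok_tree o); apply: (subsetP Q_bl). Qed.
Lemma Q_long C : C \in Q -> long_edges D (tr st C).
Proof. by move=> CQ; apply: (ok_long o); apply: (subsetP Q_bl). Qed.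
Lemma Q_diam C : C \in Q -> lam st C <= h /\
  forall a b, a \in C -> b \in C -> reach (tr st C) a b h.
Proof. by move=> CQ; apply: nbhd_diam (subsetP QN _ CQ); have := r0; lra. Qed.
Lemma Q_ball v : v \in cover Q -> D x v <= 33 * r.
Proof.
case/bigcupP => C CQ vC; have := nbhd_ball _ (subsetP QN _ CQ) vC.
by have [_ _] := r_facts; have := r0; lra.
Qed.
Lemma Q_edge e a b : e \in E -> between e a b -> a \in cover Q -> e.2 <= h.
Proof. by move=> eE eab /Q_ball Da; apply: near_edge eE eab _; have := r0; lra. Qed.

(** Read backwards: a connected set of blocks that bridges a distance has at least that much mass,
    up to [2 * h]. The lower bounds on masses below come from this. *)
Lemma conn_dist C C' v v' : conn Q -> C \in Q -> C' \in Q -> v \in C -> v' \in C' ->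
  D v v' <= W Q + 2 * h.
Proof.
move=> cQ CQ C'Q vC vC'.
have sp := spans1 (ok_pos o) Q_tree Q_long (nbhd_lam QN) CQ.
have CQ1 : [set C] \subset Q by rewrite sub1set.
have C1 : [set C] != set0 by apply/set0Pn; exists C; rewrite inE.
have [s [[[_ sl] _ _ rs] _ _]] := spans_conn Dsym (ok_pos o) (ok_edlong o) (ok_lam o) h0 Q_triv
  Q_tree Q_long (nbhd_lam QN) cQ CQ1 C1 sp.
have := reach_dist D0 Dsym Dtri sl (rs _ _ (mem_coverP CQ vC) (mem_coverP C'Q vC')).
by have := slack_le E h0 v; have := slack_le E h0 v'; lra.
Qed.

End Nearby.

Lemma x_block : exists2 B, B \in nbhd r & x \in B.
Proof.
have [B BS xB] := ok_block x o; exists B => //; rewrite inE BS.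
by apply/exists_inP; exists x => //; rewrite D0 ltW.
Qed.

(** Components that stay away from the ball of radius [r] are left out: they may merely graze the
    ball of radius [q], with too little mass to pay for a link. *)
Definition near_comps q := [set C in nbhd q | [exists B in nbhd r, C \in comp (nbhd q) B]].

Lemma near_comps_sub q : near_comps q \subset nbhd q.
Proof. by apply/subsetP => C; rewrite inE => /andP []. Qed.

Lemma near_comps_nbhd q : r <= q -> nbhd r \subset near_comps q.
Proof.
move=> rq; apply/subsetP => B BN; have BNq := subsetP (nbhd_mono rq) _ BN.
by rewrite inE BNq; apply/exists_inP; exists B => //; apply: comp_refl.
Qed.

Lemma near_comps_closed q C C' : C \in near_comps q -> C' \in nbhd q -> adj C C' ->
  C' \in near_comps q.
Proof.
rewrite !inE => /andP [CN /exists_inP [B BN CB]] C'N CC'.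
have C'N' : C' \in nbhd q by rewrite inE.
rewrite C'N; apply/exists_inP; exists B => //; exact: comp_closed CB C'N' CC'.
Qed.

Lemma near_comps_conn q C Q : C \in near_comps q -> Q \subset nbhd q -> conn Q -> C \in Q ->
  Q \subset near_comps q.
Proof.
move=> CN TN cT CT; have [//|nT] := eqVneq (Q :&: near_comps q) Q; first by move/setIidPl.
have Sn : Q :&: near_comps q != set0 by apply/set0Pn; exists C; rewrite inE CT.
have [A [B [AT BT]]] := cT _ (subsetIl _ _) Sn nT.
rewrite inE BT /= => /negP BN AB; case: BN; move: AT; rewrite inE => /andP [_ AN].
by apply: near_comps_closed AN (subsetP TN _ BT) AB.
Qed.

(** The set joins a block within [r] of [x] to an edge that leaves the ball of radius [q]. *)
Lemma comp_weight Q q C C0 C' : Q \subset nbhd (32 * r) -> q <= 32 * r -> conn Q ->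
  C \in Q -> C \in nbhd r -> C0 \in Q -> C' \in bl st -> C' \notin nbhd q -> adj C0 C' ->
  q - r - 4 * h <= W Q.
Proof.
move=> QN q32 cQ CQ CN C0Q C'b C'N /adjP [e [a [b [eE eab aC0 bC']]]].
have := CN; rewrite inE => /andP [_ /exists_inP [v vC Dv]].
have := conn_dist QN cQ CQ C0Q vC aC0; have := nbhd_out C'b C'N bC'.
have := Q_edge QN eE eab (mem_coverP C0Q aC0); have := edge_dist eE eab.
have h0' := h0; have := Dtri a x b; have := Dtri v x a; lra.
Qed.

(** With radius [4 * r], a component of the core with a way out runs from distance [r] to [4 * r];
    with radius [32 * r] for [region], every kept part runs from [5 * r] to [32 * r] inside it. *)
Definition core := near_comps (4 * r).
Definition region := near_comps (32 * r).
Definition outer := bl st :\: core.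
(** Outer components that never leave the ball of radius [32 * r] are swallowed together with the
    core, so that each remaining one has a large mass near [x]. *)
Definition absorbed := core :|: [set C in outer | comp outer C \subset nbhd (32 * r)].
Definition kept := bl st :\: absorbed.

Lemma core_bl : core \subset bl st.
Proof. by apply: subset_trans (near_comps_sub _) (nbhd_sub _). Qed.

Lemma core_nbhd : core \subset nbhd (32 * r).
Proof.
by apply: subset_trans (near_comps_sub _) (nbhd_mono _); have := r0; lra.
Qed.

Lemma core_start C : C \in core ->
  exists2 B, B \in nbhd r & [/\ B \in core, comp (nbhd (4 * r)) B \subset core &
    C \in comp (nbhd (4 * r)) B].
Proof.
rewrite inE => /andP [CN /exists_inP [B BN CB]]; exists B => //.
have BC : B \in core by apply: (subsetP (near_comps_nbhd _)) BN; have := r0; lra.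
have BN4 : B \in nbhd (4 * r) := subsetP (near_comps_sub _) _ BC.
split=> //; apply: near_comps_conn BC (comp_sub _ _ _) (comp_conn BN4) (comp_refl _ BN4).
Qed.

Lemma core_region : core \subset region.
Proof.
apply/subsetP => C /core_start [B BN [BC _ CB]].
have BN4 : B \in nbhd (4 * r) := subsetP (near_comps_sub _) _ BC.
have r32 : r <= 32 * r by have := r0; lra.
have n432 : nbhd (4 * r) \subset nbhd (32 * r) by apply: nbhd_mono; have := r0; lra.
have BR : B \in region by apply: (subsetP (near_comps_nbhd r32)).
apply: (subsetP (near_comps_conn BR _ (comp_conn BN4) (comp_refl _ BN4)) _ CB).
exact: subset_trans (comp_sub _ _ _) n432.
Qed.

Lemma core_step C C' : C \in core -> C' \in bl st -> C' \notin core -> adj C C' ->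
  C' \notin nbhd (4 * r).
Proof. by move=> CC C'b C'C CC'; apply: contraNN C'C => /near_comps_closed; apply; eauto. Qed.

Lemma outer_bl : outer \subset bl st. Proof. exact: subsetDl. Qed.

Lemma x_core : exists2 B, B \in core & x \in B.
Proof.
have [B BN xB] := x_block; exists B => //.
by apply: (subsetP (near_comps_nbhd _)) BN; have := r0; lra.
Qed.

(** The graph of all blocks is connected, so an outer component has an edge to the core; its outer
    end lies beyond [4 * r], or it would belong to the core. *)
Lemma outer_exit C : C \in outer -> exists C1 C0, [/\ C1 \in comp outer C, C0 \in core,
  adj C0 C1 & C1 \notin nbhd (4 * r)].
Proof.
move=> CO; have [B BC _] := x_core.
have OS := subset_trans (comp_sub E outer C) outer_bl.
have On : comp outer C != set0 by apply/set0Pn; exists C; apply: comp_refl.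
have OnS : comp outer C != bl st.
  apply: contraTneq (subsetP core_bl _ BC) => <-; apply/negP.
  by move/(subsetP (comp_sub _ _ _)); rewrite inE BC.
have [C1 [C0 [C1O C0b C0O a]]] := ok_conn o OS On OnS.
have C0C : C0 \in core.
  apply: contraNT C0O => C0C; apply: comp_closed C1O _ a; by rewrite inE C0C.
have C1o := subsetP (comp_sub _ _ _) _ C1O.
move: (C1o); rewrite inE => /andP [C1C C1b].
exists C1, C0; split=> //; first by rewrite adj_sym.
by apply: core_step C0C C1b C1C _; rewrite adj_sym.
Qed.

Lemma exit_near C0 C1 : C0 \in core -> C1 \in bl st -> adj C0 C1 -> C1 \in nbhd (5 * r).
Proof.
move=> C0C C1b /adjP [e [a [b [eE eab aC bC]]]]; rewrite inE C1b; apply/exists_inP; exists b => //.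
have Da : D x a <= 4 * r + h.
  by apply: nbhd_ball (subsetP (near_comps_sub _) _ C0C) aC; have := r0; lra.
have [_ _ h1] := r_facts; have rr := r0; have h0' := h0.
have : e.2 <= h by apply: near_edge eE eab _; lra.
have := edge_dist eE eab; have := Dtri a x b; lra.
Qed.

Lemma absorbed_region : absorbed \subset region.
Proof.
rewrite subUset core_region; apply/subsetP => C; rewrite inE => /andP [CO CN].
have [C1 [C0 [C1O C0C a _]]] := outer_exit CO.
have C1R : C1 \in region.
  apply: near_comps_closed (subsetP core_region _ C0C) _ a; exact: (subsetP CN).
by apply: (subsetP (near_comps_conn C1R CN (comp_conn CO) C1O)); apply: comp_refl.
Qed.

Lemma region_nbhd : region \subset nbhd (32 * r). Proof. exact: near_comps_sub. Qed.
Lemma absorbed_nbhd : absorbed \subset nbhd (32 * r).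
Proof. exact: subset_trans absorbed_region region_nbhd. Qed.
Lemma absorbed_bl : absorbed \subset bl st.
Proof. exact: subset_trans absorbed_nbhd (nbhd_sub _). Qed.
Lemma core_absorbed : core \subset absorbed. Proof. exact: subsetUl. Qed.

Lemma kept_outer : kept \subset outer.
Proof. by apply: setDS; apply: core_absorbed. Qed.

Lemma kept_far C : C \in kept -> ~~ (comp outer C \subset nbhd (32 * r)).
Proof.
move=> CK; have CO := subsetP kept_outer _ CK; apply/negP => sub.
move: CK; rewrite inE => /andP [/negP CA _]; case: CA.
by rewrite in_setU; apply/orP; right; rewrite inE CO.
Qed.

Lemma comp_kept C : C \in kept -> comp outer C \subset kept.
Proof.
move=> CK; have CO := subsetP kept_outer _ CK; apply/subsetP => C' C'C.
have C'O := subsetP (comp_sub _ _ _) _ C'C.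
rewrite inE (subsetP outer_bl _ C'O) andbT in_setU negb_or.
move: (C'O); rewrite {1}/outer in_setD => /andP [-> _]; rewrite inE C'O /= -(comp_eq C'C).
exact: kept_far.
Qed.

(** Absorbed blocks outside the core form whole components of [outer], so only core blocks can touch
    a kept block. *)
Lemma absorbed_kept C C' : C \in absorbed -> C' \in kept -> adj C C' ->
  C \in core /\ C' \notin nbhd (4 * r).
Proof.
move=> CA C'K CC'; have C'O := subsetP kept_outer _ C'K.
have CC : C \in core.
  apply: contraT => CC; have Cb := subsetP absorbed_bl _ CA.
  have CO : C \in outer by rewrite inE CC.
  suff : C \in kept by rewrite inE CA.
  apply: (subsetP (comp_kept C'K)); apply: comp_closed (comp_refl _ C'O) CO _.
  by rewrite adj_sym.
split=> //; apply: core_step CC _ _ CC'; by move: C'O; rewrite inE => /andP [].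
Qed.

(** The component starts within [5 * r] of [x] next to the core and leaves the ball of radius
    [32 * r]: it crosses [27 * r] up to a few [h]. *)
Lemma kept_weight C : C \in kept -> 26 * r <= W (comp outer C :&: region).
Proof.
move=> CK; have CO := subsetP kept_outer _ CK.
have [C1 [C0 [C1O C0C a C1N]]] := outer_exit CO.
have C1b := subsetP outer_bl _ (subsetP (comp_sub _ _ _) _ C1O).
have [_ _ h1] := r_facts; have rr := r0; have h0' := h0.
have C1N5 := exit_near C0C C1b a.
have C1N32 : C1 \in nbhd (32 * r) by apply: (subsetP (nbhd_mono _)) C1N5; lra.
(* Only the part that stays connected to the entry [C1] inside the ball counts; being attached to
   the core, it lies in [region]. *)
set O := comp outer C in C1O *; set Q := comp (O :&: nbhd (32 * r)) C1.
have C1Q : C1 \in O :&: nbhd (32 * r) by rewrite inE C1O.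
have cQ : conn Q by apply: comp_conn.
have QON : Q \subset O :&: nbhd (32 * r) := comp_sub _ _ _.
have QO : Q \subset O := subset_trans QON (subsetIl _ _).
have QN : Q \subset nbhd (32 * r) := subset_trans QON (subsetIr _ _).
have C1Q' : C1 \in Q by apply: comp_refl.
have C1R : C1 \in region by apply: near_comps_closed (subsetP core_region _ C0C) C1N32 a.
have QR : Q \subset region by apply: near_comps_conn C1R QN cQ C1Q'.
have Qn : Q != set0 by apply/set0Pn; exists C1.
have QnO : Q != O.
  by apply: contraNneq (kept_far CK) => QE; rewrite -/O -QE.
have cO : conn O by apply: comp_conn.
have [C2 [C3 [C2Q C3O C3Q a23]]] := cO Q QO Qn QnO.
have C3b : C3 \in bl st := subsetP outer_bl _ (subsetP (comp_sub _ _ _) _ C3O).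
have C3N : C3 \notin nbhd (32 * r).
  apply: contraNN C3Q => C3N; apply: comp_closed C2Q _ a23; by rewrite inE C3O.
apply: le_trans (W_sub (ok_pos o) (ok_lam o) (_ : Q \subset _)); last by rewrite subsetI QO.
have /adjP [e [a2 [a3 [eE e23 aC2 aC3]]]] := a23.
move: C1N5; rewrite inE => /andP [_ /exists_inP [v vC1 Dv]].
have := conn_dist QN cQ C1Q' C2Q vC1 aC2.
have := nbhd_out C3b C3N aC3; have := Q_edge QN eE e23 (mem_coverP C2Q aC2).
have := edge_dist eE e23; have := Dtri a2 x a3; have := Dtri v x a2; lra.
Qed.

(** Some edge leads from the component to a kept block. It starts in the core and ends beyond
    [4 * r], while the component of the core where it starts has a block within [r] of [x]. *)
Lemma absorbed_comp_weight C : C \in absorbed -> comp absorbed C != bl st ->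
  2 * r <= W (comp absorbed C).
Proof.
move=> CA nb; set Q := comp absorbed C in nb *.
have Qb : Q \subset bl st := subset_trans (comp_sub _ _ _) absorbed_bl.
have Qn : Q != set0 by apply/set0Pn; exists C; apply: comp_refl.
have [C1 [C2 [C1Q C2b C2Q a]]] := ok_conn o Qb Qn nb.
have C1A := subsetP (comp_sub _ _ _) _ C1Q.
have C2K : C2 \in kept.
  by rewrite inE C2b andbT; apply: contraNN C2Q => C2A; apply: comp_closed C1Q C2A a.
have [C1C C2N] := absorbed_kept C1A C2K a.
have [B BN [BC sub C1B]] := core_start C1C.
have BN4 : B \in nbhd (4 * r) := subsetP (near_comps_sub _) _ BC.
have sub' := conn_sub_comp (comp_conn BN4) (subset_trans sub core_absorbed) C1B.
have BQ : B \in Q by rewrite /Q (comp_eq C1Q); apply: (subsetP sub'); apply: comp_refl.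
have QN : Q \subset nbhd (32 * r) := subset_trans (comp_sub _ _ _) absorbed_nbhd.
have [_ _ h1] := r_facts; have rr := r0; have h0' := h0.
have q4 : 4 * r <= 32 * r by lra.
have := comp_weight QN q4 (comp_conn CA) BQ BN C1Q C2b C2N a.
lra.
Qed.

Lemma region_comp_weight C : C \in region -> comp region C != bl st ->
  2 * r <= W (comp region C).
Proof.
move=> CA nb; set Q := comp region C in nb *.
have Qb : Q \subset bl st := subset_trans (comp_sub _ _ _) (subset_trans region_nbhd (nbhd_sub _)).
have Qn : Q != set0 by apply/set0Pn; exists C; apply: comp_refl.
have [C1 [C2 [C1Q C2b C2Q a]]] := ok_conn o Qb Qn nb.
have C1A := subsetP (comp_sub _ _ _) _ C1Q.
have C2N : C2 \notin nbhd (32 * r).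
  by apply: contraNN C2Q => C2N; apply: comp_closed C1Q (near_comps_closed C1A C2N a) a.
move: (C1A); rewrite inE => /andP [_ /exists_inP [B BN C1B]].
have r32 : r <= 32 * r by have := r0; lra.
have BN4 : B \in nbhd (32 * r) := subsetP (nbhd_mono r32) _ BN.
have sub := near_comps_conn C1A (comp_sub _ _ _) (comp_conn BN4) C1B.
have sub' := conn_sub_comp (comp_conn BN4) sub C1B.
have BQ : B \in Q by rewrite /Q (comp_eq C1Q); apply: (subsetP sub'); apply: comp_refl.
have QN : Q \subset nbhd (32 * r) := subset_trans (comp_sub _ _ _) region_nbhd.
have [_ _ h1] := r_facts; have rr := r0; have h0' := h0.
have := comp_weight QN (lexx _) (comp_conn CA) BQ BN C1Q C2b C2N a.
lra.
Qed.

(** [star_merge] with [H = eta * r] and [kappa = 33 * r]. The diameter is at most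
    [2 * 33 * r + 8 * eta * r <= 74 * r]. *)
Lemma star Y : Y \subset nbhd (32 * r) -> core \subset Y ->
  (forall C, C \in Y -> comp Y C != bl st -> 2 * r <= W (comp Y C)) ->
  exists s N, [/\ tree_on (cover Y) s /\ long_edges D s,
    forall C, C \in Y -> {subset tr st C <= s},
    wt s <= trees_weight (tr st) Y + esum E (inside (cover Y)) + (34 * r) *+ N /\
      eta * r *+ N <= 8 * W Y,
    forall v, v \in cover Y -> reach s x v (D x v + 4 * eta * r) &
    forall a b, a \in cover Y -> b \in cover Y -> reach s a b (74 * r)].
Proof.
move=> YN cY wY; have [B BC xB] := x_core; have BY := subsetP cY _ BC.
have [e0 e1 h1] := r_facts; have rr := r0; have h0' := h0; have h2 := hr.
have hH : 8 * h <= eta * r by lra.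
have lamh C : C \in Y -> lam st C <= h by move=> CY; have [] := Q_diam YN CY.
have eh e a b : e \in E -> between e a b -> a \in cover Y -> b \in cover Y -> e.2 <= h.
  by move=> eE eab aY _; exact: (Q_edge YN eE eab aY).
have wY' C : C \in Y -> C \notin comp Y B -> eta * r / 4 <= W (comp Y C).
  move=> CY CB; suff : 2 * r <= W (comp Y C) by lra.
  apply: wY => //; apply: contraNneq CB => cE.
  have BC' : B \in comp Y C by rewrite cE; apply: (subsetP core_bl).
  by rewrite -(comp_eq BC'); apply: comp_refl.
(* The argument [e0] sets [zeta = eta * r], so that [err] is at most [4 * eta * r] and a link is at
   most [34 * r] long. *)
have [s [N [[ts sl] st' [ws wN] rs]]] := star_merge D0 Dsym Dtri (ok_pos o) (ok_edlong o) (ok_lam o)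
  h0 (Q_triv YN) (Q_tree YN) (Q_long YN) (nbhd_lam YN) e0 hH (Q_ball YN) lamh eh BY xB wY'.
have rs' v : v \in cover Y -> reach s x v (D x v + 4 * eta * r).
  by move=> vY; apply: reach_le (rs _ vY) _; rewrite /err; lra.
exists s, N; split=> //.
  split.
    suff : (33 * r + eta * r) *+ N <= 34 * r *+ N by move: ws; lra.
    by rewrite lerMn2r; apply/orP; right; lra.
  by move: wN; rewrite mulrnAl; lra.
move=> a b aY bY; apply: reach_le (reach_trans (reach_sym (rs' _ aY)) (rs' _ bY)) _.
have := Q_ball YN aY; have := Q_ball YN bY; lra.
Qed.

Definition outside T (e : V * V * R) := (e.1.1 \notin T) && (e.1.2 \notin T).

Lemma outside_between T e a b : between e a b -> outside T e = (a \notin T) && (b \notin T).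
Proof. by case/betweenP => k; rewrite /outside k //= andbC. Qed.

Lemma kept_block C a : C \in kept -> a \in C -> a \notin cover absorbed.
Proof.
rewrite inE => /andP [CA Cb] aC; apply/bigcupP => -[B BA aB]; case/negP: CA.
by rewrite (same_block (ok_triv o) Cb (subsetP absorbed_bl _ BA) aC aB).
Qed.

(** All old edges with an end in the absorbed set disappear: those inside are consumed, those
    leading out are replaced by [br]. *)
Definition bridged (br : seq (V * V * R)) := br ++ [seq e <- E | outside (cover absorbed) e].

Definition closed_under S (F : seq (V * V * R)) T :=
  (forall C a b, C \in S -> a \in C -> b \in C -> a \in T -> b \in T) /\
  (forall e a b, e \in F -> between e a b -> a \in T -> b \in T).

(** The edges inside a kept component survive in [bridged], so it remains connected and a single
    bridge suffices for it. *)
Lemma kept_spread br C T a b : closed_under (cover absorbed |: kept) (bridged br) T ->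
  C \in kept -> a \in cover (comp outer C) -> b \in cover (comp outer C) -> a \in T -> b \in T.
Proof.
move=> [clB clE] CK; have CO := subsetP kept_outer _ CK.
set O := comp outer C => /bigcupP [A AO aA] /bigcupP [B BO bB] aT.
have OK : O \subset kept by apply: comp_kept.
have blk C' u v : C' \in O -> u \in C' -> v \in C' -> u \in T -> v \in T.
  by move=> C'O; apply: clB; rewrite in_setU1 (subsetP OK _ C'O) orbT.
pose S := [set C' in O | [exists v in C', v \in T]].
have SO : S \subset O by apply/subsetP => C'; rewrite inE => /andP [].
suff SE : S = O.
  move: BO; rewrite -SE inE => /andP [BO /exists_inP [v vB vT]]; exact: blk BO vB bB vT.
apply/eqP; apply: contraT => SnO.
have Sn : S != set0 by apply/set0Pn; exists A; rewrite inE AO; apply/exists_inP; exists a.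
have [C1 [C2 [C1S C2O C2S /adjP [e [u [v [eE euv uC1 vC2]]]]]]] := comp_conn CO SO Sn SnO.
move: C1S; rewrite inE => /andP [C1O /exists_inP [w wC1 wT]].
have uT := blk _ _ _ C1O wC1 uC1 wT.
case/negP: C2S; rewrite inE C2O; apply/exists_inP; exists v => //.
apply: (clE e u v _ euv uT); rewrite mem_cat mem_filter eE andbT (outside_between _ euv).
by rewrite (kept_block (subsetP OK _ C1O) uC1) (kept_block (subsetP OK _ C2O) vC2) orbT.
Qed.

Lemma vertex_cases v : v \in cover absorbed \/ exists2 C, C \in kept & v \in C.
Proof.
have [C Cb vC] := ok_block v o; have [CA|CA] := boolP (C \in absorbed).
  by left; apply: mem_coverP vC.
by right; exists C; rewrite // inE CA.
Qed.

Lemma kept_exit C : C \in kept -> exists C1 C0 e a b, [/\ C1 \in comp outer C, C0 \in core,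
  e \in E, between e a b & a \in C0 /\ b \in C1].
Proof.
move=> CK; have [C1 [C0 [C1O C0C /adjP [e [a [b [eE eab aC bC]]]] _]]] :=
  outer_exit (subsetP kept_outer _ CK).
by exists C1, C0, e, a, b.
Qed.

Lemma weight_split (P1 P2 : pred (V * V * R)) :
  (forall e, e \in E -> P1 e -> ~~ P2 e) -> esum E P1 + esum E P2 <= esum E (predU P1 P2).
Proof. by move=> d; apply: (esum2 (ok_pos o)) => // e _ /= ->; rewrite ?orbT. Qed.

Lemma esum_wt : esum E predT = wt E. Proof. by []. Qed.

Lemma exit_bounds C0 e a b : C0 \in core -> e \in E -> between e a b -> a \in C0 ->
  [/\ D x a <= 33 * r, e.2 <= h, D x b <= 34 * r & D a b <= e.2].
Proof.
move=> C0C eE eab aC; have aQ := mem_coverP C0C aC.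
have Da := Q_ball core_nbhd aQ; have eh := Q_edge core_nbhd eE eab aQ.
have Dab := edge_dist eE eab; have := Dtri a x b; have [_ _ h1] := r_facts.
by have rr := r0; have h0' := h0; split=> //; lra.
Qed.

Lemma exit_bounds34 a (w : R) : D x a <= 33 * r -> w <= h -> D x a <= 34 * r /\ w <= 100 * r.
Proof. by have [_ _ h1] := r_facts; have rr := r0; have h0' := h0; split; lra. Qed.

(* A light region keeps at most two components: each of them costs [26 r] inside the region. The
   two are joined by a single edge as long as the passage through the absorbed set, which then
   hangs from one of them by a single vertex. *)
Lemma bridges : W region <= 75 * r -> exists br delta,
  [/\ [/\ positive_edges br, long_edges D br, 0 <= delta <= 66 * r &
      forall e, e \in br -> [/\ D x e.1.1 <= 34 * r, D x e.1.2 <= 34 * r & e.2 <= 100 * r]],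
    (forall a, a \notin cover absorbed -> port br a -> port E a) /\
    (forall a b, a \in cover absorbed -> b \in cover absorbed -> port br a -> port br b -> a = b),
    wt br + esum E (inside (cover absorbed)) + esum E (outside (cover absorbed)) <=
      wt E + delta + h,
    linked (cover absorbed |: kept) (bridged br) &
    delta + eta * r <= W absorbed \/
    conn absorbed /\ exists p q, [/\ p \in cover absorbed, q \in cover absorbed & delta = D p q]].
Proof.
move=> WR; have [e0 e1 h1] := r_facts; have rr := r0; have h0' := h0.
have [Bx BxC xBx] := x_core; have BxA := subsetP core_absorbed _ BxC.
have xA : x \in cover absorbed := mem_coverP BxA xBx.
have io e : e \in E -> inside (cover absorbed) e -> ~~ outside (cover absorbed) e.
  by move=> _ /andP [i1 i2]; rewrite /outside i1.
(* With no kept block the absorbed set is the whole connected graph: no bridge is required, and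
   [delta = 0 = D x x]. *)
have [K0|/set0Pn [C1 C1K]] := eqVneq kept set0.
  exists [::], 0.
  have AE : absorbed = bl st.
    by apply/eqP; rewrite finset.eqEsubset absorbed_bl -setD_eq0 -/kept K0 eqxx.
  split=> //.
  - by split=> //; rewrite lexx mulr_ge0 ?(ltW rr).
  - have := weight_split io; rewrite wt_nil add0r.
    have := esum1 (ok_pos o) (P := predT) (P1 := predU (inside (cover absorbed)) (outside (cover absorbed))).
    by rewrite esum_wt => /(_ (fun _ _ _ => isT)); lra.
  - move=> T /set0Pn [v vT] clB clE; apply/setP => u; rewrite inE.
    have cv w : w \in cover absorbed by rewrite AE (ok_cover o) inE.
    by apply: (clB (cover absorbed) v u) => //; rewrite in_setU1 eqxx.
  right; split; last by exists x, x; rewrite D0.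
  by rewrite AE; apply: ok_conn o.
have Anb : absorbed != bl st.
  by apply: contraTneq C1K => AE; rewrite inE AE; case: (C1 \in bl st).
have wc C : C \in absorbed -> 2 * r <= W (comp absorbed C).
  move=> CA; apply: absorbed_comp_weight => //; apply: contraNneq Anb => cE.
  by rewrite finset.eqEsubset absorbed_bl -cE comp_sub.
have WA : 2 * r <= W absorbed.
  exact: le_trans (wc _ BxA) (W_sub (ok_pos o) (ok_lam o) (comp_sub _ _ _)).
set O1 := comp outer C1.
have O1K : O1 \subset kept by apply: comp_kept.
(* With one kept component there is nothing to pass through. One of its edges to the core is
   retained, and [2 * r <= W absorbed] gives the first alternative with [delta = 0]. *)
have [KO|/subsetPn [C2 C2K C2O1]] := boolP (kept \subset O1).
  have [C' [C0 [e [a [b [C'O C0C eE eab [aC bC]]]]]]] := kept_exit C1K.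
  have [Da eh Db Dab] := exit_bounds C0C eE eab aC.
  have aA : a \in cover absorbed := mem_coverP (subsetP core_absorbed _ C0C) aC.
  have bA : b \notin cover absorbed := kept_block (subsetP O1K _ C'O) bC.
  exists [:: (a, b, e.2)], 0; split.
  - split=> [f|f||f]; rewrite ?inE.
    + by move/eqP => ->; exact: (ok_pos o eE).
    + by move/eqP => -> /=.
    + by rewrite lexx mulr_ge0 ?(ltW rr).
    + by move/eqP => -> /=; split; lra.
  - split=> [v vA|u v uA vA]; rewrite /port /= orbF.
      case/orP => /eqP vE; first by rewrite -vE aA in vA.
      by rewrite -vE; apply: port_between eE _; rewrite between_sym; exact: eab.
    have only w : w \in cover absorbed -> (a == w) || (b == w) -> w = a.
      by move=> wA /orP [/eqP -> //|/eqP wE]; rewrite -wE (negbTE bA) in wA.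
    by rewrite orbF => /(only _ uA) -> /(only _ vA) ->.
  - have := weight_split io; rewrite wt_cons wt_nil /= addr0.
    have := esum_add (ok_pos o) (P := predT)
      (P1 := predU (inside (cover absorbed)) (outside (cover absorbed))) (fun _ _ _ => isT) eE isT.
    rewrite esum_wt /= (outside_between _ eab) aA /= orbF.
    have -> : inside (cover absorbed) e = false.
      by case/betweenP: eab => k; rewrite /inside k /= (negbTE bA) ?andbF.
    by move=> /(_ isT); lra.
  - move=> T Tn clB clE; apply/setP => u; rewrite inE.
    have cl : closed_under (cover absorbed |: kept) (bridged [:: (a, b, e.2)]) T by [].
    have bO1 : b \in cover O1 := mem_coverP C'O bC.
    have abT : (a \in T) = (b \in T).
      by apply/idP/idP; apply: (clE (a, b, e.2)); rewrite ?mem_head // /between eqxx ?orbT.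
    have near v : (v \in T) = (a \in T).
      case: (vertex_cases v) => [vA|[C CK vC]].
        by apply/idP/idP; apply: (clB (cover absorbed)); rewrite // in_setU1 eqxx.
      have vO1 : v \in cover O1 := mem_coverP (subsetP KO _ CK) vC.
      by rewrite abT; apply/idP/idP; apply: (kept_spread cl C1K).
    by case/set0Pn: Tn => v; rewrite !near.
  by left; lra.
set O2 := comp outer C2.
have O2K : O2 \subset kept by apply: comp_kept.
have C1O := subsetP kept_outer _ C1K; have C2O := subsetP kept_outer _ C2K.
have O12 : [disjoint O1 & O2].
  rewrite -setI_eq0; apply/eqP/setP => C; rewrite in_set0 in_setI; apply/negP => /andP [CO1 CO2].
  by case/negP: C2O1; rewrite /O1 (comp_eq CO1) -(comp_eq CO2); apply: comp_refl.
(* A third kept component would raise the mass of the region to [3 * 26 * r > 75 * r]. *)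
have KO C : C \in kept -> C \in O1 \/ C \in O2.
  move=> CK; case: (boolP (C \in O1)); first by left.
  case: (boolP (C \in O2)); first by right.
  move=> CO2 CO1; have CO := subsetP kept_outer _ CK; exfalso.
  have tb := ok_triv o; have rb : region \subset bl st.
    exact: subset_trans region_nbhd (nbhd_sub _).
  have d3 C' : C' \in kept -> C \notin comp outer C' -> [disjoint comp outer C' & comp outer C].
    move=> C'K CC'; rewrite -setI_eq0; apply/eqP/setP => B.
    rewrite in_set0 in_setI; apply/negP => /andP [B1 B2].
    by case/negP: CC'; rewrite (comp_eq B1) -(comp_eq B2); apply: comp_refl.
  have s1 : (O1 :|: O2) :&: region \subset bl st by apply: subset_trans (subsetIr _ _) rb.
  have s2 Q : Q :&: region \subset bl st by apply: subset_trans (subsetIr _ _) rb.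
  have k1 := kept_weight C1K; have k2 := kept_weight C2K; have k3 := kept_weight CK.
  have dI (Q1 Q2 : {set {set V}}) : [disjoint Q1 & Q2] ->
      [disjoint Q1 :&: region & Q2 :&: region].
    by move=> d; apply: disjointWl (subsetIl _ _) _; apply: disjointWr (subsetIl _ _) _.
  have d12 := dI _ _ O12.
  have tr12 : trivIset ((O1 :|: O2) :&: region) := trivIsetS s1 tb.
  have := W_disj (ok_pos o) (ok_lam o) (setSI region (subsetUl O1 O2))
    (setSI region (subsetUr O1 O2)) d12 tr12.
  have d123 : [disjoint O1 :|: O2 & comp outer C].
    by rewrite disjoint_setU (d3 _ C1K CO1) (d3 _ C2K CO2).
  have := W_disj (ok_pos o) (ok_lam o) (subsetIr (O1 :|: O2) region)
    (subsetIr (comp outer C) region) (dI _ _ d123) (trivIsetS rb tb).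
  by rewrite -/O1 -/O2 in k1 k2; lra.
(* The two exits are chosen in a common component of the absorbed set, so that its mass bounds
   [D a1 a2]. Such a component exists on a way from [O1] to [O2]: the component [Z] of [O1] together
   with absorbed blocks has an edge to [O2]. *)
have [e1' [a1 [b1 [e2' [a2 [b2 [A1 [A2 [E1 E2 core1 core2 same]]]]]]]]] :
  exists e1 a1 b1 e2 a2 b2 A1 A2, [/\ [/\ e1 \in E, between e1 a1 b1, a1 \in A1 & b1 \in cover O1],
    [/\ e2 \in E, between e2 a2 b2, a2 \in A2 & b2 \in cover O2], A1 \in core, A2 \in core &
    A2 \in comp absorbed A1].
  set Z := comp (absorbed :|: O1) C1.
  have C1Z : C1 \in Z by apply: comp_refl; rewrite in_setU comp_refl ?orbT.
  have Zs : Z \subset absorbed :|: O1 := comp_sub _ _ _.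
  have Zb : Z \subset bl st.
    by apply: subset_trans Zs _; rewrite subUset absorbed_bl (subset_trans O1K (subsetDl _ _)).
  have cZ : conn Z by apply: comp_conn; rewrite in_setU comp_refl ?orbT.
  have Zn : Z != set0 by apply/set0Pn; exists C1.
  have O1Z : O1 \subset Z.
    by apply: conn_sub_comp; [exact: comp_conn|exact: subsetUr|exact: comp_refl].
  have C2A : C2 \notin absorbed by move: C2K; rewrite inE => /andP [].
  have Znb : Z != bl st.
    apply: contraTneq (subsetP outer_bl _ C2O) => <-; apply/negP => /(subsetP Zs).
    by rewrite in_setU (negbTE C2A) (negbTE C2O1).
  have [C3 [C4 [C3Z C4b C4Z a34]]] := ok_conn o Zb Zn Znb.
  have C4n : C4 \notin absorbed :|: O1.
    by apply: contraNN C4Z => C4in; exact: (comp_closed C3Z C4in a34).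
  move: C4n; rewrite in_setU negb_or => /andP [C4A C4O1].
  have C4K : C4 \in kept by rewrite inE C4A.
  have C4O2 : C4 \in O2 by case: (KO _ C4K) => // h4; rewrite h4 in C4O1.
  have C3A : C3 \in absorbed.
    move: (subsetP Zs _ C3Z); rewrite in_setU => /orP [//|C3O1].
    case/negP: C4O1; apply: comp_closed C3O1 (subsetP kept_outer _ C4K) a34.
  have [C3C _] := absorbed_kept C3A C4K a34.
  set J := comp absorbed C3.
  have JZ : J \subset Z.
    rewrite /Z (comp_eq C3Z); apply: conn_sub_comp; [exact: comp_conn| |exact: comp_refl].
    exact: subset_trans (comp_sub _ _ _) (subsetUl _ _).
  have Jn : J != set0 by apply/set0Pn; exists C3; apply: comp_refl.
  have JnZ : J != Z.
    apply: contraTneq C1Z => <-; apply/negP => /(subsetP (comp_sub _ _ _)).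
    by apply/negP; move: C1K; rewrite inE => /andP [].
  have [C5 [C6 [C5J C6Z C6J a56]]] := cZ J JZ Jn JnZ.
  have C6O1 : C6 \in O1.
    move: (subsetP Zs _ C6Z); rewrite in_setU => /orP [C6A|//].
    by case/negP: C6J; apply: comp_closed C5J C6A a56.
  have C5A := subsetP (comp_sub _ _ _) _ C5J.
  have [C5C _] := absorbed_kept C5A (subsetP O1K _ C6O1) a56.
  have /adjP [f1 [u1 [v1 [f1E f1b u1C v1C]]]] := a56.
  have /adjP [f2 [u2 [v2 [f2E f2b u2C v2C]]]] := a34.
  exists f1, u1, v1, f2, u2, v2, C5, C3; split=> //.
  - by split=> //; apply: mem_coverP v1C.
  - by split=> //; apply: mem_coverP v2C.
  - by rewrite -(comp_eq C5J); apply: comp_refl.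
case: E1 => eE1 eb1 aA1 bO1; case: E2 => eE2 eb2 aA2 bO2.
have [Da1 eh1 Db1 Dab1] := exit_bounds core1 eE1 eb1 aA1.
have [Da2 eh2 Db2 Dab2] := exit_bounds core2 eE2 eb2 aA2.
have A1A := subsetP core_absorbed _ core1; have A2A := subsetP core_absorbed _ core2.
have a1A : a1 \in cover absorbed := mem_coverP A1A aA1.
have a2A : a2 \in cover absorbed := mem_coverP A2A aA2.
have out v Q : Q \subset kept -> v \in cover Q -> v \notin cover absorbed.
  by move=> QK /bigcupP [C CQ vC]; apply: kept_block vC; apply: (subsetP QK).
have b1A := out _ _ O1K bO1; have b2A := out _ _ O2K bO2.
have b12 : b1 != b2.
  apply: contraTneq bO1 => ->; apply/negP => b2O1.
  have := triv_disjoint (ok_triv o) (subset_trans O1K (subsetDl _ _))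
    (subset_trans O2K (subsetDl _ _)) O12.
  by move=> /disjointFr/(_ b2O1); rewrite bO2.
have D12 := D_ge0 D0 Dsym Dtri a1 a2.
have p1 := ok_pos o eE1; have p2 := ok_pos o eE2.
(* [f2] replaces the passage from [b1] through [a1] and [a2] to [b2], leaving [a1] as the only port
   of the merged block. *)
set f1 := (a1, b1, e1'.2); set f2 := (b1, b2, e1'.2 + D a1 a2 + e2'.2).
have D12r : D a1 a2 <= 66 * r by have := Dtri x a1 a2; rewrite (Dsym a1 x); lra.
exists [:: f1; f2], (D a1 a2); split.
- split=> [f|f||f]; rewrite ?inE.
  + by case/orP => /eqP -> //=; lra.
  + case/orP => /eqP -> //=.
    have := Dtri a1 b1 b2; have := Dtri a2 a1 b2; rewrite (Dsym b1 a1); lra.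
  + by rewrite D12.
  + have [Da1' eh1'] := exit_bounds34 Da1 eh1; have [Da2' eh2'] := exit_bounds34 Da2 eh2.
    by case/orP => /eqP -> /=; split=> //; lra.
- split=> [v vA|u v uA vA]; rewrite /port /= orbF.
    have pb1 : port E b1 by apply: port_between eE1 _; rewrite between_sym; exact: eb1.
    have pb2 : port E b2 by apply: port_between eE2 _; rewrite between_sym; exact: eb2.
    case/orP => /orP [] /eqP vE; rewrite -vE //.
    by rewrite -vE a1A in vA.
  have only w : w \in cover absorbed ->
      ((a1 == w) || (b1 == w)) || ((b1 == w) || (b2 == w)) -> w = a1.
    move=> wA /orP [] /orP [] /eqP wE; rewrite -wE // in wA *.
    - by rewrite (negbTE b1A) in wA.
    - by rewrite (negbTE b1A) in wA.
    - by rewrite (negbTE b2A) in wA.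
  by rewrite orbF => /(only _ uA) -> /(only _ vA) ->.
(* The length of [e1'] occurs in both new edges; this surplus is the term [h]. *)
- have := weight_split io; rewrite !wt_cons wt_nil /= addr0.
  set P1 := predU _ _.
  have e12 : e1' != e2'.
    apply: contraNneq b12 => ee; rewrite ee in eb1.
    case/betweenP: eb1 => k1; case/betweenP: eb2; rewrite k1 => -[k2 k3]; subst => //.
    - by rewrite a1A in b2A.
    - by rewrite a1A in b2A.
  have P1e e a b : between e a b -> a \in cover absorbed -> b \notin cover absorbed -> ~~ P1 e.
    move=> eab aA bA; rewrite /P1 /= (outside_between _ eab) aA orbF.
    by case/betweenP: eab => k; rewrite /inside k /= (negbTE bA) ?andbF.
  have := esum_add (ok_pos o) (P := predU P1 (pred1 e1')) (P1 := P1)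
    (fun f _ => fun H => introT orP (or_introl H)) eE1 _ (P1e _ _ _ eb1 a1A b1A).
  rewrite /= eqxx orbT => /(_ isT).
  have := esum_add (ok_pos o) (P := predT) (P1 := predU P1 (pred1 e1'))
    (fun f _ _ => isT) eE2 isT.
  rewrite negb_or (P1e _ _ _ eb2 a2A b2A) /= eq_sym e12 => /(_ isT).
  rewrite esum_wt; lra.
- move=> T Tn clB clE; apply/setP => u; rewrite inE.
  have cl : closed_under (cover absorbed |: kept) (bridged [:: f1; f2]) T by [].
  have abT : (a1 \in T) = (b1 \in T).
    by apply/idP/idP; apply: (clE f1); rewrite ?mem_head // /between eqxx ?orbT.
  have bbT : (b1 \in T) = (b2 \in T).
    by apply/idP/idP; apply: (clE f2); rewrite ?inE ?eqxx ?orbT // /between eqxx ?orbT.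
  have near v : (v \in T) = (b1 \in T).
    case: (vertex_cases v) => [vA|[C CK vC]].
      by rewrite -abT; apply/idP/idP; apply: (clB (cover absorbed)); rewrite // in_setU1 eqxx.
    case: (KO _ CK) => CO.
      by apply/idP/idP; apply: (kept_spread cl C1K) => //; apply: mem_coverP vC.
    by rewrite bbT; apply/idP/idP; apply: (kept_spread cl C2K) => //; apply: mem_coverP vC.
  by case/set0Pn: Tn => v; rewrite !near.
set J := comp absorbed A1.
have A1J : A1 \in J by apply: comp_refl.
have cJ : conn J by apply: comp_conn.
have JA : J \subset absorbed := comp_sub _ _ _.
(* Either the component of the exits is everything absorbed, or another component adds [2 * r] to
   its mass of at least [D a1 a2 - 2 * h]. *)
have [JE|JnA] := eqVneq J absorbed.
  by right; split; [rewrite -JE|exists a1, a2].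
left; have /subsetPn [C CA CJ] : ~~ (absorbed \subset J).
  by apply: contraNN JnA => AJ; rewrite finset.eqEsubset JA.
have dJ : [disjoint J & comp absorbed C].
  rewrite -setI_eq0; apply/eqP/setP => B; rewrite in_set0 in_setI; apply/negP => /andP [B1 B2].
  by case/negP: CJ; rewrite /J (comp_eq B1) -(comp_eq B2); apply: comp_refl.
have := W_disj (ok_pos o) (ok_lam o) JA (comp_sub _ _ _) dJ (Q_triv absorbed_nbhd).
have := wc _ CA; have := conn_dist (subset_trans JA absorbed_nbhd) cJ A1J same aA1 aA2.
lra.
Qed.

Definition gain : R := (300 * 100) / (eta * eta).

Lemma gainP : gain * eta * eta = (300 * 100).
Proof. by rewrite /gain -mulrA divfK // mulf_neq0 // gt_eqF. Qed.

Lemma gain_gt0 : 0 < gain.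
Proof. by rewrite divr_gt0 // mulr_gt0. Qed.

(** The last clause makes the step local: blocks and edges that are not close to [x] are unchanged,
    so steps at distant centres do not interfere. *)
Definition improves st' := [/\ ok D st',
  forall C, C \in bl st -> exists2 C', C' \in bl st' & {subset tr st C <= tr st' C'},
  total st' + gain * potential st' <= total st + gain * potential st,
  exists2 C, C \in bl st' &
    forall u, D x u <= r -> reach (tr st' C) x u (D x u + 8 * eta * r) &
  (forall C, C \in bl st' -> [/\ C \in bl st, tr st' C = tr st C & lam st' C = lam st C] \/
    [/\ forall v, v \in C -> D x v <= 34 * r, lam st' C <= 100 * r &
      forall a b, a \in C -> b \in C -> reach (tr st' C) a b (100 * r)]) /\
  (forall e, e \in ed st' -> e \in E \/
    [/\ D x e.1.1 <= 34 * r, D x e.1.2 <= 34 * r & e.2 <= 100 * r])].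

Lemma merge_improves Y s l E' : Y \subset nbhd (32 * r) -> core \subset Y ->
  tree_on (cover Y) s -> long_edges D s -> (forall C, C \in Y -> {subset tr st C <= s}) ->
  (forall u, u \in cover Y -> reach s x u (D x u + 8 * eta * r)) ->
  (forall a b, a \in cover Y -> b \in cover Y -> reach s a b (100 * r)) ->
  0 <= l <= 100 * r -> positive_edges E' -> long_edges D E' ->
  (forall a, a \notin cover Y -> port E' a -> port E a) ->
  (forall a b, a \in cover Y -> b \in cover Y -> port E' a -> port E' b -> reach s a b l) ->
  linked (cover Y |: (bl st :\: Y)) E' ->
  (forall e, e \in E' -> e \in E \/
    [/\ D x e.1.1 <= 34 * r, D x e.1.2 <= 34 * r & e.2 <= 100 * r]) ->
  wt s + gain * l + (1 + gain) * wt E' <=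
    trees_weight (tr st) Y + gain * (\sum_(C in Y) lam st C) + (1 + gain) * wt E ->
  improves (merge st Y s l E').
Proof.
move=> YN cY ts sl st' rx rs /andP [l0 l1] Ep El pout pin lk Enear energy.
have Yb := Q_bl YN.
have trY : tr (merge st Y s l E') (cover Y) = s by rewrite /= /upd eqxx.
have YB : cover Y \in bl (merge st Y s l E') by rewrite /= in_setU1 eqxx.
split.
- exact: merge_ok.
- move=> C Cb; have [CY|CY] := boolP (C \in Y).
    by exists (cover Y) => //; rewrite trY; apply: st'.
  have CbY : C \in bl st :\: Y by rewrite inE CY.
  exists C; first by rewrite /= in_setU1 CbY orbT.
  by rewrite /= /upd (negbTE (cover_notin o Yb CbY)).
- rewrite (merge_potential _ _ _ o Yb) (merge_total _ _ _ o Yb).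
  by move: energy; rewrite /trees_weight; lra.
- exists (cover Y) => // u Du; rewrite trY; apply: rx.
  have [C Cb uC] := ok_block u o; apply: (mem_coverP (C := C)) => //.
  apply: (subsetP cY); apply: (subsetP (near_comps_nbhd _)); first by have := r0; lra.
  by rewrite inE Cb; apply/exists_inP; exists u.
split=> // C; rewrite in_setU1 => /orP [/eqP ->|CbY]; last first.
  left; move: (CbY); rewrite inE => /andP [_ Cb].
  by rewrite /= /upd (negbTE (cover_notin o Yb CbY)).
right; split; [|by rewrite /= /upd eqxx|by rewrite trY].
by move=> v /(Q_ball YN); have := r0; lra.
Qed.

Lemma pure_edges Y : Y \subset bl st -> let E' := [seq e <- E | ~~ inside (cover Y) e] in
  [/\ positive_edges E', long_edges D E', forall a, port E' a -> port E a,
    linked (cover Y |: (bl st :\: Y)) E' & wt E' = wt E - esum E (inside (cover Y))].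
Proof.
move=> Yb E'; have sub e : e \in E' -> e \in E by rewrite mem_filter => /andP [].
split.
- by move=> e /sub; apply: (ok_pos o).
- by move=> e /sub; apply: (ok_edlong o).
- by move=> a /hasP [e /sub eE ae]; apply/hasP; exists e.
- move=> T Tn clB clE.
  have clY a b : a \in cover Y -> b \in cover Y -> a \in T -> b \in T.
    by apply: clB; rewrite in_setU1 eqxx.
  apply: (ok_linked o) => //.
    move=> C a b Cb aC bC; have [CY|CY] := boolP (C \in Y).
      by apply: clY; [apply: mem_coverP aC|apply: mem_coverP bC].
    by apply: (clB C); rewrite // in_setU1 inE CY Cb orbT.
  move=> e a b eE eab; have [ie|ie] := boolP (inside (cover Y) e); last first.
    by apply: (clE e) => //; rewrite mem_filter ie.
  by case/betweenP: eab => k; move: ie; rewrite /inside k /= => /andP [h1 h2]; apply: clY.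
by rewrite /esum /wt big_filter [in RHS](bigID (inside (cover Y))) /= addrC addrK.
Qed.

(** The new block is granted its full diameter bound [74 * r] as passage, so all edges leading out
    of the region can stay. *)
Lemma star_improves : 75 * r <= W region -> exists st', improves st'.
Proof.
move=> WR; have [e0 e1 h1] := r_facts; have rr := r0; have h0' := h0.
have YN := region_nbhd; have Yb := Q_bl YN.
have [s [N [[ts sl] st' [ws wN] rs rd]]] := star YN core_region region_comp_weight.
have [Ep El pE lk wE] := pure_edges Yb.
exists (merge st region s (74 * r) [seq e <- E | ~~ inside (cover region) e]).
apply: merge_improves => //.
- exact: core_region.
- by move=> u uY; apply: reach_le (rs _ uY) _; lra.
- by move=> a b aY bY; apply: reach_le (rd _ _ aY bY) _; lra.
- by apply/andP; split; lra.
- by move=> a _ /pE.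
- by move=> a b aY bY _ _; apply: rd.
- by move=> e; rewrite mem_filter => /andP [_]; left.
have g0 := gain_gt0; have gP := gainP; have et0 := eta0; have et1 := eta1.
set w := W region in WR wN; set i := esum E _ in ws wE.
have wE' : w = \sum_(C in region) lam st C + i by [].
have gw : (300 * 100) * (w - 74 * r) <= gain * eta * (w - 74 * r).
  rewrite ler_wpM2r //; first exact: ge_75_74 (ltW rr) WR.
  rewrite -gP -[leRHS]mulr1; apply: ler_wpM2l => //; apply: ltW; exact: mulr_gt0.
have cost : 34 * r *+ N <= gain * (w - 74 * r).
  rewrite -(ler_pM2l et0).
  have -> : eta * (34 * r *+ N) = 34 * (eta * r *+ N) by rewrite -!mulrnAr; ring.
  have -> : eta * (gain * (w - 74 * r)) = gain * eta * (w - 74 * r) by ring.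
  exact: star_cost (ltW rr) wN gw WR.
rewrite wE; rewrite wE' in cost; exact: star_energy cost ws.
Qed.

(** If the mass exceeds [delta] by [eta * r], a star is built; the bridge provides the passage, and
    the block with its single port has [lam = 0]. Otherwise the tight tree errs by at most
    [5 * eta * r + 21 * h], and its passage [W absorbed] equals the mass consumed, so nothing has to
    be paid. *)
Lemma absorbed_improves : W region <= 75 * r -> exists st', improves st'.
Proof.
move=> WR; have [e0 e1 h1] := r_facts; have rr := r0; have h0' := h0; have h2 := hr.
have YN := absorbed_nbhd; have Yb := absorbed_bl.
have WA : W absorbed <= 75 * r.
  exact: le_trans (W_sub (ok_pos o) (ok_lam o) absorbed_region) WR.
have [br [dl [[bp bl' /andP [d0 d1] bn] [pout pin] wbr lk alt]]] := bridges WR.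
set i := esum E (inside (cover absorbed)) in wbr.
have wE : W absorbed = \sum_(C in absorbed) lam st C + i by [].
have [bad|good] := leP (dl + eta * r) (W absorbed).
  have [s [N [[ts sl] st' [ws wN] rs rd]]] := star YN core_absorbed absorbed_comp_weight.
  exists (merge st absorbed s 0 (bridged br)); apply: merge_improves => //.
  - exact: core_absorbed.
  - by move=> u uY; apply: reach_le (rs _ uY) _; lra.
  - by move=> a b aY bY; apply: reach_le (rd _ _ aY bY) _; lra.
  - by apply/andP; split; lra.
  - move=> e; rewrite mem_cat => /orP [/bp //|].
    by rewrite mem_filter => /andP [_]; apply: (ok_pos o).
  - move=> e; rewrite mem_cat => /orP [/bl' //|].
    by rewrite mem_filter => /andP [_]; apply: (ok_edlong o).
  - move=> a aY /hasP [e]; rewrite mem_cat => /orP [eb ae|].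
      by apply: pout => //; apply/hasP; exists e.
    by rewrite mem_filter => /andP [_ eE] ae; apply/hasP; exists e.
  - have inbr a : a \in cover absorbed -> port (bridged br) a -> port br a.
      move=> aY /hasP [e]; rewrite mem_cat => /orP [eb ae|]; first by apply/hasP; exists e.
      by rewrite mem_filter => /andP [/andP [b1 b2] _] /orP [] /eqP ae;
        rewrite ae aY in b1 b2.
    move=> a b aY bY /(inbr _ aY) pa /(inbr _ bY) pb; rewrite (pin _ _ aY bY pa pb).
    exact: reach_nil.
  - move=> e; rewrite mem_cat => /orP [/bn|]; first by right.
    by rewrite mem_filter => /andP [_]; left.
  have g0 := gain_gt0; have gP := gainP; have et0 := eta0; have et1 := eta1.
  have wB : wt (bridged br) = wt br + esum E (outside (cover absorbed)).
    by rewrite /bridged wt_cat /wt big_filter.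
  have gw : (300 * 100) * r <= gain * eta * r.
    rewrite ler_wpM2r ?(ltW rr) // -gP -[leRHS]mulr1; apply: ler_wpM2l => //.
    by apply: ltW; apply: mulr_gt0.
  have gw' : (300 * 100) * r <= gain * (eta * r) by rewrite mulrA.
  have cost : 34 * r *+ N <= 21 / 30 * (gain * (eta * r)).
    rewrite -(ler_pM2l et0).
    have -> : eta * (34 * r *+ N) = 34 * (eta * r *+ N) by rewrite -!mulrnAr; ring.
    have -> : eta * (21 / 30 * (gain * (eta * r))) = 21 / 30 * (gain * eta * eta * r) by ring.
    by rewrite gP; apply: bridge_cost (ltW rr) wN WA _.
  have hr1 : h <= r by lra.
  rewrite wE in bad; apply: bridge_energy (ltW rr) g0 ws cost gw' d1 hr1 h2 bad _.
  by rewrite wB; move: wbr; rewrite -/i; lra.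
case: alt => [k|[cA [p [q [pA qA dE]]]]]; first by have := lt_le_trans good k; rewrite ltxx.
have diam C a b : C \in absorbed -> a \in C -> b \in C -> reach (tr st C) a b h.
  by move=> CA; have [_] := Q_diam YN CA; apply.
have [s [[ts sl] st' ws rs] rx] := tight_merge D0 Dsym Dtri (ok_pos o) (ok_edlong o) (ok_lam o) h0
  (Q_triv YN) (Q_tree YN) (Q_long YN) (nbhd_lam YN) diam cA pA qA.
have [Ep El pE lk' wE'] := pure_edges Yb.
rewrite -dE in rx.
exists (merge st absorbed s (W absorbed) [seq e <- E | ~~ inside (cover absorbed) e]).
have xx u : u \in cover absorbed -> D x u <= 33 * r := @Q_ball _ YN u.
apply: merge_improves => //.
- exact: core_absorbed.
- have [B BC xB] := x_core; have xA := mem_coverP (subsetP core_absorbed _ BC) xB.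
  by move=> u uY; apply: reach_le (rx _ _ xA uY) _; lra.
- move=> a b aY bY; apply: reach_le (rx _ _ aY bY) _.
  by have := Dtri x a b; have := xx _ aY; have := xx _ bY; rewrite (Dsym a x); lra.
- by apply/andP; split; [exact: W_ge0 (ok_pos o) (ok_lam o) _|lra].
- by move=> a _ /pE.
- move=> a b aY bY /pE pa /pE pb; apply: reach_le (rs _ _ aY bY) _.
  by rewrite /slack pa pb !addr0.
- by move=> e; rewrite mem_filter => /andP [_]; left.
rewrite wE' -/i; move: ws; rewrite -/i wE; lra.
Qed.

Lemma step : exists st', improves st'.
Proof.
by case: (leP (75 * r) (W region)) => WR; [exact: star_improves|apply: absorbed_improves; lra].
Qed.

End Step.

(** * Light trees exact around well separated centres *)

Section Levels.
Context (R : realFieldType) (V : finType) (D : V -> V -> R).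
Hypotheses (D0 : forall x, D x x = 0) (Dsym : forall x y, D x y = D y x)
  (Dtri : forall y x z, D x z <= D x y + D y z).
Implicit Types (A B C T : {set V}) (S U Q Y : {set {set V}}) (st : state R V).
Context (eta : R) (eta0 : 0 < eta) (eta1 : eta <= 1).

Definition extends st st' := forall C, C \in bl st ->
  exists2 C', C' \in bl st' & {subset tr st C <= tr st' C'}.

Lemma extends_trans st1 st2 st3 : extends st1 st2 -> extends st2 st3 -> extends st1 st3.
Proof.
move=> h1 h2 C /h1 [C' /h2 [C'' C''b s2] s1]; exists C'' => // e /s1/s2; done.
Qed.

Definition served st r x := exists2 C, C \in bl st &
  forall u, D x u <= r -> reach (tr st C) x u (D x u + 8 * eta * r).

Lemma served_extends st st' r x : extends st st' -> served st r x -> served st' r x.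
Proof.
move=> st_st' [C /st_st' [C' C'b sub] H]; exists C' => // u /H; exact: reach_sub.
Qed.

Definition energy st := total st + gain eta * potential st.

Definition bounded st h := (forall C, C \in bl st -> lam st C <= h /\
    forall a b, a \in C -> b \in C -> reach (tr st C) a b h) /\
  (forall e, e \in ed st -> e.2 <= h).

(** Earlier steps of the same scale changed only what lies within [34 * r] of their centres. As
    [34 + 40 < 100], the ball of radius [40 * r] around the next centre still has the bound [h] of
    the previous scale, not [100 * r]. *)
Lemma level st r h (xs : seq V) : ok D st -> 0 < r -> 0 <= h -> 100 * h <= eta * r ->
  bounded st h -> uniq xs -> {in xs &, forall x y, x != y -> 100 * r <= D x y} ->
  exists st', [/\ ok D st', extends st st', energy st' <= energy st,
    {in xs, forall x, served st' r x} & bounded st' (100 * r)].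
Proof.
move=> o r0 h0 hr [bb be] uxs sep.
have hr' : h <= 100 * r.
  have : eta * r <= 1 * r by rewrite ler_wpM2r // ltW.
  by rewrite mul1r; lra.
pose local st' (xs' : seq V) := (forall C, C \in bl st' ->
    (lam st' C <= h /\ forall a b, a \in C -> b \in C -> reach (tr st' C) a b h) \/
    exists2 x, x \in xs' & [/\ forall v, v \in C -> D x v <= 34 * r, lam st' C <= 100 * r &
      forall a b, a \in C -> b \in C -> reach (tr st' C) a b (100 * r)]) /\
  (forall e, e \in ed st' -> e.2 <= h \/
    exists2 x, x \in xs' & [/\ D x e.1.1 <= 34 * r, D x e.1.2 <= 34 * r & e.2 <= 100 * r]).
suff [st' [ o' ex' en' sv' [lb le]]] : exists st', [/\ ok D st', extends st st',
    energy st' <= energy st, {in xs, forall x, served st' r x} & local st' xs].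
  exists st'; split=> //; split.
  - move=> C /lb [[l1 l2]|[x _ [_ l1 l2]]]; last by split.
    split; first exact: le_trans l1 hr'.
    by move=> a b aC bC; apply: reach_le (l2 _ _ aC bC) hr'.
  - by move=> e /le [k|[x _ [_ _ k]]] //; apply: le_trans k hr'.
elim/last_ind: xs uxs sep => [_ _|xs x IH].
  exists st; split=> //; first by move=> C Cb; exists C.
  by split=> [C /bb|e /be]; left.
rewrite rcons_uniq => /andP [xxs uxs] sep.
have [||st1 [ o1 ex1 en1 sv1 [lb1 le1]]] := IH => //.
  by move=> y z yx zx; apply: sep; rewrite mem_rcons inE ?yx ?zx orbT.
have far y v : y \in xs -> D x v <= 40 * r -> D y v <= 34 * r -> False.
  move=> yx D1 D2; have xy : x != y by apply: contraNneq xxs => ->.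
  have := sep x y _ _ xy; rewrite !mem_rcons !inE eqxx yx orbT => /(_ isT isT).
  by have := Dtri v x y; rewrite (Dsym v y); lra.
have nd C v : C \in bl st1 -> v \in C -> D x v <= 40 * r ->
    lam st1 C <= h /\ forall a b, a \in C -> b \in C -> reach (tr st1 C) a b h.
  move=> Cb vC Dv; case: (lb1 C Cb) => // -[y yx [Dy _ _]].
  by case: (far y v yx Dv (Dy _ vC)).
have ne e a b : e \in ed st1 -> between e a b -> D x a <= 40 * r -> e.2 <= h.
  move=> eE eab Da; case: (le1 e eE) => // -[y yx [D1 D2 _]].
  by case: (far y a yx Da); case/betweenP: eab => k; [move: D1|move: D2]; rewrite k.
have [st2 [ o2 ex2 en2 sv2 [lb2 le2]]] :=
  step D0 Dsym Dtri o1 r0 eta0 eta1 h0 hr nd ne.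
exists st2; split=> //.
- exact: extends_trans ex2.
- exact: le_trans en1.
- move=> y; rewrite mem_rcons inE => /orP [/eqP -> //|/sv1]; exact: served_extends.
split.
- move=> C /lb2 [[Cb tE lE]|H]; last by right; exists x => //; rewrite mem_rcons mem_head.
  rewrite tE lE; case: (lb1 C Cb) => [|[y yx H]]; first by left.
  by right; exists y => //; rewrite mem_rcons inE yx orbT.
- move=> e /le2 [eE|H]; last by right; exists x => //; rewrite mem_rcons mem_head.
  case: (le1 e eE) => [|[y yx H]]; first by left.
  by right; exists y => //; rewrite mem_rcons inE yx orbT.
Qed.

Definition start (E : seq (V * V * R)) :=
  State [set [set v] | v in [set: V]] (fun _ => [::]) (fun _ => 0) E.

Lemma start_ok E : positive_edges E -> long_edges D E ->
  linked [set [set v] | v in [set: V]] E -> ok D (start E).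
Proof.
move=> Ep El lk; split=> //=.
- apply/trivIsetP => A B /imsetP [a _ ->] /imsetP [b _ ->] ab.
  by rewrite disjoints1 inE; apply: contraNneq ab => ->.
- apply/setP => v; rewrite inE; apply: (mem_coverP (C := [set v])); last by rewrite inE.
  by apply/imsetP; exists v.
- by move=> C /imsetP [a _ ->]; apply: tree_single.
- by move=> C a b /imsetP [c _ ->] /set1P -> /set1P -> _ _; apply: reach_nil.
Qed.

Lemma start_energy E : energy (start E) = (1 + gain eta) * wt E.
Proof.
rewrite /energy /total /potential /= !big1 ?add0r; first by ring.
  by [].
by move=> C _; rewrite wt_nil.
Qed.

(** Blocks and edges are bounded by [100 * r i] after scale [i], and the next scale asks that 100
    times this be at most [eta * r i.+1]. At the end the blocks are joined along the remaining
    edges, whose weight is part of the energy. *)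
Theorem light_tree E (r : nat -> R) (X : nat -> {set V}) (K : nat) (h : R) (v0 : V) :
  positive_edges E -> long_edges D E -> linked [set [set v] | v in [set: V]] E ->
  (forall i, 0 < r i) -> (forall i, 100 * (100 * r i) <= eta * r i.+1) ->
  0 <= h -> 100 * h <= eta * r 0%N -> (forall e, e \in E -> e.2 <= h) ->
  (forall i, {in X i &, forall x y, x != y -> 100 * r i <= D x y}) ->
  exists s, [/\ tree_on [set: V] s, long_edges D s, wt s <= (1 + gain eta) * wt E &
    forall i x u, (i < K)%N -> x \in X i -> D x u <= r i ->
      reach s x u (D x u + 8 * eta * r i)].
Proof.
move=> Ep El lk r0 rr h0 hr Eh sep.
have [st [ o en sv [h' [h'0 [_ [bb be]]]]]] : exists st, [/\ ok D st, energy st <= energy (start E),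
    forall i x, (i < K)%N -> x \in X i -> served st (r i) x &
    exists h', 0 <= h' /\ 100 * h' <= eta * r K /\ bounded st h'].
  elim: K => [|K [st [ o en sv [h' [h'0 [h'r b]]]]]].
    exists (start E); split=> //; first exact: start_ok.
    exists h; split=> //; split=> //; split=> [C /imsetP [a _ ->]|e /Eh //] /=.
    by split=> // b c /set1P -> /set1P ->; apply: reach_nil.
  have [|st' [ o' ex' en' sv' b']] := level o (r0 K) h'0 h'r b (enum_uniq (mem (X K))).
    by move=> x y; rewrite !mem_enum; apply: sep.
  exists st'; split=> //.
  - exact: le_trans en.
  - move=> i x; rewrite ltnS leq_eqVlt => /orP [/eqP -> xX|iK xX].
      by apply: sv'; rewrite mem_enum.
    by apply: served_extends ex' _; apply: sv.
  - by exists (100 * r K); split; [rewrite mulr_ge0 ?(ltW (r0 K))|split].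
have [C0 C0b _] := ok_block v0 o.
have lamU C a b : C \in bl st -> a \in C -> b \in C ->
    reach (tr st C) a b (lam st C + slack (ed st) h' a + slack (ed st) h' b).
  move=> Cb aC bC; have [_ rC] := bb C Cb; have l0 := ok_lam o C; rewrite /slack.
  case: ifP => pa; case: ifP => pb.
  - by rewrite !addr0; apply: (ok_port o Cb).
  - by apply: reach_le (rC _ _ aC bC) _; lra.
  - by apply: reach_le (rC _ _ aC bC) _; lra.
  - by apply: reach_le (rC _ _ aC bC) _; lra.
have sp := spans1 (ok_pos o) (ok_tree o) (ok_long o) lamU C0b.
have C0s : [set C0] \subset bl st by rewrite sub1set.
have C0n : [set C0] != set0 by apply/set0Pn; exists C0; rewrite inE.
have [s [[[ts sl] st' ws _] _ _]] := spans_conn Dsym (ok_pos o) (ok_edlong o) (ok_lam o) h'0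
  (ok_triv o) (ok_tree o) (ok_long o) lamU (ok_conn o) C0s C0n sp.
exists s; split=> //.
- by rewrite -(ok_cover o).
- rewrite -start_energy; apply: le_trans en; rewrite /energy.
  have p0 : 0 <= gain eta * potential st.
    rewrite mulr_ge0 ?(ltW (gain_gt0 eta0)) // addr_ge0 ?(wt_ge0 (ok_pos o)) //.
    by apply: sumr_ge0 => C _; apply: (ok_lam o).
  have : esum (ed st) (inside (cover (bl st))) <= wt (ed st).
    exact: (@esum1 _ _ (ed st) (ok_pos o) predT).
  by move: ws; rewrite /trees_weight /total; lra.
- by move=> i x u iK xX Du; have [C Cb H] := sv i x iK xX; apply: reach_sub (st' C Cb) (H u Du).
Qed.

End Levels.

(** * Bounding the degrees *)

Section TreeGraph.
Context (R : realFieldType) (V : finType).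
Implicit Types (s t : seq (V * V * R)) (A B : {set V}).

Definition edge_rel s := [rel x y | has (fun e => between e x y) s].

Lemma grel_sym s : symmetric (edge_rel s).
Proof. by move=> x y /=; apply: eq_has => e; rewrite between_sym. Qed.

Lemma grel_cons e s x y : edge_rel (e :: s) x y = between e x y || edge_rel s x y.
Proof. by []. Qed.

Lemma grel_cat s t x y : edge_rel (s ++ t) x y = edge_rel s x y || edge_rel t x y.
Proof. by rewrite /= has_cat. Qed.

Lemma tree_grel A s x y : tree_on A s -> edge_rel s x y -> [/\ x \in A, y \in A & x != y].
Proof.
move=> T; elim: T x y => [//|{}A B {}s t a b w _ IHs _ IHt d aA bB w0] x y.
have ab : a != b by apply: contraTneq aA => ->; rewrite (disjointFl d bB).
rewrite grel_cons grel_cat => /or3P [/betweenP [] [<- <-]|/IHs[h1 h2 h3]|/IHt[h1 h2 h3]];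
  split; rewrite ?inE ?aA ?bB ?h1 ?h2 ?orbT // eq_sym.
by [].
Qed.

Lemma tree_connect A s x y : tree_on A s -> x \in A -> y \in A -> connect (edge_rel s) x y.
Proof.
move=> T; elim: T x y => [a x y /set1P -> /set1P -> //|{}A B {}s t a b w _ IHs _ IHt d aA bB w0].
set u := _ :: _.
have su x y : x \in A -> y \in A -> connect (edge_rel u) x y.
  move=> xA yA; apply: connect_sub (IHs x y xA yA) => p q pq; apply: connect1.
  by move: pq; rewrite /u /= has_cat => ->; rewrite orbT.
have tu x y : x \in B -> y \in B -> connect (edge_rel u) x y.
  move=> xA yA; apply: connect_sub (IHt x y xA yA) => p q pq; apply: connect1.
  by move: pq; rewrite /u /= has_cat => ->; rewrite !orbT.
have ab : connect (edge_rel u) a b.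
  by apply: connect1; rewrite /u /= /between eqxx.
have mix x y : x \in A -> y \in B -> connect (edge_rel u) x y.
  by move=> xA yB; apply: connect_trans (su _ _ xA aA) (connect_trans ab (tu _ _ bB yB)).
move=> x y; rewrite !inE => /orP [xA|xB] /orP [yA|yB]; [exact: su|exact: mix| |exact: tu].
by rewrite (sym_connect_sym (@grel_sym u)); apply: mix.
Qed.

(* A cycle cannot cross the bridge [a b]: after leaving [A] through it, the only way back is
   through [b] again. *)
Lemma tree_acyclic A s c : tree_on A s -> (2 < size c)%N -> ~ ucycle (edge_rel s) c.
Proof.
move=> T; elim: T c => [a [//|x [//|y c]] _ /andP []//|{}A B {}s t a b w Ts IHs Tt IHt d aA bB w0].
set u := _ :: _.
have uE x y : edge_rel u x y = between (a, b, w) x y || (edge_rel s x y || edge_rel t x y).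
  by rewrite /u grel_cons grel_cat.
have stepA x y : edge_rel u x y -> x \in A -> (x != a) || (y != b) -> y \in A /\ edge_rel s x y.
  rewrite uE => /or3P [/betweenP [[ax by']|[ay bx]]|xy|/(tree_grel Tt) [xB _ _]] xA.
  - by rewrite -ax -by' !eqxx.
  - by rewrite -bx (disjointFl d bB) in xA.
  - by have [_ yA _] := tree_grel Ts xy.
  - by rewrite (disjointFr d xA) in xB.
have stepB x y : edge_rel u x y -> x \in B -> (x != b) || (y != a) -> y \in B /\ edge_rel t x y.
  rewrite uE => /or3P [/betweenP [[ax by']|[ay bx]]|/(tree_grel Ts) [xA _ _]|xy] xB.
  - by rewrite -ax (disjointFr d aA) in xB.
  - by rewrite -bx -ay !eqxx.
  - by rewrite (disjointFr d xA) in xB.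
  - by have [_ yB _] := tree_grel Tt xy.
have pathA x p : path (edge_rel u) x p -> x \in A -> a \notin belast x p ->
    path (edge_rel s) x p.
  elim: p x => [|y p IH] x //= /andP [xy yp] xA; rewrite inE negb_or eq_sym => /andP [ax ap].
  have xab : (x != a) || (y != b) by rewrite ax.
  by have [yA xy'] := stepA _ _ xy xA xab; apply/andP; split=> //; apply: IH.
have pathB x p : path (edge_rel u) x p -> x \in B -> b \notin belast x p ->
    last x p \in B.
  elim: p x => [|y p IH] x //= /andP [xy yp] xB; rewrite inE negb_or eq_sym => /andP [bx bp].
  have xab : (x != b) || (y != a) by rewrite bx.
  by have [yB _] := stepB _ _ xy xB xab; apply: IH.
have pathB' x p : path (edge_rel u) x p -> x \in B -> a \notin p -> path (edge_rel t) x p.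
  elim: p x => [|y p IH] x //= /andP [xy yp] xB; rewrite inE negb_or eq_sym => /andP [ya ap].
  have xab : (x != b) || (y != a) by rewrite ya orbT.
  by have [yB xy'] := stepB _ _ xy xB xab; apply/andP; split=> //; apply: IH.
move=> c c2 uc.
have [ac|ac] := boolP (a \in c).
  have [i c' ec] := rot_to ac.
  have uc' : ucycle (edge_rel u) (a :: c') by rewrite -ec rot_ucycle.
  have c2' : (2 < size (a :: c'))%N by rewrite -ec size_rot.
  case: c' {ec} uc' c2' => [//|y c'] /andP [cyc]; rewrite cons_uniq => /andP [ay uy] c2'.
  move: cyc; rewrite /cycle rcons_cons => /andP [ay' yp].
  have [yb|yb] := eqVneq y b; last first.
    have [yA ay''] : y \in A /\ edge_rel s a y by apply: stepA ay' aA _; rewrite yb orbT.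
    apply: (IHs (a :: y :: c')) => //; apply/andP; split; last by rewrite cons_uniq ay.
    rewrite /cycle rcons_cons; apply/andP; split=> //.
    by apply: pathA yp yA _; rewrite belast_rcons.
  case: c' {c2'} (c2') yp ay uy => [//|z p] _; rewrite yb rcons_cons => /andP [bz zp].
  rewrite !inE !negb_or => /and3P [ab az ap] /andP [].
  rewrite inE negb_or => /andP [bz' bp] _.
  have [zB _] : z \in B /\ edge_rel t b z by apply: stepB bz bB _; rewrite eq_sym az orbT.
  have := pathB _ _ zp zB; rewrite belast_rcons last_rcons inE negb_or bz' bp => /(_ isT).
  by rewrite (disjointFr d aA).
case: c c2 uc ac => [//|x p] c2 /andP [cyc up] ac.
have xAB : x \in A \/ x \in B.
  move: cyc; rewrite /cycle; case: (p) => [|y q] /= /andP [+ _].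
    by rewrite -/(edge_rel u x x) => /(tree_grel (tree_join Ts Tt d aA bB w0)) [] //; rewrite eqxx.
  by rewrite -/(edge_rel u x y) => /(tree_grel (tree_join Ts Tt d aA bB w0)) [+ _ _];
    rewrite inE => /orP.
case: xAB => [xA|xB]; [apply: (IHs (x :: p))|apply: (IHt (x :: p))] => //; apply/andP; split=> //.
  by apply: pathA cyc xA _; rewrite belast_rcons.
by apply: pathB' cyc xB _; rewrite mem_rcons.
Qed.

End TreeGraph.

(** * Expanding vertices into chains *)

Section Grid.
Context (R : realFieldType) (V : finType) (s : seq (V * V * R)) (theta : R) (e0 : V * V * R).
Hypotheses (s_pos : positive_edges s) (theta0 : 0 < theta).
Local Notation n := (size s).
Local Notation grid_vertex := (V * 'I_n.+1)%type.
Implicit Types (x y z : grid_vertex) (A B : {set V}).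

(* Each vertex becomes a chain with one slot per edge of [s], and the [i]-th edge joins the [i]-th
   slots of its ends: this bounds the degrees by 3. *)
Definition chain x y := (x.1 == y.1) && ((x.2.+1 == y.2 :> nat) || (y.2.+1 == x.2 :> nat)).
Definition cross x y := [&& x.2 == y.2, (x.2 < n)%N & between (nth e0 s x.2) x.1 y.1].
Definition grid x y := chain x y || cross x y.
Definition grid_weight x y := if x.1 == y.1 then theta else (nth e0 s x.2).2.

(** The weights in [t] are placeholders: only the shape of the tree is used, and the weights are
    those of [grid_weight]. *)
Lemma chain_tree a m : (m <= n)%N -> exists t : seq (grid_vertex * grid_vertex * R),
  tree_on [set x : grid_vertex | (x.1 == a) && (x.2 <= m)%N] t /\
  forall x y, edge_rel t x y = [&& x.1 == a, y.1 == a, (x.2 <= m)%N, (y.2 <= m)%N & chain x y].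
Proof.
elim: m => [_|m IH mn].
  exists [::]; split.
    have -> : [set x : grid_vertex | (x.1 == a) && (x.2 <= 0)%N] = [set (a, ord0)].
      by apply/setP => -[v i]; rewrite !inE xpair_eqE /= leqn0.
    exact: tree_single.
  move=> [v i] [w j] /=; rewrite /chain /=.
  by case: eqP => //= _; case: eqP => //= _; rewrite !leqn0; lia.
have [t [tt tE]] := IH (ltnW mn).
have im : (inord m : 'I_n.+1) = m :> nat by rewrite inordK // ltnS ltnW.
have im1 : (inord m.+1 : 'I_n.+1) = m.+1 :> nat by rewrite inordK.
exists (((a, inord m), (a, inord m.+1), 1) :: t ++ [::]); split.
  have -> : [set x : grid_vertex | (x.1 == a) && (x.2 <= m.+1)%N] =
      [set x : grid_vertex | (x.1 == a) && (x.2 <= m)%N] :|: [set (a, inord m.+1)].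
    apply/setP => -[v i]; rewrite !inE xpair_eqE /= -andb_orr; congr (_ && _).
    by rewrite -val_eqE /= im1; lia.
  apply: tree_join tt (tree_single _ _) _ _ _ _ => //; rewrite ?inE //=.
  - by rewrite disjoint_sym disjoints1 inE /= eqxx im1 ltnn.
  - by rewrite eqxx im leqnn.
move=> [v i] [w j]; rewrite grel_cons cats0 tE /chain /between /= !xpair_eqE.
rewrite -!val_eqE /= im im1.
case: (eqVneq v a) => [va|va]; case: (eqVneq w a) => [wa|wa] //=; rewrite ?va ?wa ?eqxx /=; lia.
Qed.

(** A subtree occupies the positions of [s] from [o] on, and thus its own slots. All chains have
    full length from the start, so joining two subtrees adds exactly one cross edge. *)
Lemma grid_tree_at A s' o : tree_on A s' -> (o + size s' <= n)%N ->
  (forall i, (i < size s')%N -> nth e0 s (o + i) = nth e0 s' i) ->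
  exists t : seq (grid_vertex * grid_vertex * R), tree_on [set x : grid_vertex | x.1 \in A] t /\
  forall x y, edge_rel t x y = [&& x.1 \in A, y.1 \in A & chain x y] ||
    [&& x.2 == y.2, (o <= x.2 < o + size s')%N & between (nth e0 s x.2) x.1 y.1].
Proof.
move=> T; elim: T o => [a o _ _|{}A B s1 s2 a b w _ IH1 _ IH2 d aA bB w0 o].
  have [t [tt tE]] := chain_tree a (leqnn n); exists t; split.
    have -> // : [set x : grid_vertex | x.1 \in [set a]] = [set x : grid_vertex | (x.1 == a) && (x.2 <= n)%N].
    by apply/setP => -[v i]; rewrite !inE /= -ltnS ltn_ord andbT.
  move=> [v i] [u j]; have le_n (k : 'I_n.+1) : (k <= n)%N by rewrite -ltnS.
  rewrite tE /= !inE !le_n /= addn0.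
  have -> : (o <= i < o)%N = false by lia.
  by rewrite andbF orbF.
rewrite /= size_cat => on nE.
have [|i i1|t1 [tt1 tE1]] := IH1 o.+1; first by lia.
  by rewrite addSn -addnS nE /= ?size_cat ?nth_cat ?i1 //; lia.
have [|i i2|t2 [tt2 tE2]] := IH2 (o.+1 + size s1)%N; first by lia.
  have -> : (o.+1 + size s1 + i = o + (size s1 + i).+1)%N by lia.
  by rewrite nE /= ?size_cat ?nth_cat //; [rewrite ltnNge leq_addr /= addKn|lia].
have io : (inord o : 'I_n.+1) = o :> nat by rewrite inordK //; lia.
have no : nth e0 s o = (a, b, w) by rewrite -(addn0 o) nE.
exists (((a, inord o), (b, inord o), w) :: t1 ++ t2); split.
  have -> : [set x : grid_vertex | x.1 \in A :|: B] =
      [set x : grid_vertex | x.1 \in A] :|: [set x : grid_vertex | x.1 \in B].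
    by apply/setP => x; rewrite !inE.
  apply: tree_join tt1 tt2 _ _ _ w0; rewrite ?inE //=.
  rewrite -setI_eq0; apply/eqP/setP => x; rewrite !inE; apply/negP => /andP [xA xB].
  by rewrite (disjointFr d xA) in xB.
move=> x y.
apply: (@etrans _ _ (between ((a, inord o), (b, inord o), w) x y || (edge_rel t1 x y || edge_rel t2 x y))).
  by rewrite /= has_cat.
rewrite tE1 tE2; case: x y => [v i] [u j]; rewrite [LHS]/= [RHS]/= !inE.
have -> : between ((a, inord o), (b, inord o), w) (v, i) (u, j) =
    [&& i == j, (i == o :> nat) & between (a, b, w) v u].
  rewrite /between /= !xpair_eqE -!val_eqE /= io.
  rewrite !(eq_sym o).
  by case: (a == v); case: (b == u); case: (a == u); case: (b == v) => //=; lia.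
have -> : [&& i == j, i == o :> nat & between (a, b, w) v u] =
   [&& i == j, i == o :> nat & between (nth e0 s i) v u].
  by case: (i == j) => //=; case: eqP => //= ->; rewrite no.
have -> : [&& (v \in A) || (v \in B), (u \in A) || (u \in B) & chain (v, i) (u, j)] =
    [&& v \in A, u \in A & chain (v, i) (u, j)] || [&& v \in B, u \in B & chain (v, i) (u, j)].
  by rewrite /chain /=; have [->|] := eqVneq v u; case: (u \in A); case: (u \in B) => //=;
    rewrite ?andbF ?orbF ?orbb // ?andbF.
have -> : (o <= i < o + (size s1 + size s2).+1)%N =
    [|| i == o :> nat, (o.+1 <= i < o.+1 + size s1)%N |
        (o.+1 + size s1 <= i < o.+1 + size s1 + size s2)%N] by lia.
case: [&& v \in A, u \in A & _]; case: [&& v \in B, u \in B & _];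
  case: (i == j); case: (i == o :> nat); case: (between (nth e0 s i) v u) => //=;
  by rewrite ?orbT ?orbF ?andbF ?andbT.
Qed.

Lemma grid_tree : tree_on [set: V] s ->
  exists t : seq (grid_vertex * grid_vertex * R), tree_on [set: grid_vertex] t /\ edge_rel t =2 grid.
Proof.
move=> ts; have [//|t [tt tE]] := grid_tree_at (o := 0) ts (leqnn _); exists t; split.
  by have -> : [set: grid_vertex] = [set x : grid_vertex | x.1 \in [set: V]] by apply/setP => x; rewrite !inE.
by move=> x y; apply: etrans (tE x y) _; rewrite !inE /= add0n.
Qed.

Definition walk x (p : seq grid_vertex) : R := \sum_(a <- pairmap grid_weight x p) a.

Lemma walk_cons x y p : walk x (y :: p) = grid_weight x y + walk y p.
Proof. by rewrite /walk /= big_cons. Qed.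

Lemma walk_cat x p q : walk x (p ++ q) = walk x p + walk (last x p) q.
Proof. by rewrite /walk pairmap_cat big_cat. Qed.

Lemma grid_sym x y : grid x y = grid y x.
Proof.
rewrite /grid /chain /cross (eq_sym y.1) (orbC (y.2.+1 == x.2 :> nat)); congr (_ || _).
rewrite (eq_sym y.2); case: eqP => //= ->; by rewrite between_sym.
Qed.

Lemma grid_weight_sym x y : grid x y -> grid_weight x y = grid_weight y x.
Proof.
rewrite /grid /grid_weight eq_sym; case: ifP => // xy /orP [/andP [/eqP xy' _]|/andP [/eqP -> //]].
by rewrite xy' eqxx in xy.
Qed.

Lemma grid_weight_gt0 x y : grid x y -> 0 < grid_weight x y.
Proof.
rewrite /grid /grid_weight; case: ifP => // xy /orP [/andP [xy' _]|/and3P [_ xn _]].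
  by rewrite xy' in xy.
by apply: s_pos; apply: mem_nth.
Qed.

Lemma chain_walk v (i j : 'I_n.+1) : exists p, [/\ path grid (v, i) p, last (v, i) p = (v, j) &
  walk (v, i) p <= n%:R * theta *+ 2].
Proof.
have up (k : 'I_n.+1) : exists p, [/\ path grid (v, ord0) p, last (v, ord0) p = (v, k) &
    walk (v, ord0) p <= k%:R * theta].
  case: k => k kn; elim: k kn => [kn|k IH kn].
    exists [::]; split=> //; first by congr (_, _); apply: val_inj.
    by rewrite /walk big_nil /= mul0r.
  have [p [pp lp wp]] := IH (ltnW kn).
  exists (rcons p (v, Ordinal kn)); split.
  - by rewrite rcons_path pp lp /= /grid /chain /= eqxx /= eqxx.
  - by rewrite last_rcons.
  rewrite -cats1 walk_cat lp walk_cons /walk big_nil addr0 /grid_weight /= eqxx -natr1 mulrDl mul1r.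
  by rewrite lerD.
have [p [pp lp wp]] := up i; have [q [pq lq wq]] := up j.
have rev_walk x r : path grid x r -> exists r', [/\ path grid (last x r) r',
    last (last x r) r' = x & walk (last x r) r' = walk x r].
  elim: r x => [x _|y r IH x /= /andP [xy yr]]; first by exists [::].
  have [r' [pr' lr' wr']] := IH _ yr; exists (rcons r' x); split.
  - by rewrite rcons_path pr' lr' grid_sym.
  - by rewrite last_rcons.
  rewrite -cats1 walk_cat lr' wr' !walk_cons /walk big_nil addr0 addrC.
  by rewrite grid_weight_sym // grid_sym.
have [p' [pp' lp' wp']] := rev_walk _ _ pp; rewrite lp in pp' lp' wp'.
exists (p' ++ q); split.
- by rewrite cat_path pp' lp'.
- by rewrite last_cat lp'.
rewrite walk_cat wp' lp' mulr2n; apply: lerD.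
  by apply: le_trans wp _; rewrite ler_wpM2r ?(ltW theta0) // ler_nat -ltnS.
by apply: le_trans wq _; rewrite ler_wpM2r ?(ltW theta0) // ler_nat -ltnS.
Qed.

(** A vertex is paired with the index of the edge by which it is entered; the index of the first
    vertex is a dummy. *)
Definition hop (x y : nat * V) := (y.1 < n)%N && between (nth e0 s y.1) x.2 y.2.

(** Loops are erased, which bounds the number of vertices by [#|V|] and thereby the time spent on
    chains. *)
Lemma reach_hops a b l : reach s a b l -> exists p : seq (nat * V),
  [/\ path hop (0%N, a) p, (last (0%N, a) p).2 = b, uniq (a :: map snd p) &
      \sum_(k <- p) (nth e0 s k.1).2 <= l].
Proof.
elim=> [c k k0|e {}a c {}b k {}l es eac _ [p [pp lp up wp]] kl].
  by exists [::]; rewrite big_nil.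
have ep := s_pos es.
have pos (x : nat * V) q : path hop x q -> 0 <= \sum_(k <- q) (nth e0 s k.1).2.
  elim: q x => [|y q IH] x /=; first by rewrite big_nil.
  move=> /andP [/andP [yn _] yq]; rewrite big_cons addr_ge0 ?(IH _ yq) //.
  by apply/ltW/s_pos/mem_nth.
have [ap|ap] := boolP (a \in c :: map snd p); last first.
  exists ((index e s, c) :: p); split=> //.
  - by rewrite /= /hop /= index_mem es nth_index // eac /=; case: (p) pp => //=.
  - by case: (p) lp.
  - by rewrite map_cons cons_uniq ap.
  by rewrite big_cons /= nth_index //; lra.
move: ap; rewrite inE => /orP [/eqP ->|/mapP [[j a'] jp /= aa]].
  by exists p; split=> //; lra.
subst a'; case/splitPr: jp pp lp up wp => p1 p2.
rewrite cat_path last_cat /= => /and3P [p1p /andP [jn _] p2p] lp.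
rewrite map_cat /= => /andP [_]; rewrite cat_uniq => /and3P [_ _ up].
rewrite big_cat big_cons /= => wp.
have k1 := pos _ _ p1p; have k2 := s_pos (mem_nth e0 jn).
exists p2; split=> //; last by lra.
- by case: (p2) p2p => //=.
- by case: (p2) lp.
Qed.

(** At each vertex the walk moves along the chain to the slot of the next edge, in at most [2 * n]
    steps of length [theta] (by way of slot 0). *)
Lemma reach_walk a b l : reach s a b l -> exists p, [/\ path grid (a, ord0) p,
  last (a, ord0) p = (b, ord0) & walk (a, ord0) p <= l + theta * (#|V| * n * 2)%:R].
Proof.
move=> /reach_hops [h [hp lh uh wh]].
have key : forall (h : seq (nat * V)) i v, path hop (i, v) h -> uniq (v :: map snd h) ->
    forall j : 'I_n.+1, exists p, [/\ path grid (v, j) p,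
      last (v, j) p = ((last (i, v) h).2, ord0) &
      walk (v, j) p <= \sum_(k <- h) (nth e0 s k.1).2 + theta * ((size h).+1 * n * 2)%:R].
  elim=> [|[i v'] q IH] i0 v /=.
    move=> _ _ j; have [p [pp lp wp]] := chain_walk v j ord0; exists p; split=> //.
    by rewrite big_nil add0r mul1n natrM mulrA (mulrC theta) mulr_natr.
  move=> /andP [/andP [/= iN eiv] qp] /andP [vq uq] j.
  have iN1 : (i < n.+1)%N by apply: ltnW.
  have [p [pp lp wp]] := chain_walk v j (Ordinal iN1).
  have [r [pr lr wr]] := IH i v' qp uq (Ordinal iN1).
  have vv' : v != v' by apply: contraNneq vq => ->; rewrite mem_head.
  exists (p ++ (v', Ordinal iN1) :: r); split.
  - rewrite cat_path pp lp /= pr andbT /grid; apply/orP; right.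
    by rewrite /cross /= eqxx iN.
  - by rewrite last_cat lp.
  rewrite walk_cat lp walk_cons /grid_weight /= (negbTE vv') big_cons /=.
  have -> : theta * ((size q).+2 * n * 2)%:R =
      theta * ((size q).+1 * n * 2)%:R + n%:R * theta *+ 2.
    rewrite -mulr_natr !natrM -[(size q).+2%:R]natr1; ring.
  by move: wp wr; lra.
have [p [pp lp wp]] := key h 0%N a hp uh ord0; exists p; split=> //; first by rewrite lp lh.
apply: le_trans wp _; rewrite lerD // ler_wpM2l ?(ltW theta0) // ler_nat.
have : ((size h).+1 <= #|V|)%N.
  by rewrite -(size_map snd h) -/(size (a :: map snd h)) -(card_uniqP uh) max_card.
by move=> hV; rewrite !leq_mul2r hV !orbT.
Qed.

Lemma walk_long (D : V -> V -> R) x p : (forall v, D v v = 0) ->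
  (forall u v, D u v = D v u) -> (forall v u w, D u w <= D u v + D v w) ->
  long_edges D s -> path grid x p -> D x.1 (last x p).1 <= walk x p.
Proof.
move=> D0 Dsym Dtri sl; elim: p x => [|y p IH] x /=; first by rewrite D0 /walk big_nil.
move=> /andP [xy yp]; rewrite walk_cons.
suff : D x.1 y.1 <= grid_weight x y by have := Dtri y.1 x.1 (last y p).1; have := IH _ yp; lra.
rewrite /grid_weight; have [->|nxy] := eqVneq x.1 y.1; first by rewrite D0 ltW.
move: xy; rewrite /grid /chain (negbTE nxy) /= => /and3P [_ xn /betweenP b].
by have := sl _ (mem_nth e0 xn); case: b => -> //=; rewrite Dsym.
Qed.

Lemma grid_degree x : (#|[set y | grid x y]| <= 3)%N.
Proof.
case: x => v i; pose e := nth e0 s i.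
pose other := if e.1.1 == v then e.1.2 else e.1.1.
pose N := [:: (v, inord i.+1); (v, inord i.-1); (other, i)] : seq grid_vertex.
apply: leq_trans (_ : #|N| <= 3)%N; last exact: card_size.
apply: subset_leq_card; apply/subsetP => -[u j]; rewrite inE /grid /chain /cross /=.
rewrite !inE !xpair_eqE => /orP [/andP [/eqP -> /orP [/eqP ij|/eqP ij]]|].
- by rewrite ij inord_val !eqxx.
- by rewrite -ij /= inord_val !eqxx orbT.
move=> /and3P [/eqP ij iN /betweenP b]; rewrite ij eqxx !andbT; apply/orP; right; apply/orP; right.
rewrite /other /e; case: b => -> /=; first by rewrite !eqxx.
by have [->|_] := eqVneq u v; rewrite eqxx.
Qed.

Lemma grid_weight_at v i : (forall e, e \in s -> e.1.1 != e.1.2) ->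
  \sum_(y | grid (v, i) y) grid_weight (v, i) y <= 2 * theta +
    (if (i < n)%N then ((v == (nth e0 s i).1.1) + (v == (nth e0 s i).1.2))%:R * (nth e0 s i).2 else 0).
Proof.
move=> noloop; rewrite (bigID (chain (v, i))) /=; set e := nth e0 s i; apply: lerD.
  have c2 : (#|[set y | chain (v, i) y]| <= 2)%N.
    apply: leq_trans (_ : #|[:: (v, inord i.+1); (v, inord i.-1)] : seq grid_vertex| <= 2)%N;
      last exact: card_size.
    apply: subset_leq_card; apply/subsetP => -[u j]; rewrite inE /chain /=.
    rewrite !inE !xpair_eqE => /andP [/eqP -> /orP [/eqP ij|/eqP ij]].
    - by rewrite ij inord_val !eqxx.
    - by rewrite -ij /= inord_val !eqxx orbT.
  apply: (@le_trans _ _ (\sum_(y in [set y | chain (v, i) y]) theta)).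
    rewrite [leLHS]big_mkcond [leRHS]big_mkcond; apply: ler_sum => y _; rewrite inE.
    case: ifP => [/andP [_ cy]|_]; last by case: ifP => _; rewrite ?(ltW theta0).
    by rewrite cy /grid_weight; case/andP: cy => ->.
  by rewrite sumr_const mulr_natl; apply: ler_wpMn2l c2; apply: ltW.
case: ifPn => iN; last first.
  rewrite big1 // => -[u j] /andP [/orP [-> //|]].
  by rewrite /cross /= (negbTE iN) andbF.
have ep : 0 <= e.2 by apply/ltW/s_pos/mem_nth.
apply: (@le_trans _ _ (\sum_(y in [set y | cross (v, i) y]) e.2)).
  rewrite [leLHS]big_mkcond [leRHS]big_mkcond; apply: ler_sum => y _; rewrite inE.
  case: ifP => [/andP [/orP [-> //|cy] _]|_]; last by case: ifP.
  rewrite cy /grid_weight /=; case: eqP => // vy.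
  move: cy; rewrite /cross /= -vy => /and3P [_ _ /betweenP b].
  by have := noloop _ (mem_nth e0 iN); case: b => ->; rewrite eqxx.
rewrite sumr_const mulr_natl; apply: ler_wpMn2l => //.
have [ve|ve] := boolP ((v == e.1.1) || (v == e.1.2)); last first.
  move: (ve); rewrite negb_or => /andP [/negbTE -> /negbTE ->].
  rewrite leqn0 cards_eq0; apply/eqP/setP => y; rewrite !inE; apply/negP.
  rewrite /cross /= => /and3P [_ _ /betweenP b]; case/norP: ve.
  by rewrite /e; case: b => -> /=; rewrite eqxx.
apply: (@leq_trans 1); last by case/orP: ve => ->; rewrite ?addn1.
apply: leq_trans (_ : #|[set (if e.1.1 == v then e.1.2 else e.1.1, i)]| <= 1)%N; last by rewrite cards1.
apply: subset_leq_card; apply/subsetP => -[u j]; rewrite !inE xpair_eqE /cross /=.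
rewrite /e => /and3P [/eqP -> _ /betweenP b]; rewrite eqxx andbT.
case: b => -> /=; first by rewrite eqxx.
by have [->|_] := eqVneq u v.
Qed.

Lemma grid_total : (forall e, e \in s -> e.1.1 != e.1.2) ->
  \sum_x \sum_(y | grid x y) grid_weight x y <= 2 * wt s + theta * (2 * (#|V| * n.+1))%:R.
Proof.
move=> noloop; apply: le_trans (_ : \sum_(x : grid_vertex) (2 * theta +
    (if (x.2 < n)%N then ((x.1 == (nth e0 s x.2).1.1) + (x.1 == (nth e0 s x.2).1.2))%:R *
      (nth e0 s x.2).2 else 0)) <= _).
  by apply: ler_sum => -[v i] _; apply: grid_weight_at.
rewrite big_split /= sumr_const card_prod card_ord addrC; apply: lerD; last first.
  by rewrite -mulr_natr !natrM le_eqVlt; apply/orP; left; apply/eqP; ring.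
rewrite -(pair_big xpredT xpredT (fun v (i : 'I_n.+1) => if (i < n)%N then
  ((v == (nth e0 s i).1.1) + (v == (nth e0 s i).1.2))%:R * (nth e0 s i).2 else 0)) /=.
rewrite exchange_big big_ord_recr /= ltnn big1_eq addr0 /wt (big_nth e0) big_mkord mulr_sumr.
apply: ler_sum => i _; rewrite ltn_ord -mulr_suml ler_wpM2r //; first by apply/ltW/s_pos/mem_nth.
rewrite -natr_sum big_split /= ler_nat.
have one (w : V) : (\sum_(v : V) (v == w) = 1)%N.
  by rewrite (bigD1 w) //= eqxx big1 // => v /negbTE ->.
by rewrite !one.
Qed.

End Grid.

(** * Subdividing a spanning graph *)

Section Subdivision.
Context (R : realFieldType) (P : finType) (dist : P -> P -> R) (e : rel P) (n : nat) (zeta : R).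
Hypotheses (dist0 : forall u, dist u u = 0) (dist_sym : forall u v, dist u v = dist v u)
  (dist_tri : forall v u w, dist u w <= dist u v + dist v w).
Hypotheses (n0 : (0 < n)%N) (zeta0 : 0 < zeta) (e_connect : forall u v, connect e u v).
Local Notation V := (P * P * 'I_n.+1)%type.

(* The point at fraction [i / n] of the edge [u v], in the Kuratowski embedding
   [u |-> dist p u]; the copies of a non-edge all sit at [u]. *)
Definition position (x : V) p : R :=
  dist p x.1.1 + (if e x.1.1 x.1.2 then x.2%:R / n%:R * (dist p x.1.2 - dist p x.1.1) else 0).

(** Only a pseudometric: every [(u, v, ord0)] sits at [corner u]. The [zeta] in the edge weights
    keeps them positive. *)
Definition sup_dist (x y : V) : R := \big[Num.max/0]_p `|position x p - position y p|.

Lemma sup_dist_le x y l : 0 <= l -> (forall p, `|position x p - position y p| <= l) ->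
  sup_dist x y <= l.
Proof. by move=> l0 H; apply/bigmax_leP. Qed.

Lemma le_sup_dist x y p : `|position x p - position y p| <= sup_dist x y.
Proof. exact: (le_bigmax_cond _ (fun p => `|position x p - position y p|)). Qed.

Lemma sup_dist0 x : sup_dist x x = 0.
Proof.
apply/le_anti/andP; split; last exact: bigmax_ge_id.
by apply: sup_dist_le => // p; rewrite subrr normr0.
Qed.

Lemma sup_dist_sym x y : sup_dist x y = sup_dist y x.
Proof. by apply: eq_bigr => p _; rewrite distrC. Qed.

Lemma sup_dist_tri y x z : sup_dist x z <= sup_dist x y + sup_dist y z.
Proof.
apply: sup_dist_le => [|p]; first by rewrite addr_ge0 // bigmax_ge_id.
apply: le_trans (ler_distD (position y p) _ _) _.
by rewrite lerD // le_sup_dist.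
Qed.

Definition corner u : V := (u, u, ord0).

Lemma corner_inj : injective corner.
Proof. by move=> u v []. Qed.

Lemma position0 u v p : position (u, v, ord0) p = dist p u.
Proof. by rewrite /position /= !mul0r if_same addr0. Qed.

Lemma position_end u v p : e u v -> position (u, v, ord_max) p = dist p v.
Proof.
by move=> uv; rewrite /position /= uv divff ?mul1r ?pnatr_eq0 -?lt0n // addrC subrK.
Qed.

Lemma dist_ge0 u v : 0 <= dist u v.
Proof. by have := dist_tri v u u; rewrite dist0 (dist_sym v u); lra. Qed.

Lemma dist_lip p u v : `|dist p u - dist p v| <= dist u v.
Proof.
have := dist_tri u p v; have := dist_tri v p u; rewrite (dist_sym v u) ler_norml.
by move=> h1 h2; apply/andP; split; lra.
Qed.

Lemma sup_dist_corner u v : sup_dist (corner u) (corner v) = dist u v.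
Proof.
apply/le_anti/andP; split.
  by apply: sup_dist_le (dist_ge0 _ _) _ => p; rewrite !position0 dist_lip.
apply: le_trans (le_sup_dist _ _ u).
by rewrite !position0 dist0 sub0r normrN ler_norm.
Qed.

(* A non-edge also gets its (negligible) segment, to keep the vertex set a plain product. *)
Definition segment u v : seq (V * V * R) :=
  [seq ((u, v, inord i), (u, v, inord i.+1), (if e u v then dist u v / n%:R else 0) + zeta) |
    i <- iota 0 n].

Definition segment_ends u v : seq (V * V * R) :=
  ((u, v, ord0), corner u, zeta) :: (if e u v then [:: ((u, v, ord_max), corner v, zeta)] else [::]).

Definition subdivision : seq (V * V * R) :=
  [seq g | u <- enum P, g <- flatten [seq segment u v ++ segment_ends u v | v <- enum P]].

Lemma subdivisionP g : reflect (exists u v, g \in segment u v \/ g \in segment_ends u v)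
  (g \in subdivision).
Proof.
apply: (iffP allpairsPdep) => [[u [g' [_ /flattenP [t /mapP [v _ ->] gt] ->]]]|[u [v gg]]].
  by exists u, v; move: gt; rewrite mem_cat => /orP.
exists u, g; rewrite mem_enum; split=> //; apply/flattenP.
exists (segment u v ++ segment_ends u v); last by rewrite mem_cat; apply/orP.
by apply: map_f; rewrite mem_enum.
Qed.

Lemma subdivision_long : long_edges sup_dist subdivision.
Proof.
move=> g /subdivisionP [u [v []]].
  move=> /mapP [i]; rewrite mem_iota add0n => /andP [_ iN] -> /=.
  have i0 : (i < n.+1)%N by apply: ltnW.
  have nr : 0 < n%:R :> R by rewrite ltr0n.
  have duv := dist_ge0 u v.
  apply: sup_dist_le => [|p].
    by apply: addr_ge0 (ltW zeta0); case: ifP => // _; apply: divr_ge0 => //; apply: ltW.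
  rewrite /position /= !inordK //; case: ifP => uv; last by rewrite subrr normr0 add0r ltW.
  have -> : forall a b, a + i%:R / n%:R * (b - a) - (a + i.+1%:R / n%:R * (b - a)) = (a - b) / n%:R :> R.
    by move=> a b; rewrite -natr1; field; rewrite gt_eqF.
  rewrite normrM normfV (gtr0_norm nr).
  have := dist_lip p u v; rewrite -(ler_pM2r (_ : 0 < n%:R^-1)) ?invr_gt0 //.
  by have z := zeta0; lra.
rewrite inE => /orP [/eqP ->|] /=.
  by apply: sup_dist_le => [|p]; rewrite ?(ltW zeta0) // !position0 subrr normr0 ltW.
case: ifP => // uv; rewrite inE => /eqP -> /=.
by apply: sup_dist_le => [|p]; rewrite ?(ltW zeta0) // position0 position_end // subrr normr0 ltW.
Qed.

Lemma subdivision_pos : positive_edges subdivision.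
Proof.
move=> g /subdivisionP [u [v []]].
  move=> /mapP [i _ ->] /=; apply: ltr_wpDl => //; case: ifP => // _.
  by rewrite divr_ge0 ?dist_ge0.
by rewrite inE => /orP [/eqP -> //|]; case: ifP => // uv; rewrite inE => /eqP ->.
Qed.

(** The first scale requires that no initial edge be longer than [h]; this is why the graph is
    subdivided. *)
Lemma subdivision_short h : (forall u v, dist u v <= n%:R * (h - zeta)) ->
  forall g, g \in subdivision -> g.2 <= h.
Proof.
move=> dh; have [z0 nr] : 0 < zeta /\ 0 < n%:R :> R by rewrite ltr0n.
have zh (u : P) : zeta <= h.
  by have := dh u u; rewrite dist0 pmulr_rge0 // subr_ge0.
move=> g /subdivisionP [u [v []]].
  move=> /mapP [i _ ->] /=; have := zh u; case: ifP => uv; last by rewrite add0r.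
  by move=> _; rewrite -lerBrDr ler_pdivrMr // mulrC.
by rewrite inE => /orP [/eqP ->|] /=; [exact: zh|]; case: ifP => // uv; rewrite inE => /eqP -> /=; exact: zh.
Qed.

Lemma subdivision_linked : linked [set [set x] | x in [set: V]] subdivision.
Proof.
move=> T /set0Pn [[[u0 v0] i0] T0] _ TE.
have TE' g : g \in subdivision -> (g.1.1 \in T) = (g.1.2 \in T).
  by move=> gs; apply/idP/idP; apply: TE gs _; rewrite /between -surjective_pairing eqxx ?orbT.
have seg u v (i : 'I_n.+1) : ((u, v, i) \in T) = (corner u \in T).
  have -> : (corner u \in T) = ((u, v, ord0) \in T).
    rewrite -[LHS](TE' ((u, v, ord0), corner u, zeta)) //.
    by apply/subdivisionP; exists u, v; right; rewrite mem_head.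
  case: i => i; elim: i => [|i IH] iN; first by congr (_ \in T); congr (_, _); apply: val_inj.
  rewrite -(IH (ltnW iN)); symmetry.
  have -> : Ordinal iN = inord i.+1 by apply: val_inj; rewrite /= inordK.
  have -> : Ordinal (ltnW iN) = inord i by apply: val_inj; rewrite /= inordK // ltnW.
  apply: (TE' ((u, v, inord i), (u, v, inord i.+1), (if e u v then dist u v / n%:R else 0) + zeta)).
  by apply/subdivisionP; exists u, v; left; apply: map_f; rewrite mem_iota.
have step u v : e u v -> corner u \in T -> corner v \in T.
  move=> uv; rewrite -(seg u v ord_max).
  rewrite (TE' ((u, v, ord_max), corner v, zeta)) //.
  by apply/subdivisionP; exists u, v; right; rewrite /segment_ends uv !inE eqxx orbT.
apply/setP => -[[u v] i]; rewrite inE seg.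
move: T0; rewrite seg; have /connectP [p pp ->] := e_connect u0 u.
by elim: p u0 pp => [//|w p IH] u1 /= /andP [/step uw /IH H] /uw.
Qed.

(** Both orientations of an edge of [e] are subdivided, so the main term is twice the weight of the
    graph. *)
Lemma subdivision_wt : wt subdivision <= \sum_u \sum_(v | e u v) dist u v +
  zeta * (#|P| * (#|P| * n.+2))%:R.
Proof.
have z0 := zeta0.
have one u v : wt (segment u v ++ segment_ends u v) <=
    (if e u v then dist u v else 0) + zeta * n.+2%:R.
  have nr : n%:R != 0 :> R by rewrite pnatr_eq0 -lt0n.
  rewrite /wt big_cat big_map /= big_const_seq count_predT size_iota iter_addr_0.
  rewrite /segment_ends big_cons /= -2!natr1.
  rewrite -[X in X + _]mulr_natl; case: ifP => uv; last by rewrite big_nil; lra.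
  have E : n%:R * (dist u v / n%:R) = dist u v by rewrite mulrC divfK.
  by rewrite big_cons big_nil /=; lra.
apply: le_trans (_ : \sum_u \sum_v ((if e u v then dist u v else 0) + zeta * n.+2%:R) <= _).
  rewrite /wt /subdivision big_flatten big_map /= big_enum /=.
  apply: ler_sum => u _; rewrite map_id big_flatten big_map big_enum /=.
  by apply: ler_sum => v _; apply: one.
rewrite (eq_bigr (fun u => \sum_(v | e u v) dist u v + #|P|%:R * (zeta * n.+2%:R))); last first.
  by move=> u _; rewrite big_split /= sumr_const -big_mkcond mulr_natl.
by rewrite big_split /= sumr_const -[in leLHS]mulr_natl !natrM; lra.
Qed.

End Subdivision.

(** * From an edge list to a weighted tree *)

Lemma weighted_tree_of (R : realType) (X : metricType R) (P : {fset X}) (V : finType)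
    (D : V -> V -> R) (s : seq (V * V * R)) (pt : P -> V) (theta : R) :
  (forall v, D v v = 0) -> (forall u v, D u v = D v u) ->
  (forall v u w, D u w <= D u v + D v w) -> positive_edges s -> long_edges D s ->
  tree_on [set: V]%SET s -> injective pt -> (forall u v, D (pt u) (pt v) = point_dist u v) ->
  0 < theta ->
  exists T : weighted_tree P,
    [/\ tree_weight T <= wt s + theta * (#|{: V}| * (size s).+1)%:R,
        forall x, (degree (@edge _ _ _ T) x <= 3)%N,
        forall u v, point_dist u v <= tree_dist T u v &
        forall u v l, reach s (pt u) (pt v) l ->
          tree_dist T u v <= l + theta * (#|{: V}| * size s * 2)%:R].
Proof.
move=> D0 Dsym Dtri s_pos sl ts pti ptD theta0.
have [x0 _] := tree_neq0 ts.
pose e0 : V * V * R := (x0, x0, 0).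
have [t [tok tE]] := grid_tree e0 theta0 ts.
have gc x y : connect (@grid R V s e0) x y.
  by rewrite -(eq_connect tE); apply: tree_connect tok _ _; rewrite inE.
have gt : is_tree (@grid R V s e0).
  split=> //.
  - split; first exact: grid_sym.
    move=> z; apply/negbTE/negP; rewrite -tE => /(tree_grel tok) [_ _].
    by rewrite eqxx.
  - by apply/card_gt0P; exists (x0, ord0).
  move=> c c2 /andP [cc uc]; apply: (tree_acyclic tok c2).
  rewrite /ucycle uc andbT (eq_cycle tE).
  by [].
pose g := @WeightedTree R X P _ (@grid R V s e0) (@grid_weight R V s theta e0) (fun u => (pt u, ord0)) gt
  (@grid_weight_sym R V s theta e0) (@grid_weight_gt0 R V s theta e0 s_pos theta0).
have pti' : injective (fun u => (pt u, ord0 : 'I_(size s).+1)) by move=> u v [/pti].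
pose T := g pti'; exists T; split.
- have noloop e : e \in s -> e.1.1 != e.1.2.
    move=> es; have : edge_rel s e.1.1 e.1.2.
      by apply/hasP; exists e => //; rewrite /between -surjective_pairing eqxx.
    by case/(tree_grel ts).
  rewrite /tree_weight /total_weight ler_pdivrMr //.
  by apply: le_trans (grid_total e0 s_pos theta0 noloop) _; rewrite natrM; lra.
- by move=> x; apply: grid_degree.
- move=> u v; rewrite /tree_dist /graph_dist; apply: lb_le_inf.
    have /connectP [p pp lp] := gc (pt u, ord0) (pt v, ord0).
    by exists (walk_weight (@weight _ _ _ T) (pt u, ord0) p); exists p.
  move=> _ [p [pp lp] <-]; rewrite -ptD.
  have := walk_long (e0:=e0) theta0 D0 Dsym Dtri sl pp.
  by rewrite lp.
move=> u v l /(reach_walk e0 s_pos theta0) [p [pp lp wp]]; apply: le_trans wp.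
apply: ge_inf; last by exists p.
exists 0 => _ [q [pq _] <-].
have := walk_long (e0:=e0) theta0 D0 Dsym Dtri sl pq; apply: le_trans; exact: D_ge0.
Qed.

(** * Nets in doubling spaces *)

Section Colouring.
Context (T : finType) (c : rel T) (m : nat).
Hypotheses (c_sym : symmetric c) (c_deg : forall x, (#|[set y | c x y & y != x]%SET| <= m)%N).

Lemma greedy_colouring : exists f : T -> 'I_m.+1, forall x y, c x y -> x != y -> f x != f y.
Proof.
suff [f H] : exists f : T -> 'I_m.+1, {in enum T &, forall x y, c x y -> x != y -> f x != f y}.
  by exists f => x y; apply: H; rewrite mem_enum.
elim: (enum T) (enum_uniq T) => [|z s IH] /=; first by exists (fun=> ord0).
move=> /andP [zs /IH [f H]].
pose used := [set f y | y in [set y | c z y & y != z]%SET]%SET.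
have [i iu] : exists i, i \notin used.
  apply/existsP; rewrite -negb_forall; apply/negP => /forallP all.
  have : (#|[set: 'I_m.+1]%SET| <= #|used|)%N by apply/subset_leq_card/fintype.subsetP => i _.
  rewrite cardsT card_ord; apply/negP; rewrite -ltnNge ltnS.
  by apply: leq_trans (leq_imset_card _ _) _.
exists (fun x => if x == z then i else f x) => x y.
have new w : c z w -> z != w -> i != f w.
  move=> zw nzw; apply: contraNneq iu => ->; apply: imset_f.
  by rewrite inE zw eq_sym.
rewrite !inE; have [->|xz] := eqVneq x z; have [->|yz] := eqVneq y z => //=.
- by move=> _ _ zy _; apply: new => //; rewrite eq_sym.
- by move=> _ _ xz' _; rewrite eq_sym; apply: new; [rewrite c_sym|rewrite eq_sym].
exact: H.
Qed.

End Colouring.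

Section Net.
Context (R : realFieldType) (T : finType) (dist : T -> T -> R) (sigma : R).
Hypotheses (dist_sym : forall u v, dist u v = dist v u) (dist0 : forall u, dist u u = 0)
  (sigma0 : 0 < sigma).

(** A maximal [sigma]-separated set is a net. *)
Lemma exists_net : exists N : {set T},
  {in N &, forall x y, x != y -> sigma <= dist x y} /\
  forall u, exists2 x, x \in N & dist x u < sigma.
Proof.
pose sep (N : {set T}) := [forall x in N, forall y in N, (x != y) ==> (sigma <= dist x y)].
have sepP (N : {set T}) : reflect {in N &, forall x y, x != y -> sigma <= dist x y} (sep N).
  apply: (iffP forall_inP) => [H x y xN yN xy|H x xN].
    by have /forall_inP /(_ y yN) /implyP := H x xN; apply.
  by apply/forall_inP => y yN; apply/implyP; apply: H.
have [N /maxsetP [Ns Nmax] _] : {N | maxset sep N & set0 \subset N}.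
  by apply: maxset_exists; apply/sepP => x y; rewrite inE.
exists N; split; first exact/sepP.
move=> u; apply: contrapT => nx.
have far x : x \in N -> ~~ (dist x u < sigma) by move=> xN; apply/negP => h; apply: nx; exists x.
have uN : u \notin N by apply/negP => /far; rewrite dist0 sigma0.
suff /Nmax /(_ (subsetUr _ _)) E : sep (u |: N)%SET by rewrite -E setU11 in uN.
apply/sepP => x y; rewrite !inE => /orP [/eqP ->|xN] /orP [/eqP ->|yN]; rewrite ?eqxx //.
- by move=> _; rewrite dist_sym leNgt far.
- by move=> _; rewrite leNgt far.
- by move/sepP: Ns; apply.
Qed.

End Net.

(** * Packing from doubling *)

Section Packing.
Context (R : realType) (X : metricType R) (d : R).
Hypothesis (doubling : doubling_dimension X d).

Lemma doubling_iter n (x : X) r : 0 < r -> exists s : seq X, (size s)%:R <= (2 `^ d) ^+ n /\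
  (ball x r `<=` \bigcup_(y in [set` s]) ball y (r / 2 ^+ n))%classic.
Proof.
move=> r0; elim: n => [|n [s [ss sb]]].
  exists [:: x]; split; first by rewrite expr0.
  by move=> z xz; exists x; rewrite /= ?mem_head // expr0 divr1.
have q0 : 0 < r / 2 ^+ n by rewrite divr_gt0 // exprn_gt0.
have [f fP] := choice (fun y => doubling y q0).
exists (flatten [seq f y | y <- s]); split.
  rewrite size_flatten sumnE big_map big_map natr_sum.
  apply: le_trans (_ : \sum_(y <- s) 2 `^ d <= _).
    by apply: ler_sum => y _; case: (fP y).
  rewrite big_const_seq count_predT iter_addr_0 -[leLHS]mulr_natl exprSr.
  by rewrite ler_wpM2r // powR_ge0.
move=> z /sb [y ys] /(proj2 (fP y)) [w wf wz]; exists w.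
  by apply/flattenP; exists (f y) => //; apply: map_f.
by move: wz; rewrite exprSr invfM mulrA.
Qed.

Variable P : {fset X}.

(** After [n] halvings a covering ball has radius [r / 2 ^+ n] and contains at most one point of
    [A]. *)
Lemma packing (A : {set P}) (x : P) n r : 0 < r -> (forall y, y \in A -> point_dist x y < r) ->
  {in A &, forall y z, y != z -> r *+ 2 <= 2 ^+ n * point_dist y z} ->
  #|A|%:R <= (2 `^ d) ^+ n.
Proof.
move=> r0 near sep; have [s [ss sb]] := doubling_iter n (val x) r0.
apply: le_trans ss; rewrite ler_nat.
have cov (y : P) : exists z, y \in A -> z \in s /\ mdist z (val y) < r / 2 ^+ n.
  have [yA|] := boolP (y \in A); last by exists (val x).
  have [|z zs zy] := sb (val y); first by rewrite ballEmdist /=; apply: near.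
  by exists z => _; split=> //; move: zy; rewrite ballEmdist.
have [f fP] := choice cov.
rewrite cardE -(size_map f); apply: uniq_leq_size.
  rewrite map_inj_in_uniq ?enum_uniq // => y z; rewrite !mem_enum => yA zA fyz.
  apply/eqP; apply: contraT => yz.
  have [_ hy] := fP y yA; have [_ hz] := fP z zA.
  have := sep y z yA zA yz; rewrite leNgt mulrC -ltr_pdivlMr ?exprn_gt0 // => /negP [].
  rewrite mulrnAl mulr2n /point_dist; rewrite fyz in hy.
  by apply: le_lt_trans (metric_triangle _ (f z) _) (ltrD _ hz); rewrite metric_sym.
by move=> z /mapP [y]; rewrite mem_enum => yA ->; case: (fP y yA).
Qed.

End Packing.

(** * One tree of the cover *)

Section PointDist.
Context (R : realType) (X : metricType R) (P : {fset X}).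
Implicit Types u v w : P.

Lemma point_dist0 u : point_dist u u = 0.
Proof. exact: mdistxx. Qed.

Lemma point_distC u v : point_dist u v = point_dist v u.
Proof. exact: metric_sym. Qed.

Lemma point_dist_tri v u w : point_dist u w <= point_dist u v + point_dist v w.
Proof. exact: metric_triangle. Qed.

Lemma point_dist_gt0 u v : (0 < point_dist u v) = (u != v).
Proof. exact: mdist_gt0. Qed.

Lemma point_dist_ge0 u v : 0 <= point_dist u v.
Proof. exact: mdist_ge0. Qed.

Lemma light_net_tree (e : rel P) (u0 : P) (eta beta : R) (r : nat -> R) (Y : nat -> {set P}) K :
  (forall u v, connect e u v) -> 0 < eta -> eta <= 1 -> 0 < beta ->
  (forall i, 0 < r i) -> (forall i, 100 * (100 * r i) <= eta * r i.+1) ->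
  (forall i, {in Y i &, forall x y, x != y -> 100 * r i <= point_dist x y}) ->
  exists T : weighted_tree P,
    [/\ tree_weight T <= (1 + gain eta) * (\sum_u \sum_(v | e u v) point_dist u v + beta) + beta,
        forall x, (degree (@edge _ _ _ T) x <= 3)%N,
        forall u v, point_dist u v <= tree_dist T u v &
        forall i x u v, (i < K)%N -> x \in Y i -> point_dist x u <= r i -> point_dist x v <= r i ->
          tree_dist T u v <= point_dist x u + point_dist x v + 16 * eta * r i + beta].
Proof.
move=> ec eta0 eta1 beta0 r0 rS Yr.
pose h := eta * r 0%N / 100.
have h0 : 0 < h by rewrite divr_gt0 // mulr_gt0.
pose S := \sum_(u : P) \sum_(v : P) point_dist u v.
have dS u v : point_dist u v <= S.
  rewrite /S (bigD1 u) //= (bigD1 v) //= -addrA lerDl addr_ge0 // sumr_ge0 // => w _.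
    exact: point_dist_ge0.
  by apply: sumr_ge0 => w' _; exact: point_dist_ge0.
have S0 : 0 <= S by apply: le_trans (dS u0 u0); exact: point_dist_ge0.
(* [S] bounds all distances, so a segment has parts of length at most [h / 2], which leaves [h / 2]
   for [zeta]. Both [zeta] and, later, [theta] are so small that their total contribution is at most
   [beta]. *)
pose n := (Num.truncn (S / (h / 2))).+1.
have nS : S <= n%:R * (h / 2).
  rewrite -ler_pdivrMr; last by rewrite divr_gt0.
  exact: (ltW (truncnS_gt _)).
have c0 : 0 < (#|{: P}| * (#|{: P}| * n.+2))%:R :> R.
  by rewrite ltr0n !muln_gt0 /= !andbT; apply/andP; split; apply/card_gt0P; exists u0.
pose zeta := Num.min (h / 2) (beta / (#|{: P}| * (#|{: P}| * n.+2))%:R).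
have zeta0 : 0 < zeta by rewrite lt_min; apply/andP; split; apply: divr_gt0.
have zh : zeta <= h / 2 by rewrite ge_min lexx.
have zb : zeta * (#|{: P}| * (#|{: P}| * n.+2))%:R <= beta.
  by rewrite -ler_pdivlMr // ge_min lexx orbT.
pose E := subdivision (@point_dist R X P) e n zeta.
pose D := sup_dist (@point_dist R X P) e (n := n).
have n0 : (0 < n)%N by [].
have short g : g \in E -> g.2 <= h.
  apply: (subdivision_short point_dist0 n0 zeta0) => u v.
  by apply: le_trans (dS u v) (le_trans nS _); apply: ler_wpM2l => //; lra.
have DE (u v : P) : D (corner n u) (corner n v) = point_dist u v.
  exact: (sup_dist_corner e n point_dist0 point_distC point_dist_tri).
have D0 := @sup_dist0 R _ (@point_dist R X P) e n : forall x, D x x = 0.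
have Dsym := @sup_dist_sym R _ (@point_dist R X P) e n : forall x y, D x y = D y x.
have Dtri := @sup_dist_tri R _ (@point_dist R X P) e n : forall y x z, D x z <= D x y + D y z.
have [|||s [ts sl sw sr]] := @light_tree R _ D D0 Dsym Dtri eta eta0 eta1 E r
    (fun i => [set corner n x | x in Y i]%SET) K h (corner n u0)
    (subdivision_pos point_dist0 point_distC point_dist_tri zeta0)
    (subdivision_long point_dist0 point_distC point_dist_tri n0 zeta0)
    (subdivision_linked ec) r0 rS (ltW h0).
- by rewrite /h mulrC divfK.
- exact: short.
- move=> i _ _ /imsetP [x xY ->] /imsetP [y yY ->] xy; rewrite DE; apply: Yr => //.
  by apply: contraNneq xy => ->.
pose V := (P * P * 'I_n.+1)%type.
have V0 : 0 < (#|{: V}| * (size s).+1 * 2)%:R :> R.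
  by rewrite ltr0n !muln_gt0 /= !andbT; apply/card_gt0P; exists (corner n u0).
pose theta := beta / (#|{: V}| * (size s).+1 * 2)%:R.
have theta0 : 0 < theta by rewrite divr_gt0.
have thV : theta * (#|{: V}| * (size s).+1 * 2)%:R = beta by rewrite divfK // gt_eqF.
have theta_le m : (m <= #|{: V}| * (size s).+1 * 2)%N -> theta * m%:R <= beta.
  by move=> mV; rewrite -thV; apply: ler_wpM2l; rewrite ?ler_nat // ltW.
have [T [Tw Td Tlow Tup]] := weighted_tree_of D0 Dsym Dtri (tree_positive ts) sl ts
  (@corner_inj _ n) DE theta0.
exists T; split=> //.
  apply: le_trans Tw _; apply: lerD; last first.
    by apply: theta_le; rewrite -[leqLHS]muln1 leq_mul.
  apply: le_trans sw _; apply: ler_wpM2l; first by rewrite addr_ge0 // ltW // gain_gt0.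
  by apply: le_trans (subdivision_wt _ _ n0 zeta0) _; rewrite lerD2l.
move=> i x u v iK xY xu xv.
have ru := sr i (corner n x) (corner n u) iK (imset_f _ xY).
have rv := sr i (corner n x) (corner n v) iK (imset_f _ xY).
rewrite !DE in ru rv.
apply: le_trans (Tup _ _ _ (reach_trans (reach_sym (ru xu)) (rv xv))) _.
have := theta_le (#|{: V}| * size s * 2)%N; rewrite leq_mul2r /= leq_mul2l leqnSn orbT => /(_ isT).
by rewrite -/V; lra.
Qed.

End PointDist.

(** * The tree cover *)

Section Powers.
Context (R : realType).
Implicit Types (a d y : R).

Lemma exp2_ge y : 0 <= y -> y <= 2 ^+ (Num.truncn y).+1.
Proof.
move=> y0; apply: le_trans (ltW (truncnS_gt y)) _.
by rewrite -natrX ler_nat ltnW // ltn_expl.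
Qed.

Lemma exp2_between y : 1 <= y -> exists n, y <= 2 ^+ n <= 2 * y.
Proof.
move=> y1; have ex : exists n, y <= 2 ^+ n by exists (Num.truncn y).+1; apply: exp2_ge; lra.
case: (ex_minnP ex) => -[|n] yn min.
  by exists 0%N; rewrite yn expr0; lra.
exists n.+1; rewrite yn exprS ler_pM2l // ltW // ltNge; apply/negP => /min.
by rewrite ltnn.
Qed.

Lemma powR_exp d n : (2 `^ d) ^+ n = (2 ^+ n) `^ d :> R.
Proof. by rewrite -powR_mulrn ?powR_ge0 // powRAC powR_mulrn. Qed.

Lemma exp_le_powR a d m : 1 <= a -> 2^-1 <= d -> a ^+ m <= a `^ ((m.*2)%:R * d).
Proof.
move=> a1 d2; rewrite -powR_mulrn; last by lra.
apply: ler_powR => //; rewrite -muln2 natrM -mulrA -[leLHS]mulr1 ler_wpM2l //; lra.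
Qed.

Lemma expr_powR a d m : 0 <= a -> (a ^+ m) `^ d = a `^ (m%:R * d).
Proof. by move=> a0; rewrite -powR_mulrn // -powRrM. Qed.

Lemma exp10_ge a : 2 <= a -> 1000 <= a ^+ 10.
Proof.
move=> a2; apply: le_trans (_ : 2 ^+ 10 <= _); first by rewrite -natrX ler_nat.
by apply: lerXn2r => //; rewrite nnegrE; lra.
Qed.

(** Here [a = 2 / eps], and [(50 * a)^-1 = eps / 100] is the value chosen for [eta]. The left side
    is below [10 ^ 9 * a ^ 2]. *)
Lemma lightness_bound a : 2 <= a -> 4 * gain (50 * a)^-1 + 6 <= a ^+ 32.
Proof.
move=> a2; have h := exp10_ge a2.
have -> : gain (50 * a)^-1 = 300 * 100 * (50 * 50) * a ^+ 2.
  by rewrite /gain; field; lra.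
have -> : a ^+ 32 = a ^+ 10 * a ^+ 10 * a ^+ 10 * a ^+ 2 by rewrite -!exprD.
have e4 : 4 <= a ^+ 2 by rewrite expr2; nra.
have k0 : 0 <= 1000 :> R by apply: ler0n.
have big := ler_pM (mulr_ge0 k0 k0) k0 (ler_pM k0 k0 h h) h.
move: e4 big; move: (a ^+ 2) (a ^+ 10 * _ * _) => b c b4 cb.
apply: le_trans (_ : 1000 * 1000 * 1000 * b <= _); last by apply: ler_wpM2r cb; lra.
by lra.
Qed.

(** There are at most [a ^ 6] residues and [2 * a ^ (15 * d)] colours. With [2 <= a] and
    [1 / 2 <= d] the product is at most [a ^ (29 * d)]. *)
Lemma count_bound a d n : 2 <= a -> 2^-1 <= d -> 2 ^+ n <= 2 * (300 * 8 * a) ->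
  ((20 + (Num.truncn a).+1) * (Num.truncn ((2 `^ d) ^+ n)).+1)%:R <= a `^ (64 * d).
Proof.
move=> a2 d2 na; have a0 : 0 <= a by lra.
have a1 : 1 <= a by lra.
have d0 : 0 <= d by lra.
have le_a k : 2 ^+ k <= a ^+ k by apply: lerXn2r; rewrite ?nnegrE.
have l_le : (20 + (Num.truncn a).+1)%:R <= a ^+ 6.
  have t_le : (Num.truncn a)%:R <= a by rewrite truncn_le.
  have a5 : 32 <= a ^+ 5 by have := le_a 5; rewrite -natrX.
  rewrite exprS; apply: le_trans (_ : a * 32 <= _); last by rewrite ler_wpM2l.
  by rewrite natrD -natr1; lra.
have base : 2 ^+ n <= a ^+ 15.
  apply: le_trans na _; have h := exp10_ge a2.
  have a4 : 16 <= a ^+ 4 by have := le_a 4; rewrite -natrX.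
  have -> : a ^+ 15 = a ^+ 10 * a ^+ 4 * a by rewrite -exprD -exprSr.
  have := ler_wpM2r a0 (ler_pM (ler0n R 1000) (ler0n R 16) h a4); lra.
have m_le : (Num.truncn ((2 `^ d) ^+ n))%:R <= a `^ (15 * d).
  apply: le_trans (_ : (2 `^ d) ^+ n <= _); first by rewrite truncn_le exprn_ge0 // powR_ge0.
  rewrite powR_exp -expr_powR //; apply: ge0_ler_powR => //; rewrite nnegrE ?exprn_ge0 //.
have p1 : 1 <= a `^ (15 * d).
  by rewrite -[leLHS](powRr0 a); apply: ler_powR => //; rewrite mulr_ge0.
rewrite natrM -natr1; apply: le_trans (_ : a ^+ 6 * (a * a `^ (15 * d)) <= _).
  apply: ler_pM => //.
  by apply: le_trans (_ : 2 * a `^ (15 * d) <= _); [lra|rewrite ler_wpM2r //; lra].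
rewrite mulrA -exprSr.
apply: le_trans (ler_wpM2r (powR_ge0 _ _) (exp_le_powR 7 a1 d2)) _.
rewrite -powRD; last by rewrite (gt_eqF (lt_le_trans ltr01 a1)) implybT.
by apply: ler_powR => //; rewrite -mulrDl -natrD ler_wpM2r // ler_nat.
Qed.

End Powers.

Section Dimension.
Context (R : realType) (X : metricType R) (d : R) (P : {fset X}).
Hypothesis (doubling : doubling_dimension X d).

Lemma dimension_ge0 (u : P) : 0 <= d.
Proof.
have h : #|[set u]|%:R <= (2 `^ d) ^+ 1 :> R.
  apply: (packing doubling (x := u) (r := 1)) => //.
    by move=> y /set1P ->; rewrite point_dist0.
  by move=> y z /set1P -> /set1P ->; rewrite eqxx.
have l2 : 0 < ln (2 : R) by rewrite ln_gt0 // ltr1n.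
have : ln 1 <= ln (2 `^ d : R) by rewrite ler_ln ?posrE ?powR_gt0 //; move: h; rewrite cards1 expr1.
by rewrite ln1 ln_powR pmulr_lge0.
Qed.

(** Two points at distance [p] lie in a ball of radius [2 * p] but in no common ball of radius
    [p / 2]; two halvings therefore need at least two balls, whence [2 <= 2 ^ (2 * d)]. *)
Lemma dimension_ge_half (u v : P) : u != v -> 2^-1 <= d.
Proof.
move=> uv; have p0 : 0 < point_dist u v by rewrite point_dist_gt0.
have h : #|[set u; v]|%:R <= (2 `^ d) ^+ 2 :> R.
  apply: (packing doubling (x := u) (r := 2 * point_dist u v)); first by lra.
    by move=> y /set2P [] ->; rewrite ?point_dist0; lra.
  move=> y z yz zz ny; have -> : point_dist y z = point_dist u v.
    move: yz zz ny => /set2P [->|->] /set2P [->|->]; rewrite ?eqxx //.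
    by rewrite point_distC.
  by rewrite expr2; lra.
have l2 : 0 < ln (2 : R) by rewrite ln_gt0 // ltr1n.
have : ln 2 <= ln ((2 `^ d) `^ 2 : R).
  rewrite ler_ln ?posrE ?powR_gt0 //; move: h; rewrite cards2 uv.
  by rewrite -powR_mulrn // powR_ge0.
by rewrite !ln_powR; nra.
Qed.

End Dimension.

Section TwoPoints.
Context (R : realType) (X : metricType R) (P : {fset X}) (u1 u2 : P) (u12 : u1 != u2).
Implicit Types (u v x y : P) (e : rel P).

Lemma edge_sum_gt0 e : (forall u v, connect e u v) ->
  0 < \sum_u \sum_(v | e u v) point_dist u v.
Proof.
move=> ec; have ge0 u : 0 <= \sum_(v | e u v) point_dist u v.
  by apply: sumr_ge0 => v _; exact: point_dist_ge0.
rewrite lt_def sumr_ge0 // andbT; apply/negP => /eqP s0.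
have step u v : e u v -> u = v.
  move=> uv; apply/eqP; rewrite -[_ == _]negbK -point_dist_gt0; apply/negP => p.
  have /psumr_eq0P u0 := s0; have /psumr_eq0P v0 := u0 (fun w _ => ge0 w) u isT.
  by rewrite (v0 (fun w _ => point_dist_ge0 u w) v uv) ltxx in p.
have /connectP [p pp lp] := ec u1 u2.
have stay q u : path e u q -> last u q = u.
  by elim: q u => //= v q IH u /andP [/step -> /IH].
by have := u12; rewrite lp (stay _ _ pp) eqxx.
Qed.

(** If a minimum spanning tree exists it serves as [e], each edge being counted in both
    orientations. If none exists the bound is vacuous and the complete relation serves. *)
Lemma cheap_connected_graph : exists e, (forall u v, connect e u v) /\
  forall e', minimum_spanning_tree e' ->
    \sum_u \sum_(v | e u v) point_dist u v <= 2 * total_weight e' (@point_dist R X P).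
Proof.
have [[e [et emin]]|no] := pselect (exists e, minimum_spanning_tree e); last first.
  exists [rel u v | true]; split; first by move=> u v; apply: connect1.
  by move=> e' e'm; case: no; exists e'.
exists e; split; first by case: et.
move=> e' [/emin + _]; rewrite /total_weight => h.
by rewrite mulrC -ler_pdivrMr.
Qed.

Lemma min_dist : exists2 m : R, 0 < m & forall u v, u != v -> m <= point_dist u v.
Proof.
exists (\big[Num.min/1]_(q : P * P | q.1 != q.2) point_dist q.1 q.2).
  by apply: lt_bigmin => // q; rewrite point_dist_gt0.
by move=> u v uv; apply: (bigmin_le_cond _ (fun q : P * P => point_dist q.1 q.2) (j := (u, v))).
Qed.

Lemma dyadic_scale m u v : 0 < m -> m <= point_dist u v ->
  exists k, m * 2 ^+ k <= point_dist u v < m * 2 ^+ k.+1.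
Proof.
move=> m0 mu.
have ex : exists k, point_dist u v < m * 2 ^+ k.+1.
  exists (Num.truncn (point_dist u v / m)).+1; rewrite -ltr_pdivrMl // mulrC.
  have q0 : 0 < point_dist u v / m by rewrite divr_gt0 //; lra.
  by have := exp2_ge (ltW q0); rewrite [2 ^+ _.+2]exprS; lra.
case: (ex_minnP ex) => -[|k] kd min; first by exists 0%N; rewrite expr0 mulr1 mu.
exists k.+1; rewrite kd andbT leNgt; apply/negP => /min.
by rewrite ltnn.
Qed.

Lemma tree_dist_refl (T : weighted_tree P) u : tree_dist T u u <= 0.
Proof.
apply: ge_inf; last by exists [::] => //; rewrite /walk_weight big_nil.
exists 0 => _ [p [pp _] <-]; rewrite /walk_weight.
elim: p (Defs.point T u) pp => [|y p IH] x /=; first by rewrite big_nil.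
by move=> /andP [xy yp]; rewrite big_cons addr_ge0 ?IH // ltW // weight_gt0.
Qed.

End TwoPoints.

Section Cover.
Context (R : realType) (X : metricType R) (P : {fset X}) (d eps : R).
Hypotheses (doubling : doubling_dimension X d) (eps0 : 0 < eps) (eps1 : eps < 1).
Implicit Types (u v x y : P) (e : rel P).

(** The net is [eps / 8 * s] separated, and conflicting points lie in a ball of radius [300 * s];
    [packing] then asks for [2 * 300 * s <= 2 ^+ n * (eps / 8 * s)]. The distance [300 * s] is 100
    times the radius [3 * s] used by the trees. *)
Lemma coloured_net n m s : 0 < s -> 300 * 16 <= 2 ^+ n * eps -> (2 `^ d) ^+ n < m.+1%:R ->
  exists (N : {set P}) (f : P -> 'I_m.+1), (forall u, exists2 x, x \in N & point_dist x u < eps / 8 * s) /\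
    {in N &, forall x y, x != y -> f x = f y -> 300 * s <= point_dist x y}.
Proof.
move=> s0 n_ge m_ge.
have sigma0 : 0 < eps / 8 * s by rewrite mulr_gt0 // divr_gt0.
have [N [Nsep Nnear]] := exists_net (@point_distC R X P) (@point_dist0 R X P) sigma0.
pose conflict := [rel x y | [&& x \in N, y \in N & point_dist x y < 300 * s]].
have [||f fP] := @greedy_colouring _ conflict m.
- by move=> x y /=; rewrite andbCA point_distC.
- move=> x; rewrite -ltnS -(ltr_nat R); apply: le_lt_trans m_ge.
  apply: (packing doubling (x := x) (r := 300 * s)).
  + by rewrite mulr_gt0.
  + by move=> y; rewrite inE => /andP [/and3P []].
  move=> y z; rewrite !inE => /andP [/and3P [_ yN _] _] /andP [/and3P [_ zN _] _] yz.
  have p2 : 0 < 2 ^+ n :> R by rewrite exprn_gt0.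
  apply: le_trans (_ : 2 ^+ n * (eps / 8 * s) <= _); last by rewrite ler_pM2l // Nsep.
  have := ler_wpM2r (ltW s0) n_ge; rewrite mulr2n; lra.
exists N, f; split=> // x y xN yN xy fxy; rewrite leNgt; apply/negP => near.
by have := fP x y; rewrite /= xN yN near fxy eqxx => /(_ isT xy).
Qed.

Lemma cover_with_pair u1 u2 : u1 != u2 ->
  exists (k : nat) (T : 'I_k -> weighted_tree P),
    [/\ stretch_tree_cover (1 + eps) T,
        k%:R <= eps_power eps (64 * d),
        individual_lightness_le T (eps_power eps (64 * d)) &
        forall i : 'I_k, max_degree_le (T i) (eps_power eps (64 * d))].
Proof.
move=> u12; have d2 := dimension_ge_half doubling u12.
have [a aE] : exists a, 2 / eps = a by exists (2 / eps).
have ae : a * eps = 2 by rewrite -aE divfK // gt_eqF.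
have a2 : 2 <= a by rewrite -aE ler_pdivlMr //; move: eps0 eps1; lra.
have a1 : 1 <= a by lra.
have power m : (m <= 32)%N -> a ^+ m <= eps_power eps (64 * d).
  move=> m32; apply: le_trans (exp_le_powR m a1 d2) _; rewrite /eps_power aE; apply: ler_powR => //.
  by rewrite ler_pM2r; [rewrite ler_nat; lia|lra].
(* The scales start at or below the smallest distance, so that every pair of distinct points has
   one. *)
have [m0 mdist0 mdist_le] := min_dist P.
pose s k := m0 * 2 ^+ k.
have s0 k : 0 < s k by rewrite mulr_gt0 // exprn_gt0.
have [n /andP [n_lo n_hi]] : exists n, 300 * 8 * a <= 2 ^+ n <= 2 * (300 * 8 * a).
  by apply: exp2_between; lra.
have n_ge : 300 * 16 <= 2 ^+ n * eps.
  by apply: le_trans (_ : 300 * 8 * a * eps <= _); [rewrite -mulrA ae; lra|rewrite ler_wpM2r // ltW].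
pose m := Num.truncn ((2 `^ d : R) ^+ n).
have m_ge : (2 `^ d) ^+ n < m.+1%:R by apply: truncnS_gt.
have [N NP] := choice (fun k => coloured_net (s0 k) n_ge m_ge).
have [f fP] := choice NP.
(* Then [2 ^ l >= 10 ^ 6 * 2 / eps], so scales of equal residue modulo [l] grow by the factor
   required in [rS]. *)
pose l := (20 + (Num.truncn a).+1)%N.
have l_ge : 100 * 100 <= eps / 100 * 2 ^+ l.
  have p10 := @exp10_ge R 2 (lexx 2); have k0 : 0 <= 1000 :> R by apply: ler0n.
  have pa : 2 <= 2 ^+ (Num.truncn a).+1 * eps.
    by rewrite -[leLHS]ae ler_wpM2r // ?(ltW eps0) // exp2_ge //; lra.
  have -> : 2 ^+ l = 2 ^+ 10 * 2 ^+ 10 * 2 ^+ (Num.truncn a).+1 :> R by rewrite -!exprD.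
  move: (2 ^+ 10) p10 (2 ^+ _.+1) pa => b p10 c pa.
  have := ler_pM (mulr_ge0 k0 k0) (ler0n R 2) (ler_pM k0 k0 p10 p10) pa; lra.
have [e [ec e_cheap]] := cheap_connected_graph P.
have := edge_sum_gt0 u12 ec; set M := \sum_u _ => M0.
pose beta := Num.min M (eps * m0 / 10).
have beta0 : 0 < beta by rewrite lt_min M0 divr_gt0 ?mulr_gt0.
have betaM : beta <= M by rewrite ge_min lexx.
have beta_eps : beta <= eps * m0 / 10 by rewrite ge_min lexx orbT.
have scale u v : exists k, u != v -> s k <= point_dist u v < s k.+1.
  have [uv|] := boolP (u != v); last by exists 0%N.
  by have [k kP] := dyadic_scale mdist0 (mdist_le _ _ uv); exists k.
have [kk kkP] := choice (fun q : P * P => scale q.1 q.2).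
pose K := (\max_(q : P * P) kk q).+1.
(* A net point close to [u] is within [eps / 8 * s k + 2 * s k <= 3 * s k] of [v]. *)
pose r j i := 3 * s (i * l + j)%N.
pose Y (c : 'I_l * 'I_m.+1) i := [set x in N (i * l + c.1)%N | f (i * l + c.1)%N x == c.2].
have eta0 : 0 < eps / 100 by rewrite divr_gt0.
have eta1 : eps / 100 <= 1 by move: eps1; lra.
have r0 j i : 0 < r j i by rewrite mulr_gt0.
have rS j i : 100 * (100 * r j i) <= eps / 100 * r j i.+1.
  have -> : r j i.+1 = 2 ^+ l * r j i by rewrite /r /s mulSn -addnA exprD; ring.
  have := ler_wpM2r (ltW (r0 j i)) l_ge; lra.
have Yr c i : {in Y c i &, forall x y, x != y -> 100 * r c.1 i <= point_dist x y}.
  move=> x y; rewrite !inE => /andP [xN /eqP fx] /andP [yN /eqP fy] xy.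
  rewrite /r mulrA -[100 * 3]natrM; apply: (fP _).2 => //; by rewrite fx fy.
have [T TP] := choice (fun c : 'I_l * 'I_m.+1 =>
  light_net_tree u1 K ec eta0 eta1 beta0 (r0 c.1) (rS c.1) (Yr c)).
exists #|{: 'I_l * 'I_m.+1}|, (fun i => T (enum_val i)); split.
- split; first by move=> i u v; case: (TP (enum_val i)).
  move=> u v; have l0 : (0 < l)%N by [].
  have [->|uv] := eqVneq u v.
    exists (enum_rank (Ordinal l0, ord0)); rewrite point_dist0 mulr0; exact: tree_dist_refl.
  set k := kk (u, v); have /andP [k_lo k_hi] := kkP (u, v) uv.
  have [x xN xu] := (fP k).1 u.
  pose c := (Ordinal (ltn_pmod k l0), f k x).
  have kE : (k %/ l * l + c.1)%N = k by rewrite /= -divn_eq.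
  exists (enum_rank c); rewrite enum_rankK.
  have [_ _ _ near] := TP c.
  have kK : (k %/ l < K)%N by rewrite ltnS (leq_trans (leq_div _ _)) // (leq_bigmax (u, v)).
  have xY : x \in Y c (k %/ l)%N by rewrite inE kE xN /=.
  have rk : r c.1 (k %/ l)%N = 3 * s k by rewrite /r kE.
  have xv := point_dist_tri u x v; have sk := s0 k; have e1 := eps1; have e0 := eps0.
  have es : eps * s k <= s k by rewrite ger_pMl // ltW.
  have skS : s k.+1 = 2 * s k by rewrite /s exprS; ring.
  have mk : eps * m0 <= eps * s k.
    rewrite ler_pM2l // /s -[leLHS]mulr1 ler_pM2l //; apply: exprn_ege1; lra.
  have eu : eps * s k <= eps * point_dist u v by rewrite ler_pM2l.
  rewrite -/k in k_lo k_hi; rewrite skS in k_hi.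
  have := near (k %/ l)%N x u v kK xY; rewrite rk.
  have -> : point_dist x u <= 3 * s k by lra.
  have -> : point_dist x v <= 3 * s k by lra.
  (* The error is at most [eps * s k] times [1 / 4 + 48 / 100 + 1 / 10], for the detour through [x],
     the inexactness [16 * eta * r] and [beta]. *)
  move=> /(_ isT isT); lra.
- by rewrite card_prod !card_ord /eps_power aE; apply: count_bound.
- move=> e' e'm i; have [Tw _ _ _] := TP (enum_val i); apply: le_trans Tw _.
  have g0 := gain_gt0 eta0; have cheap := e_cheap _ e'm; rewrite -/M in cheap *.
  have etaE : eps / 100 = (50 * a)^-1.
    by rewrite -aE; field; rewrite gt_eqF.
  have t0 : 0 <= total_weight e' (@point_dist R X P) by lra.
  have := ler_wpM2r t0 (le_trans (lightness_bound a2) (power 32 (leqnn _))).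
  rewrite -etaE; apply: le_trans.
  move: (total_weight _ _) cheap t0 => W cheap t0.
  (* With [g] the gain, [beta <= M] and [M <= 2 * W], the weight is at most
     [(2 * g + 3) * M <= (4 * g + 6) * W]. *)
  have := ler_wpM2l (ltW g0) betaM; have := ler_wpM2l (ltW g0) cheap; lra.
move=> i x; have [_ Tdeg _ _] := TP (enum_val i).
apply: le_trans (_ : 3%:R <= _); first by rewrite ler_nat.
apply: le_trans (_ : a ^+ 2 <= _); last exact: power.
by rewrite expr2; nra.
Qed.

End Cover.

(** For one point the minimum spanning tree has weight 0, so the lightness bound forces a tree of
    weight exactly 0, which the chain construction does not give. *)
Lemma one_vertex_tree (R : realType) (X : metricType R) (P : {fset X}) : (forall u v : P, u = v) ->
  exists T : weighted_tree P, [/\ tree_weight T = 0,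
    forall x, degree (@edge _ _ _ T) x = 0%N & forall u v : P, tree_dist T u v = 0].
Proof.
move=> all_eq; pose no_edge := [rel x y : unit | false].
have tree : is_tree no_edge.
  split; [by []|by rewrite card_unit|by move=> [] []; apply: connect0|].
  by move=> [//|x [//|y c]] _ /andP [].
pose T := @WeightedTree R X P _ no_edge (fun _ _ => 1) (fun=> tt) tree (fun _ _ _ => erefl)
  (fun _ _ (xy : no_edge _ _) => ltac:(done)) (fun u v _ => all_eq u v).
exists T; split.
- by rewrite /tree_weight /total_weight big1 ?mul0r // => x _; rewrite big_pred0.
- by move=> x; apply: eq_card0 => y; rewrite inE.
move=> u v; rewrite /tree_dist /graph_dist.
suff -> : [set walk_weight (@weight _ _ _ T) tt p | p in
    [set p | path no_edge tt p /\ last tt p = tt]]%classic = [set 0]%classic by rewrite inf1.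
apply/seteqP; split=> [_ [[|y p] [//= _ _] <-]|_ ->]; first by rewrite /walk_weight big_nil.
by exists [::] => //; rewrite /walk_weight big_nil.
Qed.

Theorem theorem1p1 (R : realType) :
  exists (C : R) (m : nat), 0 < C /\
  forall (d : R) (X : metricType R) (P : {fset X}) (eps : R),
    doubling_dimension X d -> 0 < eps < 1 ->
    exists (k : nat) (T : 'I_k -> weighted_tree P),
      [/\ stretch_tree_cover (1 + eps) T,
          k%:R <= eps_power eps (C * d * ln (2 + d) ^+ m),
          individual_lightness_le T (eps_power eps (C * d)) &
          forall i : 'I_k, max_degree_le (T i) (eps_power eps (C * d))].
Proof.
(* The sparsity obeys the exponent [64 * d] without a logarithmic factor, hence the power 0. *)
exists 64, 0%N; split=> // d X P eps doubling /andP [eps0 eps1]; rewrite expr0 mulr1.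
have [[u [v uv]]|no_pair] := pselect (exists u v : P, u != v).
  exact: (cover_with_pair doubling eps0 eps1 uv).
have all_eq (u v : P) : u = v.
  by apply/eqP; apply: contrapT => /negP uv; apply: no_pair; exists u, v.
have [[u _]|no_point] := pselect (exists u : P, True); last first.
  have T : 'I_0 -> weighted_tree P by case.
  exists 0%N, T; split; [|exact: powR_ge0|by move=> e _ []|by case].
  by split=> [[]//|u]; case: no_point; exists u.
have [T [Tw Td Tdist]] := one_vertex_tree all_eq.
exists 1%N, (fun=> T); split.
- by split=> [i x y|x y]; [|exists ord0]; rewrite Tdist (all_eq x y) point_dist0 ?mulr0.
- rewrite -[leLHS](powRr0 (2 / eps)); apply: ler_powR.
    by rewrite ler_pdivlMr //; lra.
  by rewrite mulr_ge0 // (dimension_ge0 doubling u).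
- move=> e _ _; rewrite Tw mulr_ge0 ?powR_ge0 // divr_ge0 // sumr_ge0 // => x _.
  by apply: sumr_ge0 => y _; exact: point_dist_ge0.
by move=> _ x; rewrite Td powR_ge0.
Qed.
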